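(* Let $q$ be a prime power and let $T(n,q)$ be the set of $F$-stable maximal tori of $Sp_{2n}(\overline{F_q})$ (equivalently of $SO_{2n+1}(\overline{F_q})$). Then, as formal power series in $u$ and variables $x_r,y_r$, \[ 1+\sum_{n=1}^\infty \frac{u^n}{|Sp_{2n}(F_q)|}\sum_{T\in T(n,q)}\prod_{r=1}^n x_r^{X_r(T)}y_r^{Y_r(T)} = \prod_{k=1}^\infty \exp\left[\frac{x_k u^k}{(q^k-1)2k}+\frac{y_k u^k}{(q^k+1)2k}\right]. \]
   Context: $F$ is the $q$-Frobenius morphism. Each $F$-stable maximal torus $T$ has an associated conjugacy class of the hyperoctahedral group $B_n$ (its type), indexed by a double partition $(\mu,\lambda)$ with $|\mu|+|\lambda|=n$ (parts of $\mu$ = lengths of positive cycles, parts of $\lambda$ = lengths of negative cycles). $X_r(T)$ (resp. $Y_r(T)$) is the number of positive (resp. negative) $r$-cycles of an element of this conjugacy class, i.e. the number of parts of $\mu$ (resp. $\lambda$) equal to $r$. *)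

(* Defs.v *)
From HB Require Import structures.
From mathcomp Require Import all_boot all_order all_algebra all_fingroup.
From mathcomp Require Import monalg mpoly.
From mathcomp Require Import boolp classical_sets fsbigop.

Set Implicit Arguments.
Unset Strict Implicit.
Unset Printing Implicit Defensive.

Import GRing.Theory.
Local Open Scope classical_set_scope.
Local Open Scope ring_scope.

(* Affine algebraic groups are represented by their sets of K-points, as      *)
(* Zariski-closed subgroups of GL_N(K), for K algebraically closed.           *)

Section AlgebraicGroups.
Variable K : closedFieldType.

Definition GL (N : nat) : set 'M[K]_N := [set A | A \in unitmx].

(* The value at A of a polynomial in the N * N matrix entries. *)
Definition eval_entries (N : nat) (P : mpoly (N * N) K) (A : 'M[K]_N) : K :=
  P.@[mxvec A 0].

Definition closed_in_GL (N : nat) (X : set 'M[K]_N) : Prop :=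
  exists I : set (mpoly (N * N) K),
    X = [set A | GL A /\ forall P, I P -> eval_entries P A = 0].

Definition closed_subgroup (N : nat) (G : set 'M[K]_N) : Prop :=
  [/\ closed_in_GL G, G 1%:M,
      forall A B, G A -> G B -> G (A *m B) &
      forall A, G A -> G (invmx A)].

(* The regular functions on a closed X in GL_N are the restrictions to X of   *)
(* the elements of K[a_ij, 1/det].                                            *)
Definition regular_function (N : nat) (X : set 'M[K]_N) (f : 'M[K]_N -> K) : Prop :=
  exists (P : mpoly (N * N) K) (m : nat),
    forall A, X A -> f A = eval_entries P A / \det A ^+ m.

Definition regular_map (M N : nat) (X : set 'M[K]_M) (f : 'M[K]_M -> 'M[K]_N) : Prop :=
  forall i j, regular_function X (fun A => f A i j).

Definition algebraic_group_iso (M N : nat)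
    (G : set 'M[K]_M) (H : set 'M[K]_N) : Prop :=
  exists (f : 'M[K]_M -> 'M[K]_N) (g : 'M[K]_N -> 'M[K]_M),
    [/\ regular_map G f /\ regular_map H g,
        forall A, G A -> H (f A) /\ g (f A) = A,
        forall B, H B -> G (g B) /\ f (g B) = B &
        forall A A', G A -> G A' -> f (A *m A') = f A *m f A'].

(* Gm^d, as the group of invertible diagonal d x d matrices. *)
Definition Gm_power (d : nat) : set 'M[K]_d := [set A | GL A /\ is_diag_mx A].

Definition is_torus (N : nat) (T : set 'M[K]_N) : Prop :=
  closed_subgroup T /\ exists d, algebraic_group_iso (@Gm_power d) T.

Definition is_maximal_torus (N : nat) (G T : set 'M[K]_N) : Prop :=
  [/\ is_torus T, T `<=` G &
      forall S, is_torus S -> S `<=` G -> T `<=` S -> S = T].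

Definition frobenius (q N : nat) (A : 'M[K]_N) : 'M[K]_N :=
  map_mx (fun x => x ^+ q) A.

Definition stable_maximal_tori (q N : nat) (G : set 'M[K]_N) : set (set 'M[K]_N) :=
  [set T | is_maximal_torus G T /\ @frobenius q N @` T = T].

End AlgebraicGroups.

(* Symplectic group, for any ring of coefficients (used over F_q and over its *)
(* algebraic closure).                                                        *)
Definition sp_form (R : comUnitRingType) (n : nat) : 'M[R]_(n + n) :=
  block_mx 0 1%:M (- 1%:M) 0.

Definition symplectic (R : comUnitRingType) (n : nat) (A : 'M[R]_(n + n)) : bool :=
  A^T *m sp_form R n *m A == sp_form R n.

Definition card_Sp (Fq : finFieldType) (n : nat) : nat :=
  #|[pred A : 'M[Fq]_(n + n) | symplectic A]|.

Definition Sp (K : closedFieldType) (n : nat) : set 'M[K]_(n + n) :=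
  [set A | symplectic A].

(* Q(v) = v_0 ^ 2 + \sum_(i < n) v_(1+i) v_(1+n+i).  A quadratic form rather  *)
(* than a bilinear one, so that characteristic 2 is covered; there the        *)
(* determinant condition below is automatic.                                  *)
Definition so_form (K : closedFieldType) (n : nat) (v : 'cV[K]_(1 + (n + n))) : K :=
  v (lshift (n + n) 0) 0 ^+ 2
  + \sum_(i < n) v (rshift 1 (lshift n i)) 0 * v (rshift 1 (rshift n i)) 0.

Definition SO (K : closedFieldType) (n : nat) : set 'M[K]_(1 + (n + n)) :=
  [set A | \det A = 1 /\ forall v, so_form (A *m v) = so_form v].

(* Split maximal tori: diag(t, t^-1) in Sp_2n and diag(1, t, t^-1) in         *)
(* SO_(2n+1), for t in Gm^n(K).                                               *)
Definition sp_diag (K : closedFieldType) (n : nat) (t : 'rV[K]_n) : 'M[K]_(n + n) :=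
  diag_mx (row_mx t (map_mx GRing.inv t)).

Definition so_diag (K : closedFieldType) (n : nat) (t : 'rV[K]_n) :
    'M[K]_(1 + (n + n)) :=
  diag_mx (row_mx (const_mx 1 : 'rV[K]_1) (row_mx t (map_mx GRing.inv t))).

(* Elements of the hyperoctahedral group B_n: (s, e) is the signed            *)
(* permutation sending i to s i if e i = false and to - s i if e i = true.    *)
Definition signed_perm (n : nat) : Type := ('S_n * {ffun 'I_n -> bool})%type.

(* A cycle is positive iff the product of its signs is 1. *)
Definition positive_cycles (n : nat) (w : signed_perm n) (r : nat) : nat :=
  #|[pred C in porbits w.1 | (#|C| == r) && ~~ odd #|[pred i in C | w.2 i]|]|.

Definition negative_cycles (n : nat) (w : signed_perm n) (r : nat) : nat :=
  #|[pred C in porbits w.1 | (#|C| == r) && odd #|[pred i in C | w.2 i]|]|.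

Section TorusTypes.
Variables (K : closedFieldType) (q n N : nat).
(* D parametrizes the split maximal torus T0 = D(Gm^n) of G. *)
Variables (G : set 'M[K]_N) (D : 'rV[K]_n -> 'M[K]_N).

Definition nonzero_coords : set 'rV[K]_n := [set t | forall i, t 0 i != 0].

(* B_n acts on Gm^n by (w t)_(s i) = t_i or t_i^-1 according to e i. *)
Definition signed_act (w : signed_perm n) (t : 'rV[K]_n) : 'rV[K]_n :=
  \row_j (let i := (w.1^-1)%g j in if w.2 i then (t 0 i)^-1 else t 0 i).

(* m normalizes T0 and its class in N(T0)/T0 = B_n is w. *)
Definition weyl_image (m : 'M[K]_N) (w : signed_perm n) : Prop :=
  forall t, nonzero_coords t -> m *m D t *m invmx m = D (signed_act w t).

(* The conjugacy class of B_n attached to T: write T = g T0 g^-1 with g in G, *)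
(* then the class consists of the images in N(T0)/T0 of all such g^-1 F(g).   *)
Definition torus_type (T : set 'M[K]_N) : set (signed_perm n) :=
  [set w | exists g, [/\ G g,
     T = [set g *m D t *m invmx g | t in nonzero_coords] &
     weyl_image (invmx g *m frobenius q g) w]].

Definition type_repr (T : set 'M[K]_N) : signed_perm n :=
  xget (1%g, [ffun => false]) (torus_type T).

Definition torus_X (r : nat) (T : set 'M[K]_N) : nat :=
  positive_cycles (type_repr T) r.

Definition torus_Y (r : nat) (T : set 'M[K]_N) : nat :=
  negative_cycles (type_repr T) r.

End TorusTypes.

(* Polynomials over the rationals in x_0, x_1, ... (indices inl) and          *)
(* y_0, y_1, ... (indices inr).                                               *)
Definition Qxy : Type := {malg rat[{cmonom (nat + nat)%type}]}.
HB.instance Definition _ := GRing.ComAlgebra.on Qxy.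

Definition varx (r : nat) : Qxy := << ucm (inl r) >>.
Definition vary (r : nat) : Qxy := << ucm (inr r) >>.

(* The sum is taken over a finite subset of an infinite type (fsbigop gives 0 *)
(* for infinitely many nonzero terms); there are finitely many F-stable tori. *)
Definition tori_sum (K : closedFieldType) (q n N : nat)
    (G : set 'M[K]_N) (D : 'rV[K]_n -> 'M[K]_N) : Qxy :=
  \sum_(T \in stable_maximal_tori q G)
    \prod_(1 <= r < n.+1)
      (varx r ^+ torus_X q G D r T * vary r ^+ torus_Y q G D r T).

Section FormalPowerSeries.
Variable R : comAlgType rat.

(* Formal power series in u, as sequences of coefficients. *)
Definition fps : Type := nat -> R.

Definition fps_one : fps := fun n => (n == 0%N)%:R.

(* a u^k *)
Definition fps_monomial (a : R) (k : nat) : fps := fun n => if n == k then a else 0.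

Definition fps_mul (f g : fps) : fps :=
  fun n => \sum_(i < n.+1) f i * g (n - i)%N.

(* exp f for f without constant term: f ^ j does not contribute to the        *)
(* coefficient of u ^ n when j > n.                                           *)
Definition fps_exp (f : fps) : fps :=
  fun n => \sum_(j < n.+1) (j`!%:R^-1 : rat) *: iter j (fps_mul f) fps_one n.

(* \prod_(k >= 1) f k = p, with coefficient-wise convergence. *)
Definition fps_infinite_prod (f : nat -> fps) (p : fps) : Prop :=
  forall n, exists m0, forall m, (m0 <= m)%N ->
    (\big[fps_mul/fps_one]_(1 <= k < m.+1) f k) n = p n.

End FormalPowerSeries.

(* 1 + \sum_(n >= 1) S n / |Sp_2n(F_q)| u^n *)
Definition tori_series (Fq : finFieldType) (S : nat -> Qxy) : fps Qxy :=
  fun n => if n == 0%N then 1 else ((card_Sp Fq n)%:R^-1 : rat) *: S n.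

Definition cycle_factor (q k : nat) : fps Qxy :=
  fps_exp (fps_monomial
    ((((q%:R ^+ k - 1) * (2 * k)%N%:R)^-1 : rat) *: varx k
     + (((q%:R ^+ k + 1) * (2 * k)%N%:R)^-1 : rat) *: vary k) k).

Definition is_algebraic_closure (k : fieldType) (K : closedFieldType)
    (iota : {rmorphism k -> K}) : Prop :=
  forall x : K, exists2 P : {poly k}, P != 0 & root (map_poly iota P) x.

(* Main.v *)
(* Both groups G act simply transitively on the hyperbolic families         *)
(* (e_1, f_1, ..., e_n, f_n) of their natural module over K, and everything  *)
(* rests on this. An element of a torus has finite order prime to p, hence   *)
(* is diagonalizable, and a torus of G has a hyperbolic family of common     *)
(* eigenvectors; so the maximal tori are the conjugates g T0 g^-1, and       *)
(* N(T0)/T0 = B_n. For m in G, Lang's theorem for GL_N (an averaging         *)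
(* argument) turns {g in G | g^-1 F(g) = m} into the set of hyperbolic       *)
(* families of a quadratic or symplectic space over F_q; counting these      *)
(* recursively gives |Sp_2n(F_q)| elements for every m and for both groups.  *)
(* With one lift of each w in B_n for m, the fibre of g |-> g T0 g^-1 over   *)
(* a torus of type w has 2^n n! |T_w| elements, where |T_w| is the product   *)
(* of q^r - 1 (positive r-cycles) and q^r + 1 (negative r-cycles). The n-th  *)
(* coefficient is therefore the average over B_n of the product of           *)
(* x_r / (q^r - 1) and y_r / (q^r + 1) over the cycles of w; averaging over  *)
(* signs and splitting off the cycle of a point gives the recursion          *)
(* n h_n = \sum_k c_k h_(n-k), also satisfied by the product of exponentials. *)
From HB Require Import structures.
Require Import Defs.
From mathcomp Require Import all_boot all_order all_algebra all_fingroup all_field.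
From mathcomp Require Import boolp.
From mathcomp Require Import ring zify.

Set Implicit Arguments.
Unset Strict Implicit.
Unset Printing Implicit Defensive.

Import Order.TTheory GRing.Theory Num.Theory.
Local Open Scope ring_scope.

(** * The cycle index of the symmetric and hyperoctahedral groups *)

(** Let $G$ be either group, $T_0$ its split torus and $W = N(T_0)/T_0 = B_n$. Both halves of the
    theorem are instances ([sp_classical_group], [so_classical_group]) of one argument carried out
    from the fields of [classical_group].

    Tori. Every maximal torus is $gT_0g^{-1}$ with $g \in G$ ([torus_is_conj]), and it is $F$-stable
    iff $g^{-1}F(g)$ normalizes $T_0$. Multiplying $g$ by a suitable element of $T_0$ turns
    $g^{-1}F(g)$ into the chosen lift of some $w \in W$; the needed element exists because the
    twisted equations on $T_0$ can be solved cycle by cycle ([card_torus_eq]). So the pairs $(w,g)$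
    of [good_pair] map onto the stable tori ([stable_tori_conj]). There are [hyp_count q n] of them
    over each $w$ ([card_lang]), and $2^n n! |T_w|$ of them over each torus of type $w$
    ([card_fibre]). Hence [sum_stable_tori]: up to the factor [hyp_count q n], the sum over tori is
    the average over $W$ of the type monomial divided by $|T_w|$.

    Points. For $m \in G$, [lang_GL] makes the fixed vectors of $v \mapsto mF(v)$ an $F_q$-form of
    $K^N$, to which the bilinear and quadratic forms descend. Solutions of $mF(y)=y$ in $G$ then
    correspond to hyperbolic families over $F_q$, whose number ([card_hyp_seq]) depends on neither
    $m$ nor the group. With $m=1$ in the symplectic group this number is $|Sp_{2n}(F_q)|$
    ([card_SpE]), so it cancels in both series.

    Series. What remains is the average over $B_n$ of a product over cycles. Averaging over signs
    ([sum_signs]) leaves a cycle index of $S_n$ with weights $c_k$, equal to $n!\,h_n$ with $n h_n =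
    \sum_k c_k h_{n-k}$ ([cycle_sumE]). Applying $u\,d/du$ to the product of exponentials gives the
    same recursion ([prod_exp_theta]), since $c_k$ is $k$ times the coefficient in the $k$-th
    exponent ([mean_torus_weight]). *)

Section CycleIndex.
Variable T : finType.
Implicit Types (A X : {set T}) (s u v : {perm T}) (a x : T).

Lemma porbit_sub A s a : perm_on A s -> a \in A -> porbit s a \subset A.
Proof.
move=> sA aA; apply/subsetP => x /porbitP[i ->].
by elim: i => [|i IHi]; rewrite ?expg0 ?perm1 // expgSr permM perm_closed.
Qed.

Lemma eq_in_porbit A s u x :
  {in A, s =1 u} -> (forall y, y \in A -> u y \in A) -> x \in A ->
  porbit s x = porbit u x.
Proof.
move=> su uA xA.
have H i : (s ^+ i)%g x = (u ^+ i)%g x /\ (u ^+ i)%g x \in A.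
  elim: i => [|i [IHi iA]]; first by rewrite !expg0 !perm1.
  by rewrite !expgSr !permM IHi su //; split=> //; exact: uA.
apply/setP => y; apply/porbitP/porbitP => -[i ->]; exists i; by rewrite (H i).1.
Qed.

Lemma porbit_stable s a x : (s x \in porbit s a) = (x \in porbit s a).
Proof. by rewrite !(porbit_sym _ _ a) -[s x]/((s ^+ 1)%g x) porbit_perm. Qed.

(** Splits off the cycle of [s] through [a]. Multiplication is the inverse map, so that a
    permutation supported in [A] amounts to an orbit $X$ of [a], a cycle on $X$ and a permutation of
    $A \setminus X$. *)
Definition orbit_split A a s : {perm T} * {perm T} :=
  (restr_perm (porbit s a) s, restr_perm (A :\: porbit s a) s).

Lemma stabs_porbit A s a : perm_on A s ->
  s \in 'N(porbit s a | 'P)%g /\ s \in 'N(A :\: porbit s a | 'P)%g.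
Proof.
move=> sA; split; apply/astabsP; rewrite ?inE // => x /=; rewrite /aperm.
  exact: porbit_stable.
by rewrite !in_setD porbit_stable perm_closed.
Qed.

Section SplitAt.
Variables (A X : {set T}) (a : T) (u v : {perm T}).
Hypotheses (XA : X \subset A) (uX : perm_on X u) (vAX : perm_on (A :\: X) v).

Lemma split_mulX x : x \in X -> (u * v)%g x = u x.
Proof. by move=> xX; rewrite permM (out_perm vAX) // !inE perm_closed // xX. Qed.

Lemma split_mulD x : x \notin X -> (u * v)%g x = v x.
Proof. by move=> xX; rewrite permM (out_perm uX). Qed.

Lemma split_perm_on : perm_on A (u * v)%g.
Proof.
apply: perm_onM; apply/subsetP => x.
  by move/(subsetP uX)/(subsetP XA).
by move/(subsetP vAX); rewrite inE => /andP[].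
Qed.

Lemma split_porbitX x : x \in X -> porbit (u * v)%g x = porbit u x.
Proof.
move=> xX; apply: (@eq_in_porbit X) => // [y yX|y yX]; first exact: split_mulX.
by rewrite perm_closed.
Qed.

Lemma split_porbitD x : x \notin X -> porbit (u * v)%g x = porbit v x.
Proof.
move=> xX; apply: (@eq_in_porbit (~: X)); rewrite ?inE // => y; rewrite inE => yX.
  exact: split_mulD.
have [yA|yA] := boolP (y \in A :\: X); last by rewrite (out_perm vAX yA) inE.
by have := perm_closed y vAX; rewrite yA !inE => /andP[].
Qed.

Hypotheses (aX : a \in X) (uaX : porbit u a = X).

Lemma orbit_splitK : orbit_split A a (u * v)%g = (u, v).
Proof.
have [N1 N2] := stabs_porbit a split_perm_on.
rewrite /orbit_split; move: N1 N2; rewrite split_porbitX // uaX => N1 N2.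
congr pair; apply/permP => x.
  have [xX|xX] := boolP (x \in X); first by rewrite restr_permE // split_mulX.
  by rewrite (out_perm (restr_perm_on _ _) xX) (out_perm uX xX).
have [xX|xX] := boolP (x \in A :\: X).
  by rewrite restr_permE // split_mulD //; move: xX; rewrite inE => /andP[].
by rewrite (out_perm (restr_perm_on _ _) xX) (out_perm vAX xX).
Qed.

Lemma split_porbits :
  [set Y in porbits (u * v)%g | Y \subset A] =
  X |: [set Y in porbits v | Y \subset A :\: X].
Proof.
apply/setP => Y; rewrite !inE; apply/andP/orP => [[/imsetP[x _ ->] YA]|].
  have [xX|xX] := boolP (x \in X).
    left; rewrite split_porbitX // -uaX; apply/eqP/eqP.
    by rewrite eq_porbit_mem uaX.
  right; rewrite split_porbitD //.
  rewrite imset_f //=; apply: porbit_sub => //; rewrite inE xX.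
  by apply: (subsetP YA); exact: porbit_id.
case=> [/eqP->|/andP[/imsetP[x _ ->] vx]].
  by rewrite XA -uaX -(split_porbitX aX) imset_f.
have xAX := subsetP vx _ (porbit_id v x).
have [xX xA] : x \notin X /\ x \in A by move: xAX; rewrite inE => /andP[].
split; first by rewrite -(split_porbitD xX) imset_f.
by apply: (subset_trans vx); exact: subsetDl.
Qed.

End SplitAt.

Lemma mul_orbit_split A a s : perm_on A s -> a \in A ->
  let p := orbit_split A a s in
  [/\ perm_on (porbit s a) p.1, perm_on (A :\: porbit s a) p.2,
      porbit p.1 a = porbit s a & (p.1 * p.2)%g = s].
Proof.
move=> sA aA; rewrite /orbit_split /=.
have [N1 N2] := stabs_porbit a sA.
have [uX vX] := (restr_perm_on (porbit s a) s, restr_perm_on (A :\: porbit s a) s).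
split=> //.
  apply: (@eq_in_porbit (porbit s a)); rewrite ?porbit_id // => x xX.
    by rewrite restr_permE.
  by rewrite porbit_stable.
apply/permP => x.
have [xX|xX] := boolP (x \in porbit s a).
  by rewrite (split_mulX uX vX xX) restr_permE.
rewrite (split_mulD _ uX xX).
have [xA|xA] := boolP (x \in A); first by rewrite restr_permE // inE xX.
by rewrite (out_perm vX) ?inE ?(negPf xA) ?andbF // (out_perm sA xA).
Qed.

Definition transitive_on a X := [pred u : {perm T} | perm_on X u & porbit u a == X].

Variable R : comPzSemiRingType.
Implicit Types c : nat -> R.

Definition cycle_sum c A : R :=
  \sum_(s | perm_on A s) \prod_(X in porbits s | X \subset A) c #|X|.

(** Permutations are sorted by the orbit $X$ of [a]; the remaining cycles are those of a permutation
    of $A \setminus X$. *)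
Lemma cycle_sum_split c A a : a \in A ->
  cycle_sum c A = \sum_(X : {set T} | (a \in X) && (X \subset A))
    #|transitive_on a X|%:R * (c #|X| * cycle_sum c (A :\: X)).
Proof.
move=> aA.
rewrite /cycle_sum (partition_big (fun s => porbit s a)
  (fun X : {set T} => (a \in X) && (X \subset A))) /=; last first.
  by move=> s sA; rewrite porbit_id porbit_sub.
apply: eq_bigr => X /andP[aX XA].
rewrite mulr_natl -sumr_const.
under [RHS]eq_bigr do rewrite mulr_sumr.
rewrite pair_big /=.
rewrite (reindex_onto (fun p => (p.1 * p.2)%g) (orbit_split A a)) /=; last first.
  by move=> s /andP[sA _]; have [] := mul_orbit_split sA aA.
have E u v : perm_on A (u * v)%g && (porbit (u * v)%g a == X) &&
   (orbit_split A a (u * v)%g == (u, v)) =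
   (u \in transitive_on a X) && perm_on (A :\: X) v.
  apply/idP/idP => [/andP[/andP[sA /eqP sX] /eqP E]|].
    have [] := mul_orbit_split sA aA; rewrite E sX inE /= => -> -> -> _.
    by rewrite eqxx.
  rewrite inE => /andP[/andP[uX /eqP uaX] vX].
  by rewrite (orbit_splitK XA uX vX aX uaX) (split_perm_on XA uX vX)
    (split_porbitX uX vX aX) uaX !eqxx.
apply: eq_big => [[u v]|[u v]] /=; first exact: E.
rewrite E inE => /andP[/andP[uX /eqP uaX] vX].
have -> : \prod_(X0 in porbits (u * v)%g | X0 \subset A) c #|X0| =
  \prod_(X0 in [set Y in porbits (u * v)%g | Y \subset A]) c #|X0|.
  by apply: eq_bigl => Y; rewrite inE.
rewrite (split_porbits XA uX vX aX uaX) big_setU1 /=.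
  by congr (_ * _); apply: eq_bigl => Y; rewrite inE.
rewrite inE negb_and; apply/orP; right; apply/subsetPn; exists a => //.
by rewrite inE aX.
Qed.

(** Removing [a] puts these subsets in bijection with the subsets of $A \setminus \{a\}$, hence the
    shift from [k] to [k.+1]. *)
Lemma sum_subsets_with A a (f : nat -> R) : a \in A ->
  \sum_(X : {set T} | (a \in X) && (X \subset A)) f #|X| =
  \sum_(k < #|A|) 'C(#|A|.-1, k)%:R * f k.+1.
Proof.
move=> aA.
rewrite (reindex_onto (fun Y => a |: Y) (fun X => X :\ a)) /=; last first.
  by move=> X /andP[aX _]; rewrite setD1K.
have E (Y : {set T}) : (a \in a |: Y) && (a |: Y \subset A) && ((a |: Y) :\ a == Y) =
  (Y \subset A :\ a).
  rewrite setU11 /= subUset sub1set aA /= subsetD1.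
  have [aY|aY] := boolP (a \in Y); last by rewrite setU1K ?eqxx.
  by rewrite andbF; apply/negP => /andP[_ /eqP E]; move: aY; rewrite -E setD11.
have ltA (Y : {set T}) : Y \subset A :\ a -> (#|Y| < #|A|)%N.
  by move=> YA; rewrite (cardsD1 a A) aA ltnS subset_leq_card.
have [N AN] : exists N, #|A| = N.+1 by move: (cardsD1 a A); rewrite aA add1n; eauto.
rewrite AN (partition_big (fun Y : {set T} => inord #|Y| : 'I_N.+1) xpredT) //=.
apply: eq_bigr => k _.
rewrite mulr_natl -[N in 'C(N, _)](_ : #|A :\ a| = N); last first.
  by move: AN; rewrite (cardsD1 a A) aA add1n => -[].
rewrite -cards_draws -sumr_const; apply: eq_big => Y.
  rewrite E inE; apply: andb_id2l => /ltA; rewrite AN => lt.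
  by rewrite -(inj_eq val_inj) /= inordK.
case/andP; rewrite E => YA /eqP <-.
have aY : a \notin Y by move: YA; rewrite subsetD1 => /andP[].
by rewrite cardsU1 aY /= inordK // -AN ltA.
Qed.

Lemma sum_bin_fact n (f : nat -> nat -> R) :
  \sum_(k < n.+1) 'C(n, k)%:R * (k`!%:R * ((n - k)`!%:R * f k (n - k)%N)) =
  n`!%:R * \sum_(k < n.+1) f k (n - k)%N.
Proof.
rewrite mulr_sumr; apply: eq_bigr => k _.
have kn : (k <= n)%N by rewrite -ltnS.
by rewrite -(bin_fact kn) !natrM !mulrA.
Qed.

End CycleIndex.

(** With all weights 1, [cycle_sum_split] expresses $|A|!$ through the numbers of cycles on the
    subsets containing [a]. By induction all terms but that of $A$ itself are known, so that one is
    determined. *)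
Lemma card_transitive_on (T : finType) (a : T) (X : {set T}) :
  a \in X -> #|transitive_on a X| = (#|X|.-1)`!.
Proof.
have [n] := ubnP #|X|; elim: n X => // n IHn A /ltnSE cA aA.
have C1 B : cycle_sum (fun=> 1%N) B = (#|B|)`! :> nat.
  rewrite -card_perm -sum1_card; apply: eq_big => [s|s _]; first by rewrite unfold_in.
  by rewrite big1.
have := cycle_sum_split (fun=> 1%N) aA.
rewrite (bigD1 A) /=; last by rewrite aA subxx.
rewrite setDv !C1 cards0 fact0 !natn.
rewrite (eq_bigr (fun X : {set T} => (#|X|.-1)`! * (#|A| - #|X|)`!)%N); last first.
  move=> Y /andP[/andP[aY YA] YneA]; rewrite C1 natn cardsD.
  have lt : (#|Y| < #|A|)%N by apply: proper_card; rewrite properEneq YneA.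
  by rewrite IHn ?(leq_trans lt cA) // (setIidPr YA) mul1r.
(* The same identity with the conjectured value in every term, including $X = A$; cancelling the
   common terms isolates the case $X = A$. *)
have : (\sum_(X : {set T} | (a \in X) && (X \subset A)) (#|X|.-1)`! * (#|A| - #|X|)`! = #|A|`!)%N.
  rewrite (sum_subsets_with (fun k => (k.-1)`! * (#|A| - k)`!)%N) //.
  have [N AN] : exists N, #|A| = N.+1 by move: (cardsD1 a A); rewrite aA add1n; eauto.
  rewrite AN /=; have := @sum_bin_fact nat N (fun _ _ => 1%N).
  rewrite sumr_const card_ord !natn.
  move=> E; rewrite factS mulnC; apply: etrans E; apply: eq_bigr => k _.
  by rewrite subSS !natn !mulr1.
rewrite (bigD1 A) ?aA ?subxx //= subnn => <- E; have := @addIn _ _ _ E.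
by rewrite fact0 muln1 !mulr1.
Qed.

Section CycleIndexValue.
Variables (R : comPzSemiRingType) (c h : nat -> R).
Hypotheses (h0 : h 0%N = 1)
  (hS : forall n, n.+1%:R * h n.+1 = \sum_(k < n.+1) c k.+1 * h (n - k)%N).

(** For $|A|=N+1$ and $|X|=k+1$, the $\binom{N}{k}$ sets, the $k!$ cycles and the $(N-k)!$ from
    induction multiply to $N!$, which leaves exactly the recursion [hS]. *)
Lemma cycle_sumE (T : finType) (A : {set T}) : cycle_sum c A = #|A|`!%:R * h #|A|.
Proof.
have [n] := ubnP #|A|; elim: n A => // n IHn A /ltnSE cA.
have [->|[a aA]] := set_0Vmem A.
  rewrite cards0 h0 mulr1 /cycle_sum (big_pred1 1%g).
    rewrite big1 // => X /andP[/imsetP[x _ ->]]; rewrite subset0 => /eqP E.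
    by have := porbit_id 1 x; rewrite E inE.
  move=> s; apply/idP/eqP => [s0|->]; last exact: perm_on1.
  by apply: (perm_on_id s0); rewrite cards0.
rewrite (cycle_sum_split c aA).
have [N AN] : exists N, #|A| = N.+1 by move: (cardsD1 a A); rewrite aA add1n; eauto.
rewrite (eq_bigr (fun X : {set T} => (#|X|.-1)`!%:R *
   (c #|X| * ((#|A| - #|X|)`!%:R * h (#|A| - #|X|)%N)))); last first.
  move=> X /andP[aX XA].
  rewrite card_transitive_on // IHn cardsD (setIidPr XA) //.
  have : (0 < #|X|)%N by apply/card_gt0P; exists a.
  move: cA (subset_leq_card XA); lia.
rewrite (sum_subsets_with (fun k => (k.-1)`!%:R *
   (c k * ((#|A| - k)`!%:R * h (#|A| - k)%N)))) // AN /=.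
rewrite factS natrM -mulrA (mulrCA N.+1%:R) hS -(sum_bin_fact N (fun k j => c k.+1 * h j)).
by apply: eq_bigr => k _; rewrite subSS; congr (_ * (_ * _)); rewrite mulrCA.
Qed.

End CycleIndexValue.

Lemma odd_card_pred (T : finType) (X : {set T}) (e : T -> bool) :
  odd #|[pred i in X | e i]| = \big[addb/false]_(i in X) e i.
Proof.
rewrite -sum1_card big_mkcondr /= (big_morph odd oddD (erefl _)).
by apply: eq_bigr => i _; case: (e i).
Qed.

(** * Averaging over signs and invariance under conjugation in the hyperoctahedral group *)

Section CycleWeight.
Variable R : comAlgType rat.
Variable z : nat -> bool -> R.

Definition cycle_weight n (w : signed_perm n) : R :=
  \prod_(X in porbits w.1) z #|X| (odd #|[pred i in X | w.2 i]|).

Definition mean_weight (k : nat) : R := (2%:R^-1 : rat) *: (z k false + z k true).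

(** The parities of the signs on disjoint nonempty blocks are independent and uniformly
    distributed. *)
Lemma sum_signs (T : finType) (D : seq {set T}) : uniq D ->
  {in D, forall X, X != finset.set0} ->
  {in D &, forall X Y : {set T}, X != Y -> [disjoint X & Y]} ->
  \sum_(e : {ffun T -> bool}) \prod_(X <- D) z #|X| (odd #|[pred i in X | e i]|) =
  (2 ^ #|T|)%:R * \prod_(X <- D) mean_weight #|X|.
Proof.
elim: D => [|X D IHD] /=.
  move=> _ _ _; under eq_bigr do rewrite big_nil.
  by rewrite big_nil mulr1 sumr_const card_ffun card_bool.
move=> /andP[XD uD] D0 Ddisj.
have [i0 i0X] : exists i0, i0 \in X by apply/set0Pn/D0; rewrite mem_head.
have {}IHD := IHD uD (fun Y YD => D0 Y (mem_behead (s := X :: D) YD))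
  (fun Y Y' YD YD' => Ddisj Y Y' (mem_behead (s := X :: D) YD) (mem_behead (s := X :: D) YD')).
(* Flipping one sign in [X] is an involution that changes the parity on [X] and on no other
   block. *)
pose fl (e : {ffun T -> bool}) := [ffun i => (i == i0) (+) e i].
have flK : involutive fl by move=> e; apply/ffunP => i; rewrite !ffunE addKb.
have flX e : odd #|[pred i in X | fl e i]| = ~~ odd #|[pred i in X | e i]|.
  rewrite !odd_card_pred (bigD1 i0) //= [in RHS](bigD1 i0) //= ffunE eqxx addTb addNb.
  congr (~~ (_ (+) _)); apply: eq_bigr => i /andP[_ ne]; by rewrite ffunE (negPf ne).
have flD e Y : Y \in D -> odd #|[pred i in Y | fl e i]| = odd #|[pred i in Y | e i]|.
  move=> YD; rewrite !odd_card_pred; apply: eq_bigr => i iY; rewrite ffunE.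
  have [ii|//] := eqVneq i i0.
  have /pred0P/(_ i) : [disjoint X & Y].
    apply: Ddisj; rewrite ?mem_head ?inE ?YD ?orbT //.
    by apply: contraNneq XD => ->.
  by rewrite /= iY ii i0X.
under eq_bigr do rewrite big_cons.
rewrite big_cons mulrCA -IHD mulr_sumr.
set S := LHS.
(* Adding the sum to its image under the flip pairs both parities of [X]; this is where the factor
   $1/2$ of [mean_weight] comes from. *)
have S2 : S + S = \sum_(e : {ffun T -> bool}) (z #|X| false + z #|X| true) *
     \prod_(Y <- D) z #|Y| (odd #|[pred i in Y | e i]|).
  rewrite {2}/S (reindex_inj (inv_inj flK)) /= -big_split /=.
  apply: eq_bigr => e _; rewrite flX.
  have -> : \prod_(Y <- D) z #|Y| (odd #|[pred i in Y | fl e i]|) =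
            \prod_(Y <- D) z #|Y| (odd #|[pred i in Y | e i]|).
    by apply: eq_big_seq => Y YD; rewrite flD.
  by rewrite -mulrDl; case: (odd #|[pred i in X | e i]|); rewrite //= addrC.
under eq_bigr do rewrite -scalerAl.
rewrite -scaler_sumr -S2 -mulr2n -scaler_nat scalerA mulVf ?scale1r //.
Qed.

Lemma sum_cycle_weight (h : nat -> R) : h 0%N = 1 ->
  (forall n, n.+1%:R * h n.+1 = \sum_(k < n.+1) mean_weight k.+1 * h (n - k)%N) ->
  forall n, \sum_(w : 'S_n * {ffun 'I_n -> bool}) cycle_weight (w : signed_perm n) =
    (2 ^ n * n`!)%:R * h n.
Proof.
move=> h0 hS n.
transitivity (\sum_(s : 'S_n) (2 ^ n)%:R * \prod_(X in porbits s) mean_weight #|X|).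
  rewrite -(pair_bigA _ (fun (s : 'S_n) e => cycle_weight ((s, e) : signed_perm n))) /=.
  apply: eq_bigr => s _; rewrite -[n in (2 ^ n)%N]card_ord /cycle_weight /= -[in RHS]big_enum /=.
  rewrite -(sum_signs (D := enum (porbits s))); last 3 first.
  - exact: enum_uniq.
  - move=> X; rewrite mem_enum => /imsetP[x _ ->]; apply/set0Pn; exists x; exact: porbit_id.
  - move=> X Y; rewrite !mem_enum => /imsetP[x _ ->] /imsetP[y _ ->] ne.
    apply/pred0P => i /=; apply: contraNF ne => /andP[].
    by rewrite -!eq_porbit_mem => /eqP <- /eqP <-.
  by apply: eq_bigr => e _; rewrite big_enum.
rewrite -mulr_sumr natrM -mulrA; congr (_ * _).
have := cycle_sumE h0 hS [set: 'I_n]; rewrite cardsT card_ord => <-.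
apply: eq_big => [s|s _]; first by apply/esym/subsetP => x; rewrite inE.
by apply: eq_bigl => X; rewrite subsetT andbT.
Qed.

(* [v w' = w v] in the group of signed permutations. *)
Definition conj_by n (v w' w : signed_perm n) := forall i,
  v.1 (w'.1 i) = w.1 (v.1 i) /\ w'.2 i (+) v.2 (w'.1 i) = v.2 i (+) w.2 (v.1 i).

(** [v] carries the cycles of [w'] to those of [w], preserving lengths and signs. *)
Lemma cycle_weight_conj n (v w' w : signed_perm n) :
  conj_by v w' w -> cycle_weight w' = cycle_weight w.
Proof.
move=> vw.
have vX x : v.1 @: porbit w'.1 x = porbit w.1 (v.1 x).
  have it i : v.1 ((w'.1 ^+ i)%g x) = (w.1 ^+ i)%g (v.1 x).
    elim: i => [|i IHi]; first by rewrite !expg0 !perm1.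
    by rewrite !expgSr !permM (vw _).1 IHi.
  apply/setP => y; apply/imsetP/porbitP => [[t /porbitP[i ->] ->]|[i ->]].
    by exists i; rewrite it.
  by exists ((w'.1 ^+ i)%g x); rewrite ?mem_porbit ?it.
have porbE : porbits w.1 = [set v.1 @: (X : {set _}) | X in porbits w'.1].
  apply/setP => Y; apply/imsetP/imsetP => [[x _ ->]|[X /imsetP[x _ ->] ->]].
    exists (porbit w'.1 ((v.1^-1)%g x)); first exact: imset_f.
    by rewrite vX permKV.
  by exists (v.1 x).
rewrite /cycle_weight porbE [RHS]big_imset /=; last first.
  by move=> X Y _ _; exact: (imset_inj (@perm_inj _ _)).
apply: eq_bigr => X /imsetP[x _ ->].
rewrite card_imset; last exact: perm_inj.
congr (z _ _); rewrite !odd_card_pred [RHS]big_imset /=; last by move=> ? ? _ _; exact: perm_inj.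
(* [w'] permutes its own cycle, so the signs of [v] enter twice over the cycle and cancel. *)
have E : \big[addb/false]_(i in porbit w'.1 x) v.2 (w'.1 i) =
         \big[addb/false]_(i in porbit w'.1 x) v.2 i.
  rewrite [RHS](reindex_inj (@perm_inj _ w'.1)) /=.
  by apply: eq_bigl => i; rewrite porbit_stable.
have : \big[addb/false]_(i in porbit w'.1 x) w'.2 i (+)
    \big[addb/false]_(i in porbit w'.1 x) v.2 (w'.1 i) =
  \big[addb/false]_(i in porbit w'.1 x) v.2 i (+)
    \big[addb/false]_(i in porbit w'.1 x) w.2 (v.1 i).
  by rewrite -!big_split; apply: eq_bigr => i _; exact: (vw i).2.
by rewrite E addbC => /addbI.
Qed.

End CycleWeight.

Lemma type_monomialE (R : comAlgType rat) (x y : nat -> R) n (w : signed_perm n) :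
  \prod_(1 <= r < n.+1) (x r ^+ positive_cycles w r * y r ^+ negative_cycles w r) =
  cycle_weight (fun k b => if b then y k else x k) w.
Proof.
rewrite /cycle_weight.
rewrite (partition_big (fun X : {set 'I_n} => inord #|X| : 'I_n.+1) xpredT) //=.
have c0 (X : {set 'I_n}) : X \in porbits w.1 -> #|X| != 0%N.
  by case/imsetP => i _ ->; exact: card_porbit_neq0.
(* No cycle is empty, so a factor for $r=0$ may be added; the product is then indexed by ['I_n.+1],
   as required by the partition by cycle length. *)
have F0 : x 0%N ^+ positive_cycles w 0 * y 0%N ^+ negative_cycles w 0 = 1.
  rewrite /positive_cycles /negative_cycles !eq_card0 ?expr0 ?mulr1 // => X;
  by rewrite !inE; apply/negP => /and3P[/c0/negP].
transitivity (\prod_(0 <= r < n.+1)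
   (x r ^+ positive_cycles w r * y r ^+ negative_cycles w r)).
  by rewrite [RHS]big_ltn // F0 mul1r.
rewrite big_mkord; apply: eq_bigr => r _.
have cX (X : {set 'I_n}) : (inord #|X| == r) = (#|X| == r).
  by rewrite -(inj_eq val_inj) /= inordK // ltnS -[X in (_ <= X)%N]card_ord max_card.
rewrite (bigID (fun X : {set 'I_n} => odd #|[pred i in X | w.2 i]|)) /= [RHS]mulrC.
congr (_ * _).
  rewrite /positive_cycles -prodr_const; apply: eq_big => X.
    by rewrite inE /= -andbA; congr (_ && (_ && _)); exact/esym/cX.
  by rewrite inE => /and3P[_ /eqP -> /negPf ->].
rewrite /negative_cycles -prodr_const; apply: eq_big => X.
  by rewrite inE /= -andbA; congr (_ && (_ && _)); exact/esym/cX.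
by rewrite inE => /and3P[_ /eqP -> ->].
Qed.

(** * Products of exponentials and the Euler operator $u\,d/du$ *)

Section ExpSeries.
Variable R : comAlgType rat.
Implicit Types (f g : fps R) (b : R) (k n : nat).

Definition fps_shift b k f : fps R := fun n => if (k <= n)%N then b * f (n - k)%N else 0.

Lemma natr_inj_l n (x y : R) : n.+1%:R * x = n.+1%:R * y -> x = y.
Proof.
rewrite -!scaler_nat -!scalerAl !mul1r => /(congr1 (fun v => (n.+1%:R^-1 : rat) *: v)).
by rewrite !scalerA mulVf ?scale1r // pnatr_eq0.
Qed.

Lemma fps_mulC_at f g n : fps_mul f g n = fps_mul g f n.
Proof.
rewrite /fps_mul (reindex_inj rev_ord_inj) /=; apply: eq_bigr => i _.
by rewrite subSS subKn 1?mulrC // -ltnS.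
Qed.

Lemma eq_fps_mul f f' g g' n : (forall i, f i = f' i) -> (forall i, g i = g' i) ->
  fps_mul f g n = fps_mul f' g' n.
Proof. by move=> ff gg; apply: eq_bigr => i _; rewrite ff gg. Qed.

Lemma fps_mul_shiftl b k f g n :
  fps_mul (fps_shift b k f) g n = fps_shift b k (fps_mul f g) n.
Proof.
rewrite /fps_mul /fps_shift; case: leqP => [kn|nk]; last first.
  by rewrite big1 // => i _; rewrite leqNgt (leq_trans (ltn_ord i) nk) mul0r.
rewrite mulr_sumr -(big_mkord xpredT
  (fun i => (if (k <= i)%N then b * f (i - k)%N else 0) * g (n - i)%N)).
rewrite (big_cat_nat (n := k)) //=; last by rewrite ltnW.
rewrite big_nat big1 ?add0r; last first.
  by move=> i /= ik; rewrite leqNgt ik mul0r.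
rewrite -{1}(add0n k) big_addn subSn // big_mkord; apply: eq_bigr => i _.
by rewrite leq_addl addnK mulrA subnDAC subnAC.
Qed.

Lemma fps_mul_shiftr b k f g n :
  fps_mul f (fps_shift b k g) n = fps_shift b k (fps_mul f g) n.
Proof.
rewrite fps_mulC_at fps_mul_shiftl /fps_shift; case: ifP => // _.
by rewrite fps_mulC_at.
Qed.

Lemma fps_mul1l f n : fps_mul (fps_one R) f n = f n.
Proof.
rewrite /fps_mul big_ord_recl /= subn0 /fps_one eqxx mul1r big1 ?addr0 // => i _.
by rewrite /= mul0r.
Qed.

Lemma iter_monomial a k j n :
  iter j (fps_mul (fps_monomial a k)) (fps_one R) n = if n == (j * k)%N then a ^+ j else 0.
Proof.
elim: j n => [|j IHj] n; first by rewrite /= mul0n expr0 /fps_one; case: eqP.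
rewrite iterS (eq_fps_mul (f' := fps_shift a k (fps_one R)) (g' := iter j (fps_mul (fps_monomial a k)) (fps_one R))) //.
  rewrite fps_mul_shiftl /fps_shift fps_mul1l IHj exprS.
  case: (leqP k n) => [kn|nk]; first by
    rewrite mulSn -(eqn_add2l k) subnKC //; case: eqP; rewrite ?mulr0.
  by case: eqP => // E; move: nk; rewrite E mulSn ltnNge leq_addr.
move=> i; rewrite /fps_monomial /fps_shift /fps_one.
case: (leqP k i) => ki; last by rewrite ltn_eqF.
by rewrite subn_eq0 eqn_leq ki andbT; case: leqP; rewrite ?mulr1 ?mulr0.
Qed.

(** Terms with $j > n$ vanish since $n = jk$ forces $j \le n$. The free bound [m] allows sums for
    different degrees to be compared term by term. *)
Lemma fps_exp_monomialE a k n m : (0 < k)%N -> (n < m)%N ->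
  fps_exp (fps_monomial a k) n =
  \sum_(j < m) if n == (j * k)%N then ((j`!%:R^-1 : rat) *: a ^+ j : R) else 0.
Proof.
move=> k0 nm; rewrite /fps_exp.
rewrite (big_ord_widen_cond m xpredT (fun j => ((j`!%:R^-1 : rat) *: (iter j (fps_mul (fps_monomial a k)) (fps_one R) n : R) : R))) //.
rewrite big_mkcond /=; apply: eq_bigr => j _; rewrite iter_monomial.
case: ltnP => nj; first by case: eqP; rewrite ?scaler0.
case: eqP => // E; have : (j <= n)%N by rewrite E leq_pmulr.
by rewrite leqNgt nj.
Qed.

Lemma exp_coef_theta a k j :
  (k + j * k)%:R * (((j.+1)`!%:R^-1 : rat) *: a ^+ j.+1) =
  k%:R * a * ((j`!%:R^-1 : rat) *: a ^+ j) :> R.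
Proof.
rewrite -mulSn -mulrA !mulr_natl -scalerAr -exprS -!scaler_nat !scalerA.
congr (_ *: _); rewrite factS !natrM; field.
by rewrite pnatr_eq0 -lt0n fact_gt0 /= addrC natr1 pnatr_eq0.
Qed.

(** With $\theta = u\,d/du$, this is $\theta \exp(au^k) = k a u^k \exp(au^k)$ read on
    coefficients. *)
Lemma fps_exp_theta a k n : (0 < k)%N ->
  n%:R * fps_exp (fps_monomial a k) n =
  fps_shift (k%:R * a) k (fps_exp (fps_monomial a k)) n.
Proof.
move=> k0; rewrite (fps_exp_monomialE a k0 (ltnSn n)) big_ord_recl /= mul0n.
rewrite /fps_shift mulrDr.
have -> : n%:R * (if n == 0%N then 0`!%:R^-1 *: a ^+ 0 else 0) = 0 :> R.
  by case: eqP => [->|_]; rewrite ?mul0r ?mulr0.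
rewrite add0r mulr_sumr; case: leqP => [kn|nk].
  rewrite (@fps_exp_monomialE a k (n - k) n k0); last by lia.
  rewrite mulr_sumr; apply: eq_bigr => j _ /=.
  have -> : (n - k == j * k)%N = (n == k + j * k)%N.
    by rewrite -(eqn_add2l k) subnKC.
  rewrite /bump /= add1n mulSn; case: eqP => [E|]; last by rewrite !mulr0.
  transitivity ((k + j * k)%:R * (((j.+1)`!%:R^-1 : rat) *: a ^+ j.+1)); last exact: exp_coef_theta.
  by congr (_%:R * _).
rewrite big1 // => j _ /=; case: eqP => [E|]; last by rewrite mulr0.
by have := leq_trans nk (leq_addr (j * k) k); rewrite -mulSn -add1n -E ltnn.
Qed.

(** $\theta$ is a derivation, so the logarithmic derivative of the product is the sum of those of
    its factors. *)
Lemma prod_exp_theta (a : nat -> R) (s : seq nat) n : all (leq 1) s ->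
  let P := \big[@fps_mul R/fps_one R]_(k <- s) fps_exp (fps_monomial (a k) k) in
  P 0%N = 1 /\ n%:R * P n = \sum_(k <- s) fps_shift (k%:R * a k) k P n.
Proof.
elim: s n => [|k s IHs] n /=.
  by rewrite !big_nil /fps_one eqxx; case: eqP => [->|]; rewrite ?mul0r ?mulr0.
case/andP=> k0 s0; rewrite !big_cons.
set P := \big[_/_]_(_ <- _) _; have P0 : P 0%N = 1 := (IHs 0%N s0).1.
have {}IHs i : i%:R * P i = \sum_(k <- s) fps_shift (k%:R * a k) k P i := (IHs i s0).2.
split.
  rewrite /fps_mul big_ord_recl big_ord0 addr0 subn0 P0 mulr1.
  by rewrite (fps_exp_monomialE _ k0 (ltnSn 0)) big_ord_recl big_ord0 /= invr1 scale1r expr0 addr0.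
set E := fps_exp _.
transitivity (fps_mul (fun i => i%:R * E i) P n + fps_mul E (fun i => i%:R * P i) n).
  rewrite /fps_mul -big_split mulr_sumr; apply: eq_bigr => i _ /=.
  have -> : n%:R = i%:R + (n - i)%:R :> R by rewrite -natrD subnKC // -ltnS.
  by rewrite mulrDl mulrA mulrCA.
congr (_ + _).
  rewrite (eq_fps_mul (f' := fps_shift (k%:R * a k) k E) (g' := P)) ?fps_mul_shiftl //.
  by move=> i; exact: fps_exp_theta.
rewrite (eq_fps_mul (f' := E) (g' := fun i => \sum_(l <- s) fps_shift (l%:R * a l) l P i)) //.
transitivity (\sum_(i < n.+1) \sum_(l <- s) E i * fps_shift (l%:R * a l) l P (n - i)%N).
  by apply: eq_bigr => i _; rewrite mulr_sumr.
rewrite exchange_big /=; apply: eq_bigr => l _.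
exact: fps_mul_shiftr.
Qed.

Lemma infinite_prod_exp (a c : nat -> R) (p : fps R) :
  (forall k, c k.+1 = k.+1%:R * a k.+1) -> p 0%N = 1 ->
  (forall n, n.+1%:R * p n.+1 = \sum_(k < n.+1) c k.+1 * p (n - k)%N) ->
  fps_infinite_prod (fun k => fps_exp (fps_monomial (a k) k)) p.
Proof.
(* Only the factors with $k \le n$ reach degree $n$; from there on the partial product obeys the
   recursion of [p]. *)
move=> ca p0 pS n; exists n => m.
have s0 : all (leq 1) (index_iota 1 m.+1).
  by apply/allP => k; rewrite mem_index_iota => /andP[].
have := prod_exp_theta a _ s0; set P := \big[_/_]_(_ <= _ < _) _ => Ptheta.
have [n'] := ubnP n; elim: n' n => // n' IH [|n] ltn nm; first by rewrite p0 (Ptheta 0%N).1.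
apply: (@natr_inj_l n); rewrite (Ptheta n.+1).2 pS.
rewrite -(big_mkord xpredT (fun k => c k.+1 * p (n - k)%N)).
rewrite (big_cat_nat (n := n.+2)) //= [X in _ + X]big_nat [X in _ + X]big1 ?addr0; last first.
  by move=> k /andP[nk _]; rewrite /fps_shift leqNgt nk.
rewrite big_add1 /= big_nat [RHS]big_nat; apply: eq_bigr => k /andP[_ kn].
rewrite /fps_shift kn -ca subSS IH //; lia.
Qed.

End ExpSeries.

(** * Fixed points of a twisted Frobenius on the split torus *)

(** Finite cardinality for predicates on infinite types such as matrices over $K$, witnessed by a
    duplicate-free list. *)
Definition card_is (T : eqType) (P : T -> Prop) (k : nat) : Prop :=
  exists r : seq T, [/\ uniq r, size r = k & forall x, x \in r <-> P x].

Lemma card_is_bij (T U : eqType) (P : T -> Prop) (P' : U -> Prop) k (f : T -> U) :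
  (forall x, P x -> P' (f x)) ->
  (forall x y, P x -> P y -> f x = f y -> x = y) ->
  (forall y, P' y -> exists2 x, P x & f x = y) ->
  card_is P k -> card_is P' k.
Proof.
move=> fP finj fsurj [r [ur <- rP]]; exists (map f r); split.
- by rewrite map_inj_in_uniq // => x y /rP Px /rP Py; exact: finj.
- by rewrite size_map.
- move=> y; split=> [/mapP[x /rP Px ->]|/fsurj[x /rP xr <-]]; first exact: fP.
  exact: map_f.
Qed.

Lemma card_is_eq (T : eqType) (P P' : T -> Prop) k :
  (forall x, P x <-> P' x) -> card_is P k -> card_is P' k.
Proof. by move=> PP [r [ur sr rP]]; exists r; split=> // x; rewrite -PP. Qed.

Lemma card_is_pair_seq (T U : eqType) (r : seq T) (Q : T -> U -> Prop) (l : T -> nat) :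
  uniq r -> (forall x, x \in r -> card_is (Q x) (l x)) ->
  card_is (fun p : T * U => p.1 \in r /\ Q p.1 p.2) (\sum_(x <- r) l x)%N.
Proof.
elim: r => [|x r IHr] /= ur Ql.
  by exists [::]; rewrite big_nil; split=> // p; split=> [|[]]; rewrite in_nil.
case/andP: ur => xr ur.
have [rs [us ss rsP]] := IHr ur (fun y yr => Ql y (mem_behead (s := x :: r) yr)).
have [rx [ux sx rxP]] := Ql x (mem_head _ _).
exists (map (pair x) rx ++ rs); split.
- rewrite cat_uniq map_inj_uniq ?ux ?us /= ?andbT; last by move=> ? ? [].
  apply/hasPn => p /rsP[pr _]; apply/mapP => -[y _ E].
  by move: pr; rewrite E (negPf xr).
- by rewrite size_cat size_map ss sx big_cons.
- move=> [a b] /=; rewrite mem_cat inE; split.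
    case/orP => [/mapP[y /rxP Qy [-> ->]]|/rsP /= [ar Qab]].
      by rewrite eqxx.
    by rewrite ar orbT.
  case=> /orP[/eqP->|ar] Qab; apply/orP.
    by left; apply/map_f/rxP.
  by right; apply/rsP.
Qed.

Lemma card_is_pair (T U : eqType) (P : T -> Prop) (Q : T -> U -> Prop) k l :
  card_is P k -> (forall x, P x -> card_is (Q x) l) ->
  card_is (fun p : T * U => P p.1 /\ Q p.1 p.2) (k * l).
Proof.
move=> [r [ur <- rP]] Ql.
have := @card_is_pair_seq _ _ r Q (fun=> l) ur (fun x xr => Ql x ((rP x).1 xr)).
rewrite big_const_seq count_predT iter_addn_0 mulnC; apply: card_is_eq => p.
by rewrite rP.
Qed.

Lemma card_is_pair_fin (I : finType) (U : eqType) (Q : I -> U -> Prop) (l : I -> nat) :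
  (forall x, card_is (Q x) (l x)) ->
  card_is (fun p : I * U => Q p.1 p.2) (\sum_x l x)%N.
Proof.
move=> Ql; have := @card_is_pair_seq _ _ (enum I) Q l (enum_uniq _) (fun x _ => Ql x).
by rewrite big_enum; apply: card_is_eq => p; rewrite mem_enum; split=> [[]|].
Qed.

Lemma card_is_fin (T : finType) (A : {pred T}) : card_is (fun x => x \in A) #|A|.
Proof.
by exists (enum A); split; rewrite ?enum_uniq -?cardE // => x; rewrite mem_enum.
Qed.

Lemma card_is_inj (T : eqType) (P : T -> Prop) k l : card_is P k -> card_is P l -> k = l.
Proof.
move=> [r [ur <- rP]] [r' [ur' <- rP']]; apply/perm_size/uniq_perm => // x.
by apply/idP/idP => [/rP/rP'|/rP'/rP].
Qed.

Lemma card_is1 (T : eqType) (P : T -> Prop) x : (forall y, P y <-> y = x) -> card_is P 1.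
Proof.
move=> Px; exists [:: x]; split=> // y; rewrite inE Px; split=> [/eqP|->] //.
Qed.

Lemma card_roots (K : closedFieldType) m (c : K) :
  (0 < m)%N -> m%:R != 0 :> K -> c != 0 -> card_is (fun x => x ^+ m = c) m.
Proof.
move=> m0 mK c0; pose P := 'X^m - c%:P : {poly K}.
have szP : size P = m.+1 by exact: size_XnsubC.
have mP : P \is monic by exact: monicXnsubC.
have [r] := closed_field_poly_normal P; rewrite (monicP mP) scale1r => Pr.
exists r; split.
- rewrite -separable_prod_XsubC -Pr unlock.
  apply/coprimepP => d dP dP'.
  have : d %| 'X * P^`() - m%:R *: P.
    by rewrite dvdp_sub ?dvdp_mull // dvdpZr.
  (* A common divisor of $P = X^m - c$ and $P'$ divides $XP' - mP = mc$, a nonzero constant; so $P$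
     is separable. *)
  have -> : 'X * P^`() - m%:R *: P = (m%:R * c)%:P.
    rewrite /P derivB derivXn derivC subr0 mulrnAr -exprS prednK // scaler_nat.
    by rewrite mulrnBl opprB addrCA subrr addr0 mulr_natl polyCMn.
  rewrite -size_poly_eq1 -dvdp1.
  have mc1 : (m%:R * c)%:P %= 1 by rewrite polyC_eqp1 mulf_neq0.
  by rewrite (eqp_dvdr _ mc1).
- by apply/eqP; rewrite -eqSS -szP Pr size_prod_XsubC.
- move=> x; rewrite -root_prod_XsubC -Pr /root /P !hornerE subr_eq0.
  by split=> [/eqP|->].
Qed.

Section TorusEquation.
Variables (K : closedFieldType) (q n : nat).
Hypotheses (q1 : (1 < q)%N) (qK : q%:R = 0 :> K).
Variables (w : signed_perm n) (s : 'I_n -> K).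
Hypothesis s0 : forall i, s i != 0.

Definition inv_if (e : bool) (x : K) := if e then x^-1 else x.

Lemma inv_if_neq0 e x : x != 0 -> inv_if e x != 0.
Proof. by case: e => //; rewrite /= invr_eq0. Qed.

Lemma inv_ifM e x y : inv_if e (x * y) = inv_if e x * inv_if e y.
Proof. by case: e => //=; rewrite invfM. Qed.

Lemma inv_if_addb e e' x : inv_if e (inv_if e' x) = inv_if (e (+) e') x.
Proof. by case: e; case: e' => //=; rewrite invrK. Qed.

Lemma inv_ifX e x m : inv_if e x ^+ m = inv_if e (x ^+ m).
Proof. by case: e => //=; rewrite exprVn. Qed.

(** Coordinate [i] of $t = w(s\,F(t))$ on the split torus: Lang's equation for the twist by [w],
    with parameter [s] (see [lang_torus_eq]). *)
Definition torus_eq_at (t : 'rV[K]_n) i :=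
  t 0 (w.1 i) = inv_if (w.2 i) (s i * t 0 i ^+ q).

Fixpoint orbit_value (a : 'I_n) (x : K) (k : nat) : K :=
  if k is k'.+1 then
    let i := (w.1 ^+ k')%g a in inv_if (w.2 i) (s i * orbit_value a x k' ^+ q)
  else x.

(** Each step of the cycle raises to the power $q$, scales and possibly inverts, so $k$ steps give
    $x \mapsto c\,x^{\pm q^k}$ with the sign the product of the signs met. *)
Lemma orbit_valueE a k : exists2 c, c != 0 & forall x, x != 0 ->
  orbit_value a x k =
  c * inv_if (\big[addb/false]_(0 <= j < k) w.2 ((w.1 ^+ j)%g a)) (x ^+ (q ^ k)).
Proof.
elim: k => [|k [c c0 IHk]].
  by exists 1; rewrite ?oner_neq0 // => x _; rewrite big_geq // mul1r expr1.
set i := (w.1 ^+ k)%g a.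
exists (inv_if (w.2 i) (s i * c ^+ q)); first by rewrite inv_if_neq0 // mulf_neq0 // expf_neq0.
move=> x x0 /=; rewrite IHk // -/i exprMn inv_ifX -exprM mulrA inv_ifM inv_if_addb.
by rewrite -expnSr big_nat_recr //= addbC.
Qed.

Lemma orbit_value_neq0 a x k : x != 0 -> orbit_value a x k != 0.
Proof. by move=> x0; elim: k => //= k IH; rewrite inv_if_neq0 // mulf_neq0 // expf_neq0. Qed.

Definition cycle_order (k : nat) (b : bool) : nat := if b then (q ^ k).+1 else (q ^ k).-1.

Lemma natr_expq k : (0 < k)%N -> (q ^ k)%:R = 0 :> K.
Proof. by case: k => // k _; rewrite expnS natrM qK mul0r. Qed.

(** Closing the cycle means $x^{q^k+1} = c$ (negative) or $x^{q^k-1} = c^{-1}$ (positive); both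
    exponents are prime to the characteristic, so [card_roots] applies. *)
Lemma card_orbit_value a k : (0 < k)%N ->
  card_is (fun x => x != 0 /\ orbit_value a x k = x)
    (cycle_order k (\big[addb/false]_(0 <= j < k) w.2 ((w.1 ^+ j)%g a))).
Proof.
move=> k0; have [c c0 E] := orbit_valueE a k; move: E; set b := \big[_/_]_(_ <= _ < _) _ => E.
have Q1 : (1 < q ^ k)%N by rewrite -(expn0 q) ltn_exp2l.
have Q0 : (0 < q ^ k)%N by exact: ltnW.
rewrite /cycle_order; case: b E => E.
  apply: card_is_eq (@card_roots K (q ^ k).+1 c _ _ c0) => //; last first.
    by rewrite -natr1 natr_expq // add0r oner_neq0.
  move=> x; split=> [xc|[x0]].
    have x0 : x != 0 by apply: contraNneq c0 => x0; rewrite -xc x0 expr0n.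
    by split=> //; rewrite E //= -xc exprS mulfK // expf_neq0.
  by rewrite E //= => Ex; rewrite exprSr -{2}Ex mulrC divfK // expf_neq0.
apply: card_is_eq (@card_roots K (q ^ k).-1 c^-1 _ _ _) => //.
- move=> x; split=> [xc|[x0]].
    have x0 : x != 0.
      apply: contraNneq c0 => x0; rewrite -invr_eq0 -xc x0 expr0n.
      by case: (q ^ k)%N Q1 => [|[]].
    by split=> //; rewrite E //= -(prednK Q0) exprSr xc mulVKf.
  rewrite E //= -{1}(prednK Q0) exprSr mulrA => /(congr1 (fun v => v / x)).
  rewrite mulfK // divff // => H; apply: (mulfI c0); by rewrite H divff.
- by rewrite -subn1 subn_gt0.
- by rewrite -subn1 natrB // natr_expq // sub0r oppr_eq0 oner_neq0.
- by rewrite invr_eq0.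
Qed.

(** Coordinates off [A] are normalized to 1, so that solutions on disjoint unions of cycles multiply
    coordinatewise. *)
Definition torus_sol (A : {set 'I_n}) (t : 'rV[K]_n) := forall i,
  [/\ t 0 i != 0, i \in A -> torus_eq_at t i & i \notin A -> t 0 i = 1].

Lemma porbit_index a j : j \in porbit w.1 a ->
  (index j (traject w.1 a #|porbit w.1 a|) < #|porbit w.1 a|)%N /\
  (w.1 ^+ index j (traject w.1 a #|porbit w.1 a|))%g a = j.
Proof.
rewrite porbit_traject => jX.
have lt : (index j (traject w.1 a #|porbit w.1 a|) < #|porbit w.1 a|)%N.
  by rewrite -[X in (_ < X)%N](size_traject w.1 a) index_mem.
split=> //; rewrite permX -(nth_traject w.1 lt a) nth_index //.
Qed.

(** The coordinate at [a] determines all others along its cycle, subject only to the closing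
    condition. *)
Lemma card_torus_sol1 a : card_is (torus_sol (porbit w.1 a))
  (cycle_order #|porbit w.1 a| (odd #|[pred i in porbit w.1 a | w.2 i]|)).
Proof.
set X := porbit w.1 a.
have X0 : (0 < #|X|)%N by rewrite lt0n card_porbit_neq0.
have -> : odd #|[pred i in X | w.2 i]| =
    \big[addb/false]_(0 <= j < #|X|) w.2 ((w.1 ^+ j)%g a).
  rewrite odd_card_pred -big_enum /=.
  have P : perm_eq (enum X) (traject w.1 a #|X|).
    apply: uniq_perm; rewrite ?enum_uniq ?uniq_traject_porbit // => i.
    by rewrite mem_enum porbit_traject.
  rewrite (perm_big _ P) /= (big_nth a) size_traject.
  by apply: eq_big_nat => j /andP[_ jX]; rewrite nth_traject // permX.
have val_ord j : j \in X -> (index j (traject w.1 a #|X|) < #|X|)%N /\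
    (w.1 ^+ index j (traject w.1 a #|X|))%g a = j by exact: porbit_index.
pose sol x := \row_j (if j \in X then orbit_value a x (index j (traject w.1 a #|X|)) else 1) : 'rV[K]_n.
have aX : a \in X by exact: porbit_id.
have idx k : (k < #|X|)%N -> index ((w.1 ^+ k)%g a) (traject w.1 a #|X|) = k.
  move=> kX; rewrite permX -(nth_traject w.1 kX a) index_uniq ?size_traject //.
  exact: uniq_traject_porbit.
apply: (card_is_bij (f := sol)) (card_orbit_value a X0).
- move=> x [x0 xE] i; rewrite /torus_eq_at !mxE; split.
  + by case: ifP; rewrite ?oner_neq0 // orbit_value_neq0.
  + move=> iX; rewrite porbit_stable iX.
    have [lt E] := val_ord i iX; move: lt E; set k := index i _ => lt E.
    have -> : inv_if (w.2 i) (s i * orbit_value a x k ^+ q) = orbit_value a x k.+1.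
      by rewrite /= E.
    have E1 : w.1 i = (w.1 ^+ k.+1)%g a by rewrite expgSr permM E.
    have [ltS|] := ltnP k.+1 #|X|; first by rewrite E1 idx.
    (* The last point of the cycle, where [w] returns to [a] and the closing condition [xE] is
       used. *)
    rewrite leq_eqVlt ltnNge lt orbF => /eqP kX.
    have -> : w.1 i = (w.1 ^+ 0)%g a by rewrite E1 -kX expg0 perm1 permX iter_porbit.
    by rewrite idx // -kX xE.
  + by move=> iX; rewrite (negPf iX).
- move=> x y _ _ /rowP/(_ a); rewrite !mxE aX.
  by have := idx 0%N X0; rewrite expg0 perm1 => ->.
- move=> t tS.
  have tk k : orbit_value a (t 0 a) k = t 0 ((w.1 ^+ k)%g a).
    elim: k => [|k IHk] /=; first by rewrite expg0 perm1.
    rewrite IHk expgSr permM; apply/esym.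
    by have [_ + _] := tS ((w.1 ^+ k)%g a); apply; exact: mem_porbit.
  exists (t 0 a).
    by split; [case: (tS a)|rewrite tk permX iter_porbit].
  apply/rowP => j; rewrite mxE; case: ifPn => jX; last by case: (tS j) => _ _ ->.
  by rewrite tk (val_ord j jX).2.
Qed.

Lemma card_torus_sol_seq (D : seq {set 'I_n}) : uniq D -> {subset D <= porbits w.1} ->
  card_is (torus_sol (\bigcup_(X <- D) X))
    (\prod_(X <- D) cycle_order #|X| (odd #|[pred i in X | w.2 i]|))%N.
Proof.
elim: D => [|X D IHD] /=.
  move=> _ _; rewrite !big_nil; apply: (@card_is1 _ _ (const_mx 1)) => t; split.
    by move=> tS; apply/rowP => i; rewrite mxE; case: (tS i) => _ _ ->; rewrite ?inE.
  by move=> -> i; rewrite !mxE inE oner_neq0.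
case/andP=> XD uD DP; rewrite !big_cons.
have {}IHD := IHD uD (fun Y YD => DP Y (mem_behead (s := X :: D) YD)).
have /imsetP[a _ Xa] := DP X (mem_head _ _).
set U := \bigcup_(_ <- _) _ in IHD *.
have inU i : (i \in U) = has (fun Y : {set _} => i \in Y) D.
  rewrite /U; elim: (D) => [|Y D' IH] /=; first by rewrite big_nil inE.
  by rewrite big_cons inE IH.
have XU i : i \in X -> i \notin U.
  move=> iX; rewrite inU; apply/hasPn => Y YD; apply: contra XD => iY.
  have /imsetP[b _ Yb] := DP Y (mem_behead (s := X :: D) YD).
  move: iX iY; rewrite Xa Yb -!eq_porbit_mem => /eqP <- /eqP ->.
  by rewrite -Yb.
have Ust i : (w.1 i \in U) = (i \in U).
  rewrite !inU; apply: eq_in_has => Y YD.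
  have /imsetP[b _ ->] := DP Y (mem_behead (s := X :: D) YD).
  exact: porbit_stable.
have Xst i : (w.1 i \in X) = (i \in X) by rewrite Xa porbit_stable.
have HX : card_is (torus_sol X) (cycle_order #|X| (odd #|[pred i in X | w.2 i]|)).
  by rewrite Xa; exact: card_torus_sol1.
pose f (p : 'rV[K]_n * 'rV[K]_n) : 'rV[K]_n := \row_i (p.1 0 i * p.2 0 i).
have fX p i : torus_sol X p.1 /\ torus_sol U p.2 -> i \in X -> f p 0 i = p.1 0 i.
  by move=> [_ pU] iX; rewrite mxE; case: (pU i) => _ _ ->; rewrite ?mulr1 // XU.
have fU p i : torus_sol X p.1 /\ torus_sol U p.2 -> i \notin X -> f p 0 i = p.2 0 i.
  by move=> [pX _] iX; rewrite mxE; case: (pX i) => _ _ ->; rewrite ?mul1r.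
apply: (card_is_bij (f := f)) (card_is_pair HX (fun _ _ => IHD)).
- move=> p pP i; have [p1 p2] := pP.
  have [a1 b1 c1] := p1 i; have [a2 b2 c2] := p2 i.
  split.
  + by rewrite mxE mulf_neq0.
  + rewrite inE /torus_eq_at; have [iX _|iX /= iU] := boolP (i \in X).
      by rewrite !fX ?Xst //; exact: b1.
    by rewrite !fU ?Xst //; exact: b2.
  + by rewrite inE negb_or => /andP[iX iU]; rewrite fU // c2.
- move=> p p' pP pP' E; rewrite [p]surjective_pairing [p']surjective_pairing.
  have [p1 p2] := pP; have [p1' p2'] := pP'.
  congr pair; apply/rowP => i; have [iX|iX] := boolP (i \in X).
  + by rewrite -(fX p) // E fX.
  + by case: (p1 i) => _ _ /(_ iX) ->; case: (p1' i) => _ _ /(_ iX) ->.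
  + by case: (p2 i) => _ _ /(_ (XU i iX)) ->; case: (p2' i) => _ _ /(_ (XU i iX)) ->.
  + by rewrite -(fU p) // E fU.
- move=> t tS.
  exists (\row_i (if i \in X then t 0 i else 1), \row_i (if i \in X then 1 else t 0 i)); last first.
    by apply/rowP => i; rewrite !mxE /=; case: ifP; rewrite ?mulr1 ?mul1r.
  split=> /= i; rewrite /torus_eq_at !mxE; have [t0 tU t1] := tS i; split.
  + by case: ifP; rewrite ?oner_neq0.
  + by move=> iX; rewrite Xst iX; apply: tU; rewrite inE iX.
  + by move/negPf->.
  + by case: ifP; rewrite ?oner_neq0.
  + move=> iU; have iX : i \in X = false by apply: contraTF iU => /XU.
    by rewrite Xst iX; apply: tU; rewrite inE iU orbT.
  + by move=> iU; case: ifPn => // iX; apply: t1; rewrite inE negb_or iX.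
Qed.

Definition torus_order : nat :=
  (\prod_(X in porbits w.1) cycle_order #|X| (odd #|[pred i in X | w.2 i]|))%N.

Lemma card_torus_eq :
  card_is (fun t : 'rV[K]_n => forall i, t 0 i != 0 /\ torus_eq_at t i) torus_order.
Proof.
have sub : {subset enum (porbits w.1) <= porbits w.1} by move=> X; rewrite mem_enum.
rewrite /torus_order -big_enum /=.
apply: card_is_eq (card_torus_sol_seq (enum_uniq _) sub) => t.
have inU i : i \in \bigcup_(X <- enum (porbits w.1)) X.
  rewrite big_enum; apply/bigcupP; exists (porbit w.1 i); rewrite ?porbit_id //.
  exact: imset_f.
split=> tS i; have := tS i; rewrite inU; first by case=> t0 H _; split=> //; exact: H.
by case.
Qed.

End TorusEquation.

(** * Lang's theorem for GL_N *)

Section Frobenius.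
Variables (p e q : nat) (p_prime : prime p) (e_gt0 : (0 < e)%N) (q_def : q = (p ^ e)%N).
Variables (Fq : finFieldType) (card_Fq : #|Fq| = q).
Variables (K : closedFieldType) (iota : {rmorphism Fq -> K}).

Lemma q_gt1 : (1 < q)%N.
Proof. by rewrite q_def -(expn0 p) ltn_exp2l // prime_gt1. Qed.

Lemma pchar_closure : p \in [pchar K].
Proof.
apply: (rmorph_pchar iota); apply: (card_finPcharP (n := e)) => //.
by rewrite card_Fq.
Qed.

Lemma natr_q : q%:R = 0 :> K.
Proof. by rewrite q_def natrX (pcharf0 pchar_closure) expr0n eqn0Ngt e_gt0. Qed.

Lemma frob_rmorphism : {phi : {rmorphism K -> K} | forall x, phi x = x ^+ q}.
Proof.
rewrite q_def; elim: (e) => [|k [f fE]]; first by exists idfun => x; rewrite expn0 expr1.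
exists (pFrobenius_aut pchar_closure \o f) => x /=.
by rewrite fE pFrobenius_autE -exprM expnSr.
Qed.

Definition frob : {rmorphism K -> K} := sval frob_rmorphism.

Lemma frobE x : frob x = x ^+ q. Proof. exact: (svalP frob_rmorphism). Qed.

Lemma frobeniusE N (A : 'M[K]_N) : frobenius q A = map_mx frob A.
Proof. by apply/matrixP => i j; rewrite !mxE frobE. Qed.

Lemma frob_iter x k : iter k frob x = x ^+ (q ^ k).
Proof.
by elim: k => [|k IHk]; rewrite ?expr1 //= IHk frobE -exprM -expnSr.
Qed.

Lemma frob_iota a : frob (iota a) = iota a.
Proof. by rewrite frobE -rmorphXn -card_Fq /= expf_card. Qed.

(** $X^q - X$ is the product of the $X - a$ over $a \in F_q$, so one factor vanishes at [x]. *)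
Lemma frob_fixed x : frob x = x -> exists a, iota a = x.
Proof.
rewrite frobE => xq; have := congr1 (map_poly iota) (finField_genPoly Fq).
rewrite card_Fq rmorphB /= map_polyXn map_polyX rmorph_prod /= => /(congr1 (horner^~ x)).
rewrite !hornerE xq subrr horner_prod => /esym/eqP/prodf_eq0[a _].
rewrite rmorphB /= map_polyX map_polyC !hornerE subr_eq0 => /eqP xa.
by exists a.
Qed.

Lemma frob_surj x : exists y, frob y = x.
Proof.
have q0 : (0 < q)%N by exact: ltnW q_gt1.
have [y] := @solve_monicpoly K q (fun i => if i == 0%N then x else 0) q0.
rewrite -frobE => yE; exists y; rewrite yE; case: (q) q0 => // q' _.
by rewrite big_ord_recl /= expr0 mulr1 big1 ?addr0 // => i _; rewrite mul0r.
Qed.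

Hypothesis K_closure : is_algebraic_closure iota.

(** If $P(x)=0$ with $P$ over $F_q$, the residues of $X^{q^i}$ modulo $P$ lie in a finite set, so
    two of the $x^{q^i}$ coincide; injectivity of Frobenius turns this into a period. *)
Lemma expq_periodic (x : K) : exists2 M, (0 < M)%N & x ^+ (q ^ M) = x.
Proof.
have [P P0 rP] := K_closure x.
have mod_x i : (map_poly iota (('X^i : {poly Fq}) %% P)%R).[x] = x ^+ i.
  rewrite -[RHS]hornerXn -(map_polyXn iota) {2}(divp_eq 'X^i P).
  by rewrite rmorphD rmorphM /= hornerD hornerM (rootP rP) mulr0 add0r.
pose f (i : 'I_(#|'rV[Fq]_(size P)|.+1)) : 'rV[Fq]_(size P) := poly_rV (('X^(q ^ i) : {poly Fq}) %% P)%R.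
have /injectivePn[i [j ij fij]] : ~~ injectiveb f.
  by apply/negP => /injectiveP/leq_card; rewrite card_ord ltnn.
have sz i0 : (size (('X^i0 : {poly Fq}) %% P)%R <= size P)%N by rewrite ltnW // ltn_modp.
have E : x ^+ (q ^ i) = x ^+ (q ^ j).
  by rewrite -!mod_x -(poly_rV_K (sz (q ^ i)%N)) -(poly_rV_K (sz (q ^ j)%N)) -/(f i) fij.
have inj k : injective (fun y : K => y ^+ (q ^ k)).
  by move=> y z; rewrite -!frob_iter; elim: k => //= k IHk /fmorph_inj.
have aux a b : (a < b)%N -> x ^+ (q ^ a) = x ^+ (q ^ b) -> exists2 M, (0 < M)%N & x ^+ (q ^ M) = x.
  move=> ab Eab; exists (b - a)%N; first by rewrite subn_gt0.
  by apply: (inj a); rewrite /= -exprM -expnD subnK ?Eab // ltnW.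
have [ltij|ltji|/val_inj eij] := ltngtP i j; [exact: aux ltij E|exact: aux ltji (esym E)|].
by rewrite eij eqxx in ij.
Qed.

Lemma expq_periodicM (x : K) M k : x ^+ (q ^ M) = x -> x ^+ (q ^ (M * k)) = x.
Proof.
by move=> xM; elim: k => [|k IHk]; rewrite ?muln0 ?expr1 // mulnS expnD exprM xM.
Qed.

Lemma expq_periodic_seq (s : seq K) :
  exists2 M, (0 < M)%N & {in s, forall x, x ^+ (q ^ M) = x}.
Proof.
elim: s => [|x s [M M0 IH]]; first by exists 1%N.
have [M' M'0 xM'] := expq_periodic x.
exists (M' * M)%N; first by rewrite muln_gt0 M0 M'0.
move=> y; rewrite inE => /orP[/eqP->|/IH yM]; first exact: expq_periodicM.
by rewrite mulnC; exact: expq_periodicM.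
Qed.

Lemma natr_expq_pred M : (0 < M)%N -> (q ^ M).-1%:R != 0 :> K.
Proof.
move=> M0; have q0 : (0 < q ^ M)%N by rewrite expn_gt0 (ltnW q_gt1).
rewrite -subn1 natrB // natrX natr_q expr0n eqn0Ngt M0 sub0r.
by rewrite oppr_eq0 oner_neq0.
Qed.

Lemma periodic_order (x : K) M : x != 0 -> (0 < M)%N -> x ^+ (q ^ M) = x -> x ^+ (q ^ M).-1 = 1.
Proof.
move=> x0 M0 xM; apply: (mulfI x0); rewrite -exprS prednK ?mulr1 //.
by rewrite expn_gt0 (ltnW q_gt1).
Qed.

(** All eigenvalues are roots of some $X^m-1$, so the characteristic polynomial divides a power of
    it. Raising to a power of $p$ instead gives $X^{mq^{N+1}}-1$, and Cayley-Hamilton concludes. *)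
Lemma unitmx_finite_order N (A : 'M[K]_N.+1) :
  A \in unitmx -> exists2 k, (0 < k)%N & A ^+ k = 1.
Proof.
move=> Au; have [s sE] := closed_field_poly_normal (char_poly A).
move: sE; rewrite (monicP (char_poly_monic A)) scale1r => sE.
have [M M0 sM] := expq_periodic_seq s.
set m := (q ^ M).-1.
have m0 : (0 < m)%N by rewrite /m -subn1 subn_gt0 -(expn0 q) ltn_exp2l // q_gt1.
have sX x : x \in s -> 'X - x%:P %| 'X^m - 1.
  move=> xs; rewrite dvdp_XsubCl /root !hornerE subr_eq0; apply/eqP.
  apply: periodic_order (sM x xs) => //; apply: contraTneq Au => x0.
  rewrite unitmxE unitfE negbK; have : root (char_poly A) 0 by rewrite sE root_prod_XsubC -x0.
  by rewrite /root horner_coef0 char_poly_det mulf_eq0 signr_eq0.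
have size_s : size s = N.+1.
  by have := size_char_poly A; rewrite sE size_prod_XsubC => -[].
have dv : char_poly A %| ('X^m - 1) ^+ (q ^ N.+1).
  apply: (@dvdp_trans _ (('X^m - 1) ^+ N.+1)).
    rewrite sE -size_s; elim: (s) sX => [|x s' IH] sX; first by rewrite big_nil dvd1p.
    rewrite big_cons /= exprS dvdp_mul ?sX ?mem_head //.
    by apply: IH => y ys; apply: sX; rewrite inE ys orbT.
  by apply: dvdp_exp2l; apply: ltnW; rewrite ltn_expl // q_gt1.
exists (m * q ^ N.+1)%N; first by rewrite muln_gt0 m0 expn_gt0 (ltnW q_gt1).
have pX : p \in [pchar {poly K}] by rewrite pchar_poly pchar_closure.
have chX : [pchar {poly K}].-nat (q ^ N.+1)%N.
  by rewrite q_def -expnM pnatX pnatE // pX.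
move: dv; rewrite exprDn_pchar // exprNn_pchar // expr1n -exprM => /dvdpP[Q EQ].
have := congr1 (horner_mx A) EQ.
rewrite rmorphB rmorphM /= Cayley_Hamilton mulr0 rmorphXn /= horner_mx_X rmorph1.
by move/eqP; rewrite subr_eq0 => /eqP.
Qed.

(** $mF(m)\cdots F^{k-1}(m)$: the $k$-th iterate of $v \mapsto mF(v)$ is $v \mapsto$
    [twisted_power m k] $F^k(v)$. *)
Fixpoint twisted_power N (m : 'M[K]_N) k : 'M[K]_N :=
  if k is k'.+1 then m *m map_mx frob (twisted_power m k') else 1%:M.

Lemma twisted_powerD N (m : 'M[K]_N) i j :
  twisted_power m (i + j) = twisted_power m i *m iter i (map_mx frob) (twisted_power m j).
Proof.
elim: i => [|i IHi]; first by rewrite mul1mx.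
by rewrite addSn /= IHi map_mxM mulmxA.
Qed.

Lemma iter_map_frob m n (A : 'M[K]_(m, n)) k i j :
  iter k (map_mx frob) A i j = A i j ^+ (q ^ k).
Proof.
by elim: k i j => [|k IHk] i j; rewrite ?expr1 //= mxE IHk frobE -exprM -expnSr.
Qed.

Lemma twisted_power_fixed N (m : 'M[K]_N) M :
  iter M (map_mx frob) m = m -> forall k, iter M (map_mx frob) (twisted_power m k) = twisted_power m k.
Proof.
move=> mM; elim=> [|k IHk] /=.
  elim: (M) => //= M' ->; exact: map_mx1.
have itM B C : iter M (map_mx frob) (B *m C) = iter M (map_mx frob) B *m iter M (map_mx frob) C.
  by elim: (M) B C => [|M' IH] B C //=; rewrite IH map_mxM.
by rewrite itM mM -iterSr iterS IHk.
Qed.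

Lemma twisted_powerM N (m : 'M[K]_N.+1) M k : iter M (map_mx frob) m = m ->
  twisted_power m (M * k) = twisted_power m M ^+ k.
Proof.
move=> mM; elim: k => [|k IHk]; first by rewrite muln0 expr0.
by rewrite mulnS twisted_powerD (twisted_power_fixed mM) IHk exprS.
Qed.

Lemma twisted_power_unit N (m : 'M[K]_N) k : m \in unitmx -> twisted_power m k \in unitmx.
Proof.
by move=> mu; elim: k => [|k IHk] /=; rewrite ?unitmx1 // unitmx_mul mu map_unitmx.
Qed.

(** Once $F^M$ fixes [m], twisted powers with exponent a multiple of $M$ are ordinary powers of an
    invertible matrix, which has finite order. *)
Lemma twisted_power1 N (m : 'M[K]_N.+1) : m \in unitmx ->
  exists2 M, (0 < M)%N & twisted_power m M = 1%:M.
Proof.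
move=> mu.
have [M M0 mM] := expq_periodic_seq [seq m ij.1 ij.2 | ij : 'I_N.+1 * 'I_N.+1].
have {}mM : iter M (map_mx frob) m = m.
  apply/matrixP => i j; rewrite iter_map_frob mM //.
  by apply/mapP; exists (i, j); rewrite ?mem_enum.
have [k k0 E] := unitmx_finite_order (twisted_power_unit M mu).
by exists (M * k)%N; rewrite ?muln_gt0 ?M0 // twisted_powerM.
Qed.

(** A polynomial of degree at most $q^{M-1}$ with $q^M$ distinct roots is zero; $c_0$ is its
    coefficient of $X$. *)
Lemma sum_qpoly_eq0 M (c : nat -> K) : (0 < M)%N ->
  (forall x, x ^+ (q ^ M) = x -> \sum_(i < M) c i * x ^+ (q ^ i) = 0) -> c 0%N = 0.
Proof.
move=> M0 cE.
pose P : {poly K} := \sum_(i < M) c i *: 'X^(q ^ i).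
have [r [ur sr rP]] : card_is (fun x : K => x ^+ (q ^ M).-1 = 1) (q ^ M).-1.
  apply: card_roots; rewrite ?natr_expq_pred ?oner_neq0 //.
  by rewrite -subn1 subn_gt0 -(expn0 q) ltn_exp2l // q_gt1.
have qM0 : (0 < q ^ M)%N by rewrite expn_gt0 (ltnW q_gt1).
have szP : (size P <= (q ^ M.-1).+1)%N.
  apply: (leq_trans (size_sum _ _ _)); apply/bigmax_leqP => i _.
  apply: (leq_trans (size_scale_leq _ _)); rewrite size_polyXn ltnS.
  by rewrite leq_exp2l ?q_gt1 // -ltnS prednK.
have P0 : P = 0.
  apply: (@roots_geq_poly_eq0 _ P (0 :: r)).
  - apply/allP => x; rewrite inE => xr; rewrite /root /P horner_sum.
    under eq_bigr do rewrite hornerZ hornerXn.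
    rewrite cE //; case/orP: xr => [/eqP ->|/rP xr].
      by rewrite expr0n eqn0Ngt qM0.
    by rewrite -(prednK qM0) exprS xr mulr1.
  - rewrite /= ur andbT; apply/negP => /rP.
    have := natr_expq_pred M0; case: ((q ^ M).-1) => [|k _]; first by rewrite eqxx.
    by rewrite expr0n => /eqP; rewrite eq_sym oner_eq0.
  - rewrite /= sr prednK // (leq_trans szP) //.
    by rewrite ltn_exp2l ?q_gt1 // prednK.
have := congr1 (fun Q : {poly K} => Q`_1) P0; rewrite coef0 /P coef_sum.
case: M M0 {cE P rP sr ur qM0 szP P0} => // M _.
rewrite big_ord_recl /= coefZ coefXn eqxx mulr1 big1 ?addr0 // => i _.
by rewrite coefZ coefXn /= /bump add1n ltn_eqF ?mulr0 // -(expn0 q) ltn_exp2l // q_gt1.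
Qed.

(** A set of vectors killed by no nonzero linear form contains a basis: a form vanishing on the
    vectors already chosen is nonzero on some further one. *)
Lemma row_free_extract N (S : 'rV[K]_N -> Prop) :
  (forall f : 'cV[K]_N, (forall v, S v -> v *m f = 0) -> f = 0) ->
  forall k, (k <= N)%N -> exists A : 'M[K]_(k, N), row_free A /\ forall i, S (row i A).
Proof.
move=> Sspan; elim=> [|k IHk] kN.
  by exists 0; split=> [|[]//]; rewrite /row_free mxrank0.
have [A [Af AS]] := IHk (ltnW kN).
have [f f0 Af0] : exists2 f : 'cV[K]_N, f != 0 & A *m f = 0.
  have : cokermx A != 0.
    by rewrite -mxrank_eq0 mxrank_coker (eqP Af) subn_eq0 -ltnNge.
  case/matrix0Pn => i [j ij]; exists (col j (cokermx A)).
    by apply/matrix0Pn; exists i, 0; rewrite mxE.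
  by rewrite colE mulmxA mulmx_coker mul0mx.
have [v Sv vf] : exists2 v, S v & v *m f != 0.
  apply: contrapT => H; case/eqP: f0; apply: Sspan => v Sv.
  by apply/eqP; apply: contra_notT H => vf; exists v.
exists (col_mx v A : 'M_(1 + k, N)); split.
  apply: inj_row_free => u; rewrite -[u](@hsubmxK _ 1 1 k).
  set a := lsubmx _; set b := rsubmx _.
  move=> E0; have E : a *m v + b *m A = 0 by rewrite -mul_row_col; exact: E0.
  clear E0.
  have a0 : a = 0.
    have := congr1 (mulmx^~ f) E; rewrite mulmxDl -!mulmxA Af0 mulmx0 addr0 mul0mx.
    rewrite [v *m f]mx11_scalar mul_mx_scalar => /eqP; rewrite scaler_eq0 => /orP[|/eqP//].
    by move/eqP=> vf0; case/eqP: vf; apply/rowP => j; rewrite (ord1 j) vf0 mxE.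
  have : b *m A = 0 by rewrite -E a0 mul0mx add0r.
  move/eqP; rewrite mulmx_free_eq0 // => /eqP ->.
  by rewrite a0 row_mx0.
move=> i; have -> : i = unsplit (@split 1 k i) by rewrite splitK.
case: (split _) => j; rewrite /unsplit ?(@rowKu K 1 k N) ?(@rowKd K 1 k N) //.
by have -> : row j v = v by apply/rowP => l; rewrite mxE (ord1 j).
Qed.

(** The fixed vectors of $v \mapsto mF(v)$ span $K^N$; a basis of them forms the columns of [g]. *)
Lemma lang_GL N (m : 'M[K]_N) : m \in unitmx ->
  exists2 g : 'M[K]_N, g \in unitmx & m *m map_mx frob g = g.
Proof.
case: N m => [|N] m mu.
  by exists 1%:M; rewrite ?unitmx1 //; apply/matrixP => -[].
have [M M0 mM] := twisted_power1 mu.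
pose S (v : 'rV[K]_N.+1) := m *m map_mx frob v^T = v^T.
have Sspan (f : 'cV[K]_N.+1) : (forall v, S v -> v *m f = 0) -> f = 0.
  move=> fS; apply/colP => j; rewrite mxE.
  pose c i := (f^T *m (twisted_power m i *m (delta_mx j 0 : 'cV_N.+1))) 0 0.
  suff : c 0%N = 0 by rewrite /c mul1mx -[f^T *m _]colE !mxE.
  apply: (@sum_qpoly_eq0 M) => // x xM.
  (* The average of the orbit of $x e_j$ under $v \mapsto mF(v)$; the orbit closes up after $M$
     steps because [twisted_power m M] is 1 and $x^{q^M}=x$. A form [f] vanishing on all of them
     yields a $q$-polynomial in $x$ that is zero. *)
  pose w : 'cV[K]_N.+1 := \sum_(i < M) x ^+ (q ^ i) *: (twisted_power m i *m delta_mx j 0).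
  have Sw : S w^T.
    rewrite /S trmxK /w (raddf_sum (map_mx frob)) mulmx_sumr.
    have E i : m *m map_mx frob (x ^+ (q ^ i) *: (twisted_power m i *m delta_mx j 0)) =
       x ^+ (q ^ i.+1) *: (twisted_power m i.+1 *m delta_mx j 0).
      by rewrite map_mxZ map_mxM map_delta_mx -scalemxAr mulmxA frobE -exprM -expnSr.
    under eq_bigr do rewrite E.
    case: (M) M0 mM xM => // M' _ mM xM.
    rewrite big_ord_recr /= [RHS]big_ord_recl /= expr1 xM addrC.
    by rewrite -[m *m map_mx frob _]/(twisted_power m M'.+1) mM.
  have E : f^T *m w = 0 by rewrite -[w]trmxK -trmx_mul fS // trmx0.
  transitivity ((f^T *m w) 0 0); last by rewrite E mxE.
  rewrite /w mulmx_sumr summxE; apply: eq_bigr => i _.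
  by rewrite -scalemxAr mxE mulrC.
have [A [Af AS]] := row_free_extract Sspan (leqnn _).
exists A^T; first by rewrite unitmx_tr -row_free_unit.
apply/matrixP => i j; have := congr1 (fun v : 'cV[K]_N.+1 => v i 0) (AS j).
by rewrite !mxE => <-; apply: eq_bigr => l _; rewrite !mxE.
Qed.

End Frobenius.

(** * Hyperbolic families over a finite field *)

Section QuadSpace.
Variables (R : fieldType) (V : lmodType R) (kap : bool).

(* A space with a quadratic form ([kap] true, [B] being the polar form of [Q]) *)
(* or with an alternating form ([kap] false, [Q] being zero). *)
Definition quad_space (B : V -> V -> R) (Q : V -> R) : Prop :=
  [/\ forall a x y z, B (a *: x + y) z = a * B x z + B y z,
      forall x y, B x y = (-1) ^+ (~~ kap) * B y x,
      forall x, B x x = Q x *+ 2,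
      forall a x y, Q (a *: x + y) = a ^+ 2 * Q x + kap%:R * a * B x y + Q y &
      forall x, ~~ kap -> Q x = 0].

Variables (B : V -> V -> R) (Q : V -> R).
Hypothesis BQ : quad_space B Q.

Definition hyp_pair (p : V * V) := [&& Q p.1 == 0, Q p.2 == 0 & B p.1 p.2 == 1].

Definition orth_pair (p r : V * V) :=
  [&& B p.1 r.1 == 0, B p.1 r.2 == 0, B p.2 r.1 == 0 & B p.2 r.2 == 0].

Definition hyp_seq (s : seq (V * V)) := all hyp_pair s && pairwise orth_pair s.

Lemma formDl a x y z : B (a *: x + y) z = a * B x z + B y z.
Proof. by have [] := BQ. Qed.

Lemma formC x y : B x y = (-1) ^+ (~~ kap) * B y x.
Proof. by have [] := BQ. Qed.

Lemma formxx x : B x x = Q x *+ 2.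
Proof. by have [] := BQ. Qed.

Lemma quadD a x y : Q (a *: x + y) = a ^+ 2 * Q x + kap%:R * a * B x y + Q y.
Proof. by have [] := BQ. Qed.

Lemma quad_kap0 x : ~~ kap -> Q x = 0.
Proof. by have [] := BQ => _ _ _ _; apply. Qed.

Lemma kap_form_quad x : kap%:R * Q x = Q x.
Proof. by case: (boolP kap) => [_|/quad_kap0 ->]; rewrite ?mul1r ?mulr0. Qed.

Lemma formC_eq0 x y : (B x y == 0) = (B y x == 0).
Proof. by rewrite formC mulf_eq0 signr_eq0. Qed.

Lemma formDr a x y z : B z (a *: x + y) = a * B z x + B z y.
Proof. by rewrite formC formDl mulrDr mulrCA -!formC. Qed.

Lemma form0l z : B 0 z = 0.
Proof. by have := formDl 1 0 0 z; rewrite scaler0 addr0 mul1r => /eqP; rewrite -subr_eq0 opprD addNKr oppr_eq0 => /eqP. Qed.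

Lemma form0r z : B z 0 = 0.
Proof. by rewrite formC form0l mulr0. Qed.

Lemma formZr a x z : B z (a *: x) = a * B z x.
Proof. by rewrite -[a *: x]addr0 formDr form0r addr0. Qed.

Lemma formZl a x z : B (a *: x) z = a * B x z.
Proof. by rewrite -[a *: x]addr0 formDl form0l addr0. Qed.

Lemma form_addr x y z : B z (x + y) = B z x + B z y.
Proof. by rewrite -[x]scale1r formDr mul1r scale1r. Qed.

Lemma form_addl x y z : B (x + y) z = B x z + B y z.
Proof. by rewrite -[x]scale1r formDl mul1r scale1r. Qed.

Lemma form_sumr I (r : seq I) (F : I -> V) z : B z (\sum_(i <- r) F i) = \sum_(i <- r) B z (F i).
Proof. by elim: r => [|i r IHr]; rewrite ?big_nil ?form0r // !big_cons form_addr IHr. Qed.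

Lemma form_suml I (r : seq I) (F : I -> V) z : B (\sum_(i <- r) F i) z = \sum_(i <- r) B (F i) z.
Proof. by elim: r => [|i r IHr]; rewrite ?big_nil ?form0l // !big_cons form_addl IHr. Qed.

Lemma quadZ a x : Q (a *: x) = a ^+ 2 * Q x.
Proof.
have Q0 : Q 0 = 0.
  have := quadD 1 0 0; rewrite scaler0 addr0 form0l mulr0 addr0 expr1n mul1r => /eqP.
  by rewrite -subr_eq0 opprD addNKr oppr_eq0 => /eqP.
by rewrite -[a *: x]addr0 quadD form0r mulr0 !addr0 Q0 addr0.
Qed.

Lemma quad0 : Q 0 = 0.
Proof. by rewrite -[X in Q X](scale0r 0) quadZ expr0n mul0r. Qed.

Lemma quad_add x y : Q (x + y) = Q x + kap%:R * B x y + Q y.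
Proof. by rewrite -[x]scale1r quadD expr1n mul1r mulr1 !scale1r. Qed.

Lemma orth_pairC p r : orth_pair p r = orth_pair r p.
Proof.
by rewrite /orth_pair !(formC_eq0 _ p.1) !(formC_eq0 _ p.2); do !case: (_ == 0).
Qed.

Section HyperbolicPair.
Variables (e f : V).
Hypothesis ef : hyp_pair (e, f).

Let Qe : Q e = 0. Proof. by have /and3P[/eqP] := ef. Qed.
Let Qf : Q f = 0. Proof. by have /and3P[_ /eqP] := ef. Qed.
Let Bef : B e f = 1. Proof. by have /and3P[_ _ /eqP] := ef. Qed.

Lemma hyp_formfe : B f e = (-1) ^+ (~~ kap). Proof. by rewrite formC Bef mulr1. Qed.
Lemma hyp_formee : B e e = 0. Proof. by rewrite formxx Qe mul0rn. Qed.
Lemma hyp_formff : B f f = 0. Proof. by rewrite formxx Qf mul0rn. Qed.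

(** The orthogonal projection along the hyperbolic plane of $e, f$; the sign compensates $B(f,e) =
    \pm 1$. *)
Definition perp_proj u := (- B e u) *: f + ((- ((-1) ^+ (~~ kap) * B f u)) *: e + u).

Lemma perp_proj_e u : B e (perp_proj u) = 0.
Proof. by rewrite !formDr Bef hyp_formee mulr0 add0r mulr1 addNr. Qed.

Lemma perp_proj_f u : B f (perp_proj u) = 0.
Proof.
rewrite !formDr hyp_formff hyp_formfe mulr0 add0r mulNr mulrAC -expr2.
by rewrite sqrr_sign mul1r addNr.
Qed.

Lemma perp_projE v u : B v e = 0 -> B v f = 0 -> B v (perp_proj u) = B v u.
Proof. by move=> ve vf; rewrite !formDr ve vf !mulr0 !add0r. Qed.

End HyperbolicPair.

(** Subtracting $Q(f)e$ kills $Q(f)$ without changing the pairing with $e$. *)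
Lemma make_hyp_pair e f : Q e = 0 -> B e f = 1 -> hyp_pair (e, (- Q f) *: e + f).
Proof.
move=> Qe ef; rewrite /hyp_pair /= Qe eqxx quadD Qe mulr0 add0r ef mulr1 mulrN.
rewrite kap_form_quad addNr eqxx formDr ef formxx Qe mul0rn mulr0 add0r eqxx //.
Qed.

End QuadSpace.

(** * Squares in a finite field *)

Section SumOfSquares.
Variable F : finFieldType.

(** Squaring is at most two-to-one and 0 has a single root, so $|F| \le 1 + 2(|S|-1)$. *)
Lemma card_squares : (#|F| < 2 * #|[set x ^+ 2 | x : F]|)%N.
Proof.
set S := [set _ | _ in _].
have S0 : (0 : F) \in S by apply/imsetP; exists 0; rewrite ?inE // expr0n.
have -> : #|F| = (\sum_(y in S) #|[set x : F | x ^+ 2 == y]|)%N.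
  rewrite -sum1_card (partition_big (fun x : F => x ^+ 2) (mem S)) /=; last first.
    by move=> x _; exact: imset_f.
  by apply: eq_bigr => y _; rewrite -sum1_card; apply: eq_bigl => x; rewrite inE.
rewrite (bigD1 0) //= (cardsD1 0 S) S0 mulnDr muln1.
have -> : #|[set x : F | x ^+ 2 == 0]| = 1%N.
  transitivity #|[set (0 : F)]|; last exact: cards1.
  by apply: eq_card => x; rewrite !inE sqrf_eq0.
rewrite add1n addSn add1n !ltnS mulnC -sum_nat_const.
rewrite (eq_bigl (mem (S :\ 0))); last by move=> y; rewrite !inE andbC.
apply: leq_sum => y; rewrite !inE => /andP[_ /imsetP[x _ ->]].
apply: (leq_trans (subset_leq_card (_ : _ \subset [set x; - x]))).
  by apply/subsetP => z; rewrite !inE => zx; rewrite -eqf_sqr.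
by rewrite cards2 ltnS leq_b1.
Qed.

(** The sets of values $as^2$ and $c - bt^2$ each fill more than half of the field, so they meet. *)
Lemma sum_of_squares (a b c : F) : a != 0 -> b != 0 -> exists s t, a * s ^+ 2 + b * t ^+ 2 = c.
Proof.
move=> a0 b0; set S := [set x ^+ 2 | x : F].
pose A := [set a * y | y in S]; pose A' := [set c - b * y | y in S].
have cA : #|A| = #|S| by apply: card_imset; exact: mulfI.
have cA' : #|A'| = #|S|.
  by apply: card_imset => x y /addrI/oppr_inj; exact: mulfI.
have : A :&: A' != finset.set0.
  apply: contraTneq card_squares => AA; rewrite -leqNgt mul2n -addnn -{1}cA -cA'.
  by rewrite -cardsUI AA cards0 addn0 max_card.
case/set0Pn => z; rewrite inE => /andP[/imsetP[y /imsetP[s _ ->] ->] /imsetP[y' /imsetP[t _ ->]]].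
by move=> E; exists s, t; rewrite E subrK.
Qed.

Lemma square_surj_char2 (c : F) : 2%:R = 0 :> F -> exists s, s ^+ 2 = c.
Proof.
move=> F2.
have inj : injective (fun x : F => x ^+ 2).
  move=> x y /eqP; rewrite eqf_sqr => /orP[/eqP//|/eqP ->].
  by apply/eqP; rewrite -subr_eq0 -opprD oppr_eq0 -mulr2n -mulr_natr F2 mulr0.
by have [g _ gK] := injF_bij inj; exists (g c); exact: gK.
Qed.

End SumOfSquares.

(** The choices, in a form of Witt index $n$, of a nonzero singular $e$, then of a partner $f$, then
    of a family in the complement of $\langle e,f\rangle$; equally the order of $Sp_{2n}(F_q)$. *)
Fixpoint hyp_count (q n : nat) : nat :=
  if n is n'.+1 then ((q ^ (2 * n)).-1 * q ^ (2 * n).-1 * hyp_count q n')%N else 1%N.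

(** * The number of hyperbolic families of a nondegenerate space over $F_q$ *)

Section CountHyperbolic.
Variables (F : finFieldType) (N : nat) (kap : bool).
Local Notation V := 'cV[F]_N.
Local Notation q := #|F|.
Variables (B : V -> V -> F) (Q : V -> F).
Hypothesis BQ : quad_space kap B Q.
Implicit Types (U : {set V}) (u v w e f : V).

Definition subspace U := 0 \in U /\ forall a u v, u \in U -> v \in U -> a *: u + v \in U.

(** Only singular vectors are barred from the radical: in characteristic 2 the polar form on an
    odd-dimensional space is alternating, hence has a nonzero radical. *)
Definition nondegenerate U :=
  forall v, v \in U -> (forall u, u \in U -> B v u = 0) -> Q v = 0 -> v = 0.

Lemma subspaceD U u v : subspace U -> u \in U -> v \in U -> u + v \in U.
Proof. by move=> [_ H] uU vU; rewrite -[u]scale1r H. Qed.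

Lemma subspaceZ U a u : subspace U -> u \in U -> a *: u \in U.
Proof. by move=> [U0 H] uU; rewrite -[_ *: _]addr0 H. Qed.

Lemma card_field_gt1 : (1 < q)%N. Proof. exact: finNzRing_gt1. Qed.

(** The level sets of a nonzero linear form are translates of one another. Sizes of subspaces are
    compared in this way, without dimensions. *)
Lemma card_level U v u c : subspace U -> u \in U -> B v u != 0 ->
  (#|[set x in U | B v x == c]| * q)%N = #|U|.
Proof.
move=> Us uU vu.
have same c' : #|[set x in U | B v x == c']| = #|[set x in U | B v x == c]|.
  pose d := ((c' - c) / B v u) *: u.
  rewrite -(card_imset (mem [set x in U | B v x == c]) (addrI d)).
  apply: eq_card => x; apply/idP/imsetP => [|[y + ->]].
    rewrite inE => /andP[xU /eqP xc]; exists (- d + x); last by rewrite addNKr.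
    rewrite inE /= subspaceD // /d -?scaleNr ?subspaceZ //=.
    by rewrite (formDr BQ) xc mulNr divfK // opprB subrK.
  rewrite !inE => /andP[yU /eqP yc]; rewrite subspaceD ?subspaceZ //=.
  by rewrite (formDr BQ) yc divfK // subrK.
rewrite mulnC -sum_nat_const -[RHS]sum1_card (partition_big (B v) xpredT) //=.
by apply: eq_bigr => c' _; rewrite -(same c') -sum1_card; apply: eq_bigl => x; rewrite inE.
Qed.

Definition perp U v := [set x in U | B v x == 0].

Lemma perp_subspace U v : subspace U -> subspace (perp U v).
Proof.
move=> Us; split; first by rewrite inE Us.1 (form0r BQ) eqxx.
move=> a x y; rewrite !inE => /andP[xU /eqP x0] /andP[yU /eqP y0].
by rewrite Us.2 //= (formDr BQ) x0 y0 mulr0 addr0.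
Qed.

Lemma card_perp_ge U v : subspace U -> (#|U| <= #|perp U v| * q)%N.
Proof.
move=> Us; have [/existsP[u /andP[uU vu]]|/existsPn H] := boolP [exists u, (u \in U) && (B v u != 0)].
  by rewrite (card_level 0 Us uU vu).
have -> : perp U v = U.
  by apply/setP => x; rewrite inE; case: (boolP (x \in U)) (H x) => //= _; rewrite negbK.
by rewrite leq_pmulr // ltnW // card_field_gt1.
Qed.

Lemma exists_notin_line U v : (q < #|U|)%N -> exists2 x, x \in U & forall a, x != a *: v.
Proof.
move=> qU; have : ~~ (U \subset [set a *: v | a : F]).
  apply: contraL qU => /subset_leq_card le; rewrite -leqNgt (leq_trans le) //.
  exact: leq_imset_card.
case/subsetPn => x xU xL; exists x => // a; apply: contraNneq xL => ->.
exact: imset_f.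
Qed.

Lemma exists_neq0 U : (1 < #|U|)%N -> exists2 x, x \in U & x != 0.
Proof.
move=> U1; have : ~~ (U \subset [set 0]).
  by apply: contraL U1 => /subset_leq_card; rewrite cards1 -leqNgt.
by case/subsetPn => x xU; rewrite inE => x0; exists x.
Qed.

(** Chevalley's theorem for a quadratic form in three variables. Two orthogonal vectors suffice in
    characteristic 2, where every element is a square; otherwise three are used, with
    [sum_of_squares]. *)
Lemma exists_singular U : subspace U -> (q ^ 3 <= #|U|)%N ->
  exists2 v, v \in U & v != 0 /\ Q v = 0.
Proof.
move=> Us U3.
have q1 := card_field_gt1; have q0 := ltnW q1.
have c1 v : (q ^ 2 <= #|perp U v|)%N.
  by rewrite -(leq_pmul2r q0) -expnSr (leq_trans U3) // card_perp_ge.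
have [u uU u0] : exists2 x, x \in U & x != 0.
  by apply: exists_neq0; apply: leq_trans U3; rewrite -(expn0 q) ltn_exp2l.
have [Qu|Qu] := eqVneq (Q u) 0; first by exists u.
have [v + vu] : exists2 x, x \in perp U u & forall a, x != a *: u.
  by apply: exists_notin_line; apply: leq_trans (c1 u); rewrite -{1}(expn1 q) ltn_exp2l.
rewrite inE => /andP[vU /eqP Buv].
have v0 : v != 0 by have := vu 0; rewrite scale0r.
have [Qv|Qv] := eqVneq (Q v) 0; first by exists v.
have [F2|F2] := eqVneq (2%:R : F) 0.
  have [s sE] := square_surj_char2 (- Q v / Q u) F2.
  exists (s *: u + v); first exact: Us.2.
  split; last by rewrite (quadD BQ) Buv mulr0 addr0 sE divfK // addNr.
  by apply: contraTneq (vu (- s)) => E; rewrite scaleNr negbK -subr_eq0 opprK addrC E.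
have c2 : (q <= #|perp (perp U u) v|)%N.
  rewrite -(leq_pmul2r q0) -[X in (X <= _)%N]/(q ^ 2)%N (leq_trans (c1 u)) //.
  exact/card_perp_ge/perp_subspace.
have [w + w0] := exists_neq0 (leq_trans q1 c2).
rewrite !inE -andbA => /and3P[wU /eqP Buw /eqP Bvw].
have [Qw|Qw] := eqVneq (Q w) 0; first by exists w.
have [s [t st]] := sum_of_squares (- Q w) Qu Qv.
have Bvu : B v u = 0 by apply/eqP; rewrite (formC_eq0 BQ) Buv.
exists (s *: u + (t *: v + w)).
  by apply: Us.2 => //; exact: Us.2.
split; last first.
  rewrite !(quadD BQ) (formDr BQ) Buv Buw Bvw !mulr0 !addr0 mulr0 addr0.
  by rewrite addrA [s ^+ 2 * _]mulrC [t ^+ 2 * _]mulrC st addNr.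
(* Pairing a vanishing combination with [u] and with [v] gives $s=t=0$, since $B(u,u)=2Q(u)$ and
   $B(v,v)=2Q(v)$ are nonzero. *)
apply: contra_neq w0 => E.
have Q2 x : Q x != 0 -> B x x != 0.
  by move=> Qx; rewrite (formxx BQ) -mulr_natl mulf_neq0.
have s0 : s = 0.
  have : B u (s *: u + (t *: v + w)) = 0 by rewrite E (form0r BQ).
  rewrite !(formDr BQ) Buv Buw mulr0 !addr0 => /eqP; rewrite mulf_eq0 => /orP[/eqP//|].
  by rewrite (negPf (Q2 _ Qu)).
have t0 : t = 0.
  have : B v (s *: u + (t *: v + w)) = 0 by rewrite E (form0r BQ).
  rewrite !(formDr BQ) Bvu Bvw mulr0 addr0 add0r => /eqP; rewrite mulf_eq0 => /orP[/eqP//|].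
  by rewrite (negPf (Q2 _ Qv)).
by move: E; rewrite s0 t0 !scale0r !add0r.
Qed.

Section Complement.
Variables (U : {set V}) (e f : V).
Hypotheses (Us : subspace U) (Und : nondegenerate U) (eU : e \in U) (fU : f \in U).
Hypothesis ef : hyp_pair B Q (e, f).

Definition hyp_perp := perp (perp U e) f.

Let Bef : B e f = 1. Proof. by have /and3P[_ _ /eqP] := ef. Qed.
Let Qe : Q e = 0. Proof. by have /and3P[/eqP] := ef. Qed.
Let Qf : Q f = 0. Proof. by have /and3P[_ /eqP] := ef. Qed.

Lemma hyp_perpP x : reflect [/\ x \in U, B e x = 0 & B f x = 0] (x \in hyp_perp).
Proof.
rewrite !inE -andbA; apply: (iffP and3P) => -[xU xe xf]; split=> //; exact/eqP.
Qed.

Lemma hyp_perp_subspace : subspace hyp_perp.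
Proof. exact/perp_subspace/perp_subspace. Qed.

Lemma card_hyp_perp : (#|hyp_perp| * q ^ 2)%N = #|U|.
Proof.
rewrite -(@card_level U e f 0) //; last by rewrite Bef oner_neq0.
rewrite -(@card_level (perp U e) f e 0) ?expnS ?mulnA ?expn0 ?muln1 //.
- exact: perp_subspace.
- by rewrite inE eU (hyp_formee BQ ef) eqxx.
- by rewrite (hyp_formfe BQ ef) signr_eq0.
Qed.

Lemma perp_proj_in u : u \in U -> perp_proj kap B e f u \in hyp_perp.
Proof.
move=> uU; apply/hyp_perpP; split.
- by apply: Us.2 => //; exact: Us.2.
- exact: (perp_proj_e BQ ef).
- exact: (perp_proj_f BQ ef).
Qed.

(** For [v] in the complement, pairing with [u] equals pairing with its projection, so a radical
    vector of the complement is radical in [U]. *)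
Lemma hyp_perp_nondegenerate : nondegenerate hyp_perp.
Proof.
move=> v vU' vB Qv; have /hyp_perpP[vU ve vf] := vU'.
have Bve : B v e = 0 by apply/eqP; rewrite (formC_eq0 BQ) ve.
have Bvf : B v f = 0 by apply/eqP; rewrite (formC_eq0 BQ) vf.
by apply: Und => // u uU; rewrite -(perp_projE BQ u Bve Bvf) vB ?perp_proj_in.
Qed.

End Complement.

Lemma nondegenerate_partner U e : subspace U -> nondegenerate U -> e \in U -> e != 0 -> Q e = 0 ->
  exists2 f, f \in U & hyp_pair B Q (e, f).
Proof.
move=> Us Und eU e0 Qe.
have [/existsP[u /andP[uU eu]]|/existsPn H] := boolP [exists u, (u \in U) && (B e u != 0)].
  pose f := (B e u)^-1 *: u.
  have fU : f \in U by exact: subspaceZ.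
  exists (- Q f *: e + f); first exact: Us.2.
  by apply: (make_hyp_pair BQ) => //; rewrite (formZr BQ) mulVf.
case/eqP: e0; apply: Und => // u uU; apply/eqP; have := H u; by rewrite uU negbK.
Qed.

(** Alternating case: every vector is singular. Quadratic case: induction by splitting off a
    hyperbolic plane; in dimension one, a nonzero singular vector would have a partner and force
    $q^2 \le q$. *)
Lemma card_singular n U : subspace U -> nondegenerate U -> #|U| = (q ^ (2 * n + kap))%N ->
  #|[set v in U | Q v == 0]| = (q ^ (2 * n))%N.
Proof.
have q1 := card_field_gt1; have q0 := ltnW q1.
have [k0|k1] : ~~ kap \/ kap by case: kap; [right|left].
  move=> _ _; rewrite (negPf k0) addn0 => <-; apply: eq_card => v; rewrite inE.
  by rewrite (quad_kap0 BQ) // eqxx andbT.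
elim: n U => [|n IHn] U Us Und cU.
  rewrite muln0 expn0; apply/eqP/cards1P; exists 0; apply/setP => v; rewrite !inE.
  apply/andP/eqP => [[vU /eqP Qv]|->]; last first.
    by rewrite Us.1 (quad0 BQ) eqxx.
  apply/eqP; apply: contraT => v0.
  have [f fU ef] := nondegenerate_partner Us Und vU v0 Qv.
  have c0 : (0 < #|hyp_perp U v f|)%N.
    by apply/card_gt0P; exists 0; exact: (hyp_perp_subspace _ _ Us).1.
  have := card_hyp_perp Us vU fU ef; rewrite cU k1 muln0 add0n expn1 => E.
  have : (q ^ 2 <= q ^ 1)%N by rewrite expn1 -[X in (_ <= X)%N]E leq_pmull.
  by rewrite leq_exp2l.
have [e eU [e0 Qe]] : exists2 v, v \in U & v != 0 /\ Q v = 0.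
  by apply: exists_singular; rewrite // cU leq_exp2l // k1; lia.
have [f fU ef] := nondegenerate_partner Us Und eU e0 Qe.
have Bef : B e f = 1 by have /and3P[_ _ /eqP] := ef.
have Qf : Q f = 0 by have /and3P[_ /eqP] := ef.
set U' := hyp_perp U e f.
have cU' : #|U'| = (q ^ (2 * n + kap))%N.
  have := card_hyp_perp Us eU fU ef; rewrite cU -/U'.
  have -> : (q ^ (2 * n.+1 + kap) = q ^ (2 * n + kap) * q ^ 2)%N by rewrite -expnD; congr expn; lia.
  by move/eqP; rewrite eqn_pmul2r ?expn_gt0 ?q0 // => /eqP.
have {}IHn := IHn U' (hyp_perp_subspace _ _ Us) (hyp_perp_nondegenerate Us Und eU fU ef) cU'.
have UP x : reflect [/\ x \in U, B e x = 0 & B f x = 0] (x \in U') by exact: hyp_perpP.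
have proj_in u : u \in U -> perp_proj kap B e f u \in U' by exact: perp_proj_in.
clearbody U'.
(* coordinates: v = a e + b f + u with u in U', and Q v = a b + Q u *)
pose X := [set abu : F * (F * V) | (abu.2.2 \in U') && (abu.1 * abu.2.1 + Q abu.2.2 == 0)].
have -> : #|[set v in U | Q v == 0]| = #|X|.
  pose g (abu : F * (F * V)) := abu.1 *: e + (abu.2.1 *: f + abu.2.2).
  have gE abu : abu.2.2 \in U' -> [/\ B e (g abu) = abu.2.1,
      B f (g abu) = (-1) ^+ (~~ kap) * abu.1 & Q (g abu) = abu.1 * abu.2.1 + Q abu.2.2].
    case: abu => a [b u] /= /UP[uU ue uf].
    rewrite /g /= !(formDr BQ) !(quadD BQ) !(formDr BQ) Bef ue uf (hyp_formee BQ ef).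
    rewrite (hyp_formff BQ ef) (hyp_formfe BQ ef) Qe Qf k1 /=.
    by split; rewrite ?mulr0 ?mulr1 ?addr0 ?add0r ?mul1r // ?mulr0 ?add0r // mulr1.
  rewrite -[RHS](@card_in_imset _ _ g); last first.
    move=> [a [b u]] [a' [b' u']]; rewrite !inE => /andP[uU _] /andP[uU' _] E.
    have [b1 a1 _] := gE _ uU; have [b2 a2 _] := gE _ uU'.
    have bb : b' = b by move: b1; rewrite E b2.
    have aa : a' = a by apply: (mulfI (negbT (signr_eq0 _ (~~ kap)))); move: a1; rewrite E a2 /= => ->.
    by move: E; rewrite bb aa /g /= => /addrI/addrI ->.
  apply: eq_card => v; apply/idP/imsetP => [|[[a [b u]]]].
    rewrite inE => /andP[vU /eqP Qv].
    pose u := perp_proj kap B e f v.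
    have uU : u \in U' by exact: proj_in.
    have vE : v = g ((-1) ^+ (~~ kap) * B f v, (B e v, u)).
      by rewrite /g /= /u /perp_proj !scaleNr !addNKr.
    exists ((-1) ^+ (~~ kap) * B f v, (B e v, u)) => //.
    rewrite inE /= uU /=.
    by have [_ _ /= <-] := gE ((-1) ^+ (~~ kap) * B f v, (B e v, u)) uU; rewrite -vE Qv.
  rewrite !in_set /= => /andP[uU' Q0] ->.
  have [_ _ /= ->] := gE (a, (b, u)) uU'; have /UP[uU _ _] := uU'.
  by rewrite Q0 andbT; apply: Us.2 => //; exact: Us.2.
have -> : #|X| = (\sum_(b : F) \sum_(u in U') #|[set a : F | a * b + Q u == 0]%R|)%N.
  rewrite pair_big_dep /= -sum1_card (partition_big snd (fun bu : F * V => bu.2 \in U')) /=; last first.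
    by move=> abu; rewrite inE => /andP[].
  apply: eq_bigr => -[b u] /= uU; rewrite -sum1_card.
  rewrite (reindex_onto (fun a => (a, (b, u))) fst) /=; last first.
    by move=> [a bu] /andP[_ /eqP /= ->].
  by apply: eq_bigl => a; rewrite !inE /= uU !eqxx !andbT.
(* For $b=0$ the vector $u$ is singular and $a$ is free: $q \cdot q^{2n}$ solutions. For each of the
   $q-1$ other $b$, $u$ is free and determines $a$: $q^{2n+1}$ solutions. *)
rewrite (bigD1 0) //=.
have -> : (\sum_(u in U') #|[set a : F | a * 0 + Q u == 0]%R| = q * q ^ (2 * n))%N.
  rewrite -IHn mulnC -sum_nat_const big_mkcond [RHS]big_mkcond; apply: eq_bigr => u _ /=.
  rewrite inE; case: (u \in U') => //=; case: eqP => [->|Qu].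
    by apply: eq_card => a; rewrite inE mulr0 addr0 eqxx.
  by apply: eq_card0 => a; rewrite inE mulr0 add0r; apply/eqP.
rewrite (eq_bigr (fun _ => (q ^ (2 * n + kap))%N)); last first.
  move=> b b0; rewrite -cU' -sum1_card; apply: eq_bigr => u _.
  rewrite -(cards1 (- Q u / b)); apply: eq_card => a; rewrite !inE.
  by rewrite addr_eq0 -(inj_eq (mulIf (invr_neq0 b0))) mulfK.
rewrite sum_nat_const k1 addn1 cardC1.
have -> : (2 * n.+1 = (2 * n).+2)%N by lia.
by rewrite !expnS -mulSn prednK.
Qed.

(** In the quadratic case each $x$ with $B(e,x)=1$ is uniquely $ae+f$ with $f$ a partner, and
    $a=Q(x)$; so partners are a fraction $1/q$ of an affine hyperplane. In the alternating case they
    are the whole hyperplane. *)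
Lemma card_partners n U e : subspace U -> nondegenerate U -> #|U| = (q ^ (2 * n.+1 + kap))%N ->
  e \in U -> e != 0 -> Q e = 0 ->
  #|[set f in U | hyp_pair B Q (e, f)]| = (q ^ (2 * n.+1).-1)%N.
Proof.
move=> Us Und cU eU e0 Qe.
have q1 := card_field_gt1; have q0 := ltnW q1.
have [f fU ef] := nondegenerate_partner Us Und eU e0 Qe.
have Bef : B e f = 1 by have /and3P[_ _ /eqP] := ef.
have cH : #|[set x in U | B e x == 1]| = (q ^ (2 * n.+1 + kap).-1)%N.
  apply/eqP; rewrite -(eqn_pmul2r q0) (@card_level U e f 1) //; last by rewrite Bef oner_neq0.
  by rewrite cU -expnSr; apply/eqP; congr expn; lia.
have hE x : hyp_pair B Q (e, x) = (Q x == 0) && (B e x == 1).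
  by rewrite /hyp_pair /= Qe eqxx.
have [k|k] : ~~ kap \/ kap by case: kap; [right|left].
  rewrite (negPf k) addn0 in cH; rewrite -cH; apply: eq_card => x; rewrite !inE hE.
  by rewrite (quad_kap0 BQ) // eqxx.
have Bee : B e e = 0 by exact: hyp_formee BQ _ _ ef.
apply/eqP; rewrite -(eqn_pmul2l q0); apply/eqP.
transitivity #|[set x in U | B e x == 1]|; last by rewrite cH k -expnS; congr expn; lia.
rewrite -cardsT -cardsX.
rewrite -[LHS](@card_in_imset _ _ (fun p : F * V => p.1 *: e + p.2)); last first.
  move=> [a x] [b y]; rewrite !inE /= !hE => /and3P[_ /eqP Qx /eqP Bx] /and3P[_ /eqP Qy /eqP By] E.
  have := congr1 Q E; rewrite !(quadD BQ) Qe Qx Qy Bx By k !mulr0 !add0r !addr0 !mul1r !mulr1.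
  by move=> ab; move: E; rewrite ab => /addrI ->.
apply: eq_card => x; apply/imsetP/idP => [[[a y] + ->]|].
  rewrite !inE /= hE => /and3P[yU /eqP Qy /eqP By]; rewrite Us.2 //=.
  by rewrite (formDr BQ) Bee mulr0 add0r By.
rewrite inE => /andP[xU /eqP Bx]; exists (Q x, - Q x *: e + x); last first.
  by rewrite /= scaleNr addrA subrr add0r.
by rewrite !inE /= Us.2 //= (make_hyp_pair BQ).
Qed.

Lemma card_hyp_seq n U : subspace U -> nondegenerate U -> #|U| = (q ^ (2 * n + kap))%N ->
  card_is (fun s : seq (V * V) =>
    [/\ size s = n, all (fun p => (p.1 \in U) && (p.2 \in U)) s & hyp_seq B Q s])
    (hyp_count q n).
Proof.
have q1 := card_field_gt1; have q0 := ltnW q1.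
elim: n U => [|n IHn] U Us Und cU.
  by apply: (@card_is1 _ _ [::]) => s; split=> [[/size0nil]|->].
have cE : card_is (fun e => e \in [set v in U | Q v == 0] :\ 0) (q ^ (2 * n.+1)).-1.
  have := card_is_fin (mem ([set v in U | Q v == 0] :\ 0)).
  have -> : #|mem ([set v in U | Q v == 0] :\ 0)| = (q ^ (2 * n.+1)).-1; last by [].
  rewrite -(card_singular Us Und cU) [in RHS](cardsD1 0) inE Us.1.
  by rewrite (quad0 BQ) eqxx add1n.
have cP : card_is (fun p : V * V => p.1 \in [set v in U | Q v == 0] :\ 0 /\
    p.2 \in [set f in U | hyp_pair B Q (p.1, f)]) ((q ^ (2 * n.+1)).-1 * q ^ (2 * n.+1).-1).
  apply: (card_is_pair (Q := fun e f => f \in [set f in U | hyp_pair B Q (e, f)])) cE _ => e.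
  rewrite !inE => /and3P[e0 eU /eqP Qe].
  by rewrite -(card_partners Us Und cU eU e0 Qe); exact: card_is_fin.
pose T p (s : seq (V * V)) := [/\ size s = n,
  all (fun r => (r.1 \in hyp_perp U p.1 p.2) && (r.2 \in hyp_perp U p.1 p.2)) s & hyp_seq B Q s].
have := @card_is_pair _ _ _ T _ (hyp_count q n) cP.
rewrite /= -/(hyp_count _ _) => cS.
apply: (card_is_bij (f := fun x => x.1 :: x.2)) (cS _); last first.
- move=> [e f] /=; rewrite !inE => -[/and3P[e0 eU Qe] /andP[fU ef]].
  apply: IHn.
  + exact: hyp_perp_subspace.
  + exact: hyp_perp_nondegenerate.
  + have := card_hyp_perp Us eU fU ef; rewrite cU.
    have -> : (q ^ (2 * n.+1 + kap) = q ^ (2 * n + kap) * q ^ 2)%N by rewrite -expnD; congr expn; lia.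
    by move/eqP; rewrite eqn_pmul2r ?expn_gt0 ?q0 // => /eqP.
- case=> [|[e f] s] [] // [sn] /= /andP[/andP[eU fU] sU] /andP[/= /andP[ef hs] /andP[os ps]].
  have /and3P[/= Qe Qf /eqP Bef] := ef.
  exists ((e, f), s) => //=; split.
    rewrite !inE eU Qe fU ef !andbT; split=> //.
    by apply: contra_eq_neq Bef => ->; rewrite (form0l BQ) eq_sym oner_eq0.
  split=> //; last by rewrite /hyp_seq hs ps.
  apply/allP => r rs; have /andP[rU1 rU2] := allP sU _ rs; have /and4P[/= o1 o2 o3 o4] := allP os _ rs.
  by apply/andP; split; apply/hyp_perpP; split=> //; exact/eqP.
- by move=> [p s] [p' s'] _ _ /= [-> ->].
move=> [[e f] s] /= []; rewrite !inE => -[/and3P[e0 eU Qe] /andP[fU ef]] [sn sU /andP[hs ps]].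
split; first by rewrite /= sn.
  rewrite /= eU fU /=; apply: sub_all sU => r /andP[/hyp_perpP[-> _ _] /hyp_perpP[-> _ _]] //.
rewrite /hyp_seq /= ef hs ps !andbT; apply: sub_all sU => r /andP[/hyp_perpP[_ a b] /hyp_perpP[_ c d]].
by rewrite /orth_pair /= a b c d eqxx.
Qed.

End CountHyperbolic.

From mathcomp Require Import monalg mpoly.
From mathcomp Require Import classical_sets fsbigop.

(** * Weyl group and maximal tori of a classical group *)

Lemma signed_actE (K : closedFieldType) n (w : signed_perm n) (t : 'rV[K]_n) i :
  signed_act w t 0 (w.1 i) = inv_if (w.2 i) (t 0 i).
Proof. by rewrite mxE permK. Qed.

Lemma signed_act_nonzero (K : closedFieldType) n (w : signed_perm n) (t : 'rV[K]_n) :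
  nonzero_coords t -> nonzero_coords (signed_act w t).
Proof.
move=> t0 j; rewrite -[j](permKV w.1) signed_actE; exact: inv_if_neq0.
Qed.

Section HypFamily.
Variables (R : fieldType) (V : lmodType R) (kap : bool) (B : V -> V -> R) (Q : V -> R).
Hypothesis BQ : quad_space kap B Q.

Definition hyp_family n (H : 'I_n -> V * V) :=
  (forall i, hyp_pair B Q (H i)) /\ (forall i j, i != j -> orth_pair B (H i) (H j)).

Lemma hyp_seqP n (H : 'I_n -> V * V) :
  hyp_seq B Q [seq H i | i <- enum 'I_n] <-> hyp_family H.
Proof.
have pw (s : seq 'I_n) : uniq s ->
    pairwise (orth_pair B) (map H s) <-> {in s &, forall i j, i != j -> orth_pair B (H i) (H j)}.
  elim: s => [|k s IHs] //= /andP[ks us]; rewrite all_map; split.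
    case/andP=> /allP kP /(IHs us) sP i j; rewrite !inE.
    case/orP=> [/eqP->|is_]; case/orP=> [/eqP->|js] ij; first by rewrite eqxx in ij.
    - exact: kP.
    - by rewrite (orth_pairC BQ); exact: kP.
    - exact: sP.
  move=> H0; apply/andP; split.
    apply/allP => j js /=; apply: H0; rewrite ?inE ?eqxx ?js ?orbT //.
    by apply: contraNneq ks => ->.
  by apply/(IHs us) => i j is_ js; apply: H0; rewrite inE ?is_ ?js orbT.
rewrite /hyp_seq /hyp_family; split.
  case/andP=> /allP Hp /(pw _ (enum_uniq _)) Ho; split.
    by move=> i; apply: Hp; apply: map_f; rewrite mem_enum.
  by move=> i j; apply: Ho; rewrite mem_enum.
case=> Hp Ho; apply/andP; split; first by apply/allP => _ /mapP[i _ ->].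
by apply/(pw _ (enum_uniq _)) => i j _ _; exact: Ho.
Qed.

End HypFamily.

(** If a nonconstant [P] vanished everywhere, $P+1$ would have no root. *)
Lemma exists_not_in (K : closedFieldType) (P : {poly K}) : P != 0 -> exists x, ~~ root P x.
Proof.
move=> P0; apply: contrapT => H.
have rP x : root P x by apply: contrapT => /negP rx; apply: H; exists x.
have [|s1] := leqP (size P) 1.
  move/size1_polyC=> PE; have := rP 0; rewrite PE /root hornerC => /eqP P00.
  by case/eqP: P0; rewrite PE P00 polyC0.
have : size (P + 1) != 1%N by rewrite size_polyDl ?size_poly1 // neq_ltn s1 orbT.
move/closed_rootP => [x]; rewrite /root hornerD hornerC (eqP (rP x)) add0r.
by rewrite oner_eq0.
Qed.

(* Powers of an element of large order. *)
Lemma exists_regular (K : closedFieldType) n : exists t : 'rV[K]_n,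
  [/\ nonzero_coords t, forall s i, inv_if s (t 0 i) != 1 &
      forall s i s' i', inv_if s (t 0 i) = inv_if s' (t 0 i') -> s = s' /\ i = i'].
Proof.
have P0 : 'X * \prod_(k < (n + n).+1) ('X^(k.+1) - 1) != 0 :> {poly K}.
  rewrite mulf_neq0 ?polyX_eq0 //; apply/prodf_neq0 => k _.
  by rewrite -size_poly_eq0 size_XnsubC.
have [x] := exists_not_in P0.
rewrite /root hornerM mulf_eq0 negb_or hornerX horner_prod => /andP[x0 /prodf_neq0 xk].
have {}xk k : (0 < k)%N -> (k <= n + n)%N -> x ^+ k != 1.
  case: k => // k _ kn; have kn' : (k < (n + n).+1)%N by lia.
  by have := xk (Ordinal kn') isT; rewrite !hornerE subr_eq0.
have inj a b : (a <= n + n)%N -> (b <= n + n)%N -> x ^+ a = x ^+ b -> a = b.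
  move=> an bn; wlog ab : a b an bn / (a <= b)%N => [W|].
    by have [/W|/ltnW/W W' /esym/W'] := leqP a b; [exact|move=> -> //].
  rewrite -{1}(subnKC ab) exprD -{1}[x ^+ a]mulr1 => /(mulfI (expf_neq0 _ x0))/esym E.
  have [/eqP|d0] := posnP (b - a); first by rewrite subn_eq0 => ba; apply/eqP; rewrite eqn_leq ab.
  have db : (b - a <= n + n)%N by lia.
  by have := xk _ d0 db; rewrite E eqxx.
exists (\row_i x ^+ i.+1); split.
- by move=> i; rewrite mxE expf_neq0.
- move=> s i; rewrite mxE; have xi : x ^+ i.+1 != 1 by apply: xk => //; have := ltn_ord i; lia.
  by case: s => //=; rewrite invr_eq1.
- move=> s i s' i'; rewrite !mxE; have := (ltn_ord i, ltn_ord i') => -[ltn_i ltn_i'].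
  have mixed a b : (a < n)%N -> (b < n)%N -> (x ^+ a.+1)^-1 <> x ^+ b.+1.
    move=> an bn E; have : x ^+ (a.+1 + b.+1) != 1 by apply: xk => //; lia.
    by rewrite exprD -E divff ?expf_neq0 // eqxx.
  have same a b : (a < n)%N -> (b < n)%N -> x ^+ a.+1 = x ^+ b.+1 -> a = b.
    by move=> an bn E; apply: succn_inj; apply: inj E; lia.
  case: s; case: s' => /= E.
  + by split=> //; apply/val_inj/same => //; exact: invr_inj.
  + by case: (mixed _ _ ltn_i ltn_i' E).
  + by case: (mixed _ _ ltn_i' ltn_i (esym E)).
  + by split=> //; apply/val_inj/same.
Qed.

Section ClassicalGroups.
Variables (K : closedFieldType) (n N : nat) (kap : bool).
Variables (B : 'cV[K]_N -> 'cV[K]_N -> K) (Q : 'cV[K]_N -> K).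
Variables (G : set 'M[K]_N) (D : 'rV[K]_n -> 'M[K]_N).
Variables (idx : bool -> 'I_n -> 'I_N) (del : 'rV[K]_n -> 'rV[K]_N).

Definition std_vec s i : 'cV[K]_N := delta_mx (idx s i) 0.

(* G is the isometry group (of determinant 1) of (B, Q) on K^N; it acts simply *)
(* transitively on hyperbolic families, among which the standard basis         *)
(* vectors e_i, f_i of indices [idx false i], [idx true i].                    *)
Record classical_group : Prop := ClassicalGroup {
  cg_form : quad_space kap B Q;
  cg_dim : N = (2 * n + kap)%N;
  cg_nondeg : forall v, (forall u, B v u = 0) -> Q v = 0 -> v = 0;
  cg_1 : G 1%:M;
  cg_mul : forall x y, G x -> G y -> G (x *m y);
  cg_inv : forall x, G x -> G (invmx x);
  cg_unit : forall x, G x -> x \in unitmx;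
  cg_isoB : forall x u v, G x -> B (x *m u) (x *m v) = B u v;
  cg_isoQ : forall x u, G x -> Q (x *m u) = Q u;
  cg_torus : forall t, nonzero_coords t -> G (D t);
  cg_diag : forall t, D t = diag_mx (del t);
  cg_del : forall t s i, del t 0 (idx s i) = inv_if s (t 0 i);
  cg_del1 : forall k, (exists s i, k = idx s i) \/ (forall t, del t 0 k = 1);
  cg_idx_inj : forall s i s' i', idx s i = idx s' i' -> s = s' /\ i = i';
  cg_std : hyp_family B Q (fun i => (std_vec false i, std_vec true i));
  cg_frame : forall H : 'I_n -> 'cV[K]_N * 'cV[K]_N, hyp_family B Q H ->
    exists2 y, G y & forall i, y *m std_vec false i = (H i).1 /\ y *m std_vec true i = (H i).2;
  cg_frame_inj : forall x y, G x -> G y ->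
    (forall s i, x *m std_vec s i = y *m std_vec s i) -> x = y;
  cg_mapB : forall (phi : {rmorphism K -> K}) u v,
    B (map_mx phi u) (map_mx phi v) = phi (B u v);
  cg_mapQ : forall (phi : {rmorphism K -> K}) u, Q (map_mx phi u) = phi (Q u);
  cg_mapG : forall (phi : {rmorphism K -> K}) x, G x -> G (map_mx phi x) }.

Hypothesis cg : classical_group.
Let BQ := cg_form cg.

Lemma diag_std t s i : D t *m std_vec s i = inv_if s (t 0 i) *: std_vec s i.
Proof.
rewrite (cg_diag cg); apply/colP => k; rewrite mul_diag_mx !mxE andbT.
by have [->|_] := eqVneq k (idx s i); rewrite ?(cg_del cg) // !mulr0.
Qed.

Lemma std_neq0 s i : std_vec s i != 0.
Proof.
apply/eqP => /colP/(_ (idx s i)); rewrite !mxE !eqxx => /eqP.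
by rewrite oner_eq0.
Qed.

Lemma mul_std_neq0 x s i : G x -> x *m std_vec s i != 0.
Proof.
move=> Gx; apply: contra_neq (std_neq0 s i) => E.
by rewrite -(mulKmx (cg_unit cg Gx) (std_vec s i)) E mulmx0.
Qed.

Lemma diag_inj t t' : D t = D t' -> t = t'.
Proof.
move=> E; apply/rowP => i; have := diag_std t false i; rewrite E diag_std => /colP/(_ (idx false i)).
by rewrite !mxE !eqxx !mulr1.
Qed.

Lemma map_diag (phi : {rmorphism K -> K}) t : map_mx phi (D t) = D (map_mx phi t).
Proof.
rewrite !(cg_diag cg) map_diag_mx; congr diag_mx; apply/rowP => k; rewrite mxE.
have [[s [i ->]]|k1] := cg_del1 cg k; last by rewrite !k1 rmorph1.
by rewrite !(cg_del cg) mxE; case: s; rewrite //= fmorphV.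
Qed.

Lemma diagM (t t' : 'rV[K]_n) : D t *m D t' = D (\row_(i < n) (t 0 i * t' 0 i)).
Proof.
rewrite !(cg_diag cg) mulmx_diag; congr diag_mx; apply/rowP => k; rewrite mxE.
have [[s [i ->]]|k1] := cg_del1 cg k; last by rewrite !k1 mulr1.
by rewrite !(cg_del cg) mxE inv_ifM.
Qed.

Lemma diag_comm (t t' : 'rV[K]_n) : D t *m D t' = D t' *m D t.
Proof. by rewrite !diagM; congr (D _); apply/rowP => i; rewrite !mxE mulrC. Qed.

(** The standard basis vectors $e_i, f_i$ then have distinct eigenvalues under [D t], all different
    from the eigenvalue 1 on the remaining basis vector, if any. *)
Definition regular (t : 'rV[K]_n) :=
  [/\ nonzero_coords t, forall s i, inv_if s (t 0 i) != 1 &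
      forall s i s' i', inv_if s (t 0 i) = inv_if s' (t 0 i') -> s = s' /\ i = i'].

Lemma eigenvalue_idx t (v : 'cV[K]_N) c : v != 0 -> c != 1 -> D t *m v = c *: v ->
  exists s i, c = inv_if s (t 0 i).
Proof.
move=> /matrix0Pn[k [j vk]] c1; rewrite (ord1 j) in vk => /colP/(_ k).
rewrite (cg_diag cg) mul_diag_mx !mxE => /(mulIf vk) E.
have [[s [i ki]]|k1] := cg_del1 cg k; first by exists s, i; rewrite -E ki (cg_del cg).
by rewrite -E k1 eqxx in c1.
Qed.

Lemma eigenline t (v : 'cV[K]_N) s i : regular t -> D t *m v = inv_if s (t 0 i) *: v ->
  exists c, v = c *: std_vec s i.
Proof.
move=> [_ t1 tinj] /colP E; exists (v (idx s i) 0); apply/colP => k.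
rewrite !mxE andbT; have [->|ki] := eqVneq k (idx s i); first by rewrite mulr1.
rewrite mulr0; apply/eqP; apply: contraNT ki => vk.
have := E k; rewrite (cg_diag cg) mul_diag_mx !mxE => /(mulIf vk).
have [[s' [i' ->]]|k1] := cg_del1 cg k; first by rewrite (cg_del cg) => /tinj[-> ->].
by rewrite k1 => /esym/eqP; rewrite (negPf (t1 _ _)).
Qed.

Lemma std_pairing i : B (std_vec false i) (std_vec true i) = 1.
Proof. by have [/(_ i)/and3P[_ _ /eqP]] := cg_std cg. Qed.

(** Invariance of the pairing of $ye_i$ and $yf_i$ forces the eigenvalues on them to be inverse to
    each other. *)
Lemma diagonal_on_frame x y (c : bool -> 'I_n -> K) : G x -> G y ->
  (forall s i, x *m (y *m std_vec s i) = c s i *: (y *m std_vec s i)) ->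
  exists2 t, nonzero_coords t & x = y *m D t *m invmx y.
Proof.
move=> Gx Gy xy.
have c1 i : c false i * c true i = 1.
  have := cg_isoB cg (y *m std_vec false i) (y *m std_vec true i) Gx.
  rewrite !xy (formZl BQ) (formZr BQ) (cg_isoB cg) // std_pairing mulr1.
  by rewrite mulrC.
have c0 i : c false i != 0 by apply: contra_eq_neq (c1 i) => ->; rewrite mul0r eq_sym oner_neq0.
have t0 : nonzero_coords (\row_i c false i) by move=> i; rewrite mxE.
exists (\row_i c false i) => //.
apply: (canRL (mulmxK (cg_unit cg Gy))); apply: (cg_frame_inj cg).
- exact: cg_mul.
- by apply: (cg_mul cg) => //; exact: cg_torus.
move=> s i; rewrite -!mulmxA xy diag_std -scalemxAr mxE; congr (_ *: _).
case: s => //=; apply: (mulfI (c0 i)); by rewrite c1 divff.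
Qed.

(** An element commuting with a regular [D t] preserves its eigenlines. *)
Lemma centralizer_torus t (x : 'M[K]_N) : regular t -> G x -> x *m D t = D t *m x ->
  exists2 s, nonzero_coords s & x = D s.
Proof.
move=> treg Gx xt.
have H s i : exists c, x *m std_vec s i = c *: std_vec s i.
  by apply: (eigenline treg); rewrite mulmxA -xt -mulmxA diag_std scalemxAr.
have /choice[c cE] (si : bool * 'I_n) : exists c, x *m std_vec si.1 si.2 = c *: std_vec si.1 si.2.
  exact: H.
have [|s s0 E] := @diagonal_on_frame x 1%:M (fun s i => c (s, i)) Gx (cg_1 cg).
  by move=> s i; rewrite mul1mx; exact: (cE (s, i)).
by exists s; rewrite // E mul1mx invmx1 mulmx1.
Qed.

Lemma weyl_image_mul x w t : G x -> weyl_image D x w -> nonzero_coords t ->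
  x *m D t = D (signed_act w t) *m x.
Proof. by move=> Gx xw t0; rewrite -(xw t t0) mulmxKV // (cg_unit cg). Qed.

Lemma weyl_image_monomial x (w : signed_perm n) : G x ->
  (forall s i, exists c, x *m std_vec s i = c *: std_vec (s (+) w.2 i) (w.1 i)) ->
  weyl_image D x w.
Proof.
move=> Gx xw t t0; apply: (canLR (mulmxK (cg_unit cg Gx))); apply: (cg_frame_inj cg).
- by apply: (cg_mul cg) => //; exact: cg_torus.
- by apply: (cg_mul cg) => //; apply/(cg_torus cg)/signed_act_nonzero.
move=> s i; have [c cE] := xw s i.
rewrite -!mulmxA diag_std -scalemxAr cE -scalemxAr diag_std signed_actE.
by rewrite inv_if_addb -addbA addbb addbF scalerA mulrC -scalerA.
Qed.

Lemma weyl_image_inj x (w w' : signed_perm n) : weyl_image D x w -> weyl_image D x w' -> w = w'.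
Proof.
have [t [t0 t1 tinj]] := exists_regular K n.
move=> /(_ t t0) E /(_ t t0); rewrite E => /diag_inj {}E.
have H i : w.1 i = w'.1 i /\ w.2 i = w'.2 i.
  have [j wj] : exists j, w'.1 j = w.1 i by exists ((w'.1^-1)%g (w.1 i)); rewrite permKV.
  have := congr1 (fun A : 'rV[K]_n => A 0 (w.1 i)) E.
  by rewrite signed_actE -wj signed_actE => /tinj[-> ->].
case: w w' H {E} => s e [s' e'] /= H; congr pair; first by apply/permP => i; case: (H i).
by apply/ffunP => i; case: (H i).
Qed.

Lemma weyl_image_exists (w : signed_perm n) : exists2 x, G x & weyl_image D x w.
Proof.
(* A sign change swaps $e$ and $f$; in the alternating case one of them is negated to keep the
   pairing equal to 1. *)
pose H0 i := if w.2 i then (std_vec true (w.1 i), (-1) ^+ (~~ kap) *: std_vec false (w.1 i))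
            else (std_vec false (w.1 i), std_vec true (w.1 i)).
pose H j := H0 ((w.1^-1)%g j).
have [sp so] := cg_std cg.
have hH : hyp_family B Q H0.
  split=> [i|i j ij].
    rewrite /H0; case: ifP => _; last exact: sp.
    have /and3P[/= /eqP Qe /eqP Qf _] := sp (w.1 i).
    by rewrite /hyp_pair /= (quadZ BQ) Qe Qf mulr0 (formZr BQ) -(formC BQ) std_pairing !eqxx.
  have ne : w.1 i != w.1 j by rewrite (inj_eq perm_inj).
  have /and4P[/= /eqP a /eqP b /eqP c /eqP d] := so _ _ ne.
  rewrite /H0 /orth_pair; case: (w.2 i); case: (w.2 j) => /=;
  by rewrite ?(formZr BQ) ?(formZl BQ) a b c d ?mulr0 !eqxx.
have [y Gy yE] := cg_frame cg hH; exists y => //.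
apply: weyl_image_monomial => // s i; have := yE i; rewrite /H0.
by case: s => -[]; case: (w.2 i) => /= E1 E2; rewrite ?E1 ?E2;
  [exists ((-1) ^+ (~~ kap))|exists 1|exists 1|exists 1]; rewrite ?scale1r.
Qed.

Definition stabilizes_torus x := forall t, nonzero_coords t ->
  exists2 t', nonzero_coords t' & x *m D t *m invmx x = D t'.

(** Conjugation by [x] sends a regular [D t] to a [D t'] with the same eigenvalues. Matching each
    $t_i$ with some $t'_j$ or its inverse defines [w], and [x] permutes the eigenlines
    accordingly. *)
Lemma normalizer_weyl x : G x -> stabilizes_torus x -> exists w, weyl_image D x w.
Proof.
move=> Gx xT; have [t treg] := exists_regular K n; have [t0 t1 tinj] := treg.
have [t' t'0 E] := xT t t0.
have xt : D t' *m x = x *m D t by rewrite -E mulmxKV // (cg_unit cg).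
have eig s i : D t' *m (x *m std_vec s i) = inv_if s (t 0 i) *: (x *m std_vec s i).
  by rewrite mulmxA xt -mulmxA diag_std scalemxAr.
have /choice[f fE] i : exists sj : bool * 'I_n, t 0 i = inv_if sj.1 (t' 0 sj.2).
  have [s [j Ej]] := eigenvalue_idx (mul_std_neq0 false i Gx) (t1 false i) (eig false i).
  by exists (s, j).
have finj : injective (fun i => (f i).2).
  move=> i j ij; have Ei := fE i; have Ej := fE j; rewrite -ij in Ej.
  have : t 0 j = inv_if ((f j).1 (+) (f i).1) (t 0 i) by rewrite Ei Ej inv_if_addb addbK.
  by move/(tinj false j)=> [].
pose w : signed_perm n := (perm finj, [ffun i => (f i).1]).
have t'E i : t' 0 (w.1 i) = inv_if (w.2 i) (t 0 i).
  by rewrite fE permE ffunE inv_if_addb addbb.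
have t'act : t' = signed_act w t.
  by apply/rowP => j; rewrite -[j](permKV w.1) t'E signed_actE.
have t'reg : regular t'.
  have H s j : inv_if s (t' 0 j) = inv_if (s (+) w.2 ((w.1^-1)%g j)) (t 0 ((w.1^-1)%g j)).
    by rewrite -{1}[j](permKV w.1) t'E inv_if_addb.
  split=> // [s j|s j s' j']; first by rewrite H.
  rewrite !H => /tinj[+ /perm_inj jj']; rewrite jj' => /addIb ->.
  by [].
exists w; apply: weyl_image_monomial => // s i.
apply: (eigenline t'reg); rewrite eig t'E inv_if_addb -addbA addbb addbF //.
Qed.

End ClassicalGroups.

(** * Conjugates of the split torus are maximal tori *)

Section PolynomialFunctions.
Variables (K : closedFieldType) (N : nat).

Definition poly_fun (f : 'M[K]_N -> K) :=
  exists P : mpoly (N * N) K, forall A, eval_entries P A = f A.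

Lemma poly_fun_const c : poly_fun (fun=> c).
Proof. by exists (mpolyC _ c) => A; rewrite /eval_entries mevalC. Qed.

Lemma poly_fun_entry i j : poly_fun (fun A => A i j).
Proof. by exists (mpolyX K U_(mxvec_index i j))%MM => A; rewrite /eval_entries mevalXU mxvecE. Qed.

Lemma poly_funD f g : poly_fun f -> poly_fun g -> poly_fun (fun A => f A + g A).
Proof. by move=> [P PE] [R RE]; exists (P + R) => A; rewrite -PE -RE /eval_entries mevalD. Qed.

Lemma poly_funM f g : poly_fun f -> poly_fun g -> poly_fun (fun A => f A * g A).
Proof. by move=> [P PE] [R RE]; exists (P * R) => A; rewrite -PE -RE /eval_entries mevalM. Qed.

Lemma poly_fun_sum (I : Type) (r : seq I) (P : pred I) (f : I -> 'M[K]_N -> K) :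
  (forall i, poly_fun (f i)) -> poly_fun (fun A => \sum_(i <- r | P i) f i A).
Proof.
move=> fP; elim: r => [|i r [R IHr]].
  by exists 0 => A; rewrite big_nil /eval_entries meval0.
have [S SE] := fP i; exists (if P i then S + R else R) => A; rewrite big_cons.
by case: (P i); rewrite -IHr // -SE /eval_entries mevalD.
Qed.

Lemma poly_fun_prod (I : Type) (r : seq I) (P : pred I) (f : I -> 'M[K]_N -> K) :
  (forall i, poly_fun (f i)) -> poly_fun (fun A => \prod_(i <- r | P i) f i A).
Proof.
move=> fP; elim: r => [|i r [R IHr]].
  by exists 1 => A; rewrite big_nil /eval_entries meval1.
have [S SE] := fP i; exists (if P i then S * R else R) => A; rewrite big_cons.
by case: (P i); rewrite -IHr // -SE /eval_entries mevalM.
Qed.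

Lemma poly_fun_conj (x y : 'M[K]_N) i j : poly_fun (fun A => (x *m A *m y) i j).
Proof.
have [P PE] : poly_fun (fun A => \sum_k (\sum_l x i l * A l k) * y k j).
  apply: poly_fun_sum => k; apply: poly_funM; last exact: poly_fun_const.
  apply: poly_fun_sum => l; apply: poly_funM; first exact: poly_fun_const.
  exact: poly_fun_entry.
exists P => A; rewrite PE mxE; apply: eq_bigr => k _; by rewrite mxE.
Qed.

End PolynomialFunctions.

Section MaximalTori.
Variables (K : closedFieldType) (n N : nat) (kap : bool).
Variables (B : 'cV[K]_N -> 'cV[K]_N -> K) (Q : 'cV[K]_N -> K).
Variables (G : set 'M[K]_N) (D : 'rV[K]_n -> 'M[K]_N).
Variables (idx : bool -> 'I_n -> 'I_N) (del : 'rV[K]_n -> 'rV[K]_N).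
Hypothesis cg : classical_group kap B Q G D idx del.

Definition conj_torus (g : 'M[K]_N) : set 'M[K]_N :=
  [set g *m D t *m invmx g | t in @nonzero_coords K n]%classic.

Lemma conj_torus_sub g : G g -> (conj_torus g `<=` G)%classic.
Proof.
move=> Gg _ [t t0 <-]; apply: (cg_mul cg); last exact: (cg_inv cg).
by apply: (cg_mul cg) => //; exact: (cg_torus cg).
Qed.

Lemma conj_torus_conjK g t : G g -> invmx g *m (g *m D t *m invmx g) *m g = D t.
Proof. by move=> /(cg_unit cg) gu; rewrite !mulmxA mulVmx // mul1mx mulmxKV. Qed.

Lemma conj_torusP g A : G g -> A \in unitmx ->
  (forall k l, k != l -> (invmx g *m A *m g) k l = 0) ->
  (forall i, (invmx g *m A *m g) (idx false i) (idx false i) *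
             (invmx g *m A *m g) (idx true i) (idx true i) = 1) ->
  (forall k, (forall t, del t 0 k = 1) -> (invmx g *m A *m g) k k = 1) ->
  conj_torus g A.
Proof.
move=> Gg Au; set C := invmx g *m A *m g => Cd C1 C2.
have gu := cg_unit cg Gg.
have c0 i : C (idx false i) (idx false i) != 0.
  by apply: contra_eq_neq (C1 i) => ->; rewrite mul0r eq_sym oner_neq0.
exists (\row_i C (idx false i) (idx false i)); first by move=> i; rewrite mxE.
have -> : D (\row_i C (idx false i) (idx false i)) = C.
  rewrite (cg_diag cg); apply/matrixP => k l; rewrite mxE.
  have [<-|kl] := eqVneq k l; last by rewrite Cd.
  rewrite mulr1n; have [[s [i ->]]|k1] := cg_del1 cg k; last by rewrite k1 C2.
  rewrite (cg_del cg) mxE; case: s => //=.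
  by apply: (mulfI (c0 i)); rewrite C1 divff.
by rewrite /C !mulmxA mulmxV // mul1mx mulmxK.
Qed.

Lemma conj_torus_closed g : G g -> closed_in_GL (conj_torus g).
Proof.
move=> Gg; have gu := cg_unit cg Gg.
pose I : set (mpoly (N * N) K) := fun P => forall A, conj_torus g A -> eval_entries P A = 0.
have van f : poly_fun f -> (forall A, conj_torus g A -> f A = 0) ->
    forall A, (forall P, I P -> eval_entries P A = 0) -> f A = 0.
  by move=> [P PE] fT A /(_ P) <- // A' /fT; rewrite PE.
exists I; apply/seteqP; split=> [A TA|A /= [Au HA]].
  by split; [exact: (cg_unit cg (conj_torus_sub Gg TA))|move=> P; exact].
have entry k l := poly_fun_conj (invmx g) g k l.
apply: conj_torusP => // [k l kl|i|k k1].
- apply: (van _ (entry k l)) HA => _ [t _ <-].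
  by rewrite conj_torus_conjK // (cg_diag cg) mxE (negPf kl).
- apply/eqP; rewrite -subr_eq0; apply/eqP.
  apply: (van (fun A => (invmx g *m A *m g) (idx false i) (idx false i) *
             (invmx g *m A *m g) (idx true i) (idx true i) - 1)) HA.
    by apply: poly_funD; [apply: poly_funM; exact: entry|exact: poly_fun_const].
  move=> _ [t t0 <-]; rewrite conj_torus_conjK // (cg_diag cg) !mxE !eqxx !mulr1n.
  by rewrite !(cg_del cg) /= divff ?subrr.
- apply/eqP; rewrite -subr_eq0; apply/eqP.
  apply: (van (fun A => (invmx g *m A *m g) k k - 1)) HA.
    by apply: poly_funD; [exact: entry|exact: poly_fun_const].
  move=> _ [t t0 <-]; rewrite conj_torus_conjK // (cg_diag cg) !mxE !eqxx !mulr1n.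
  by rewrite k1 subrr.
Qed.

Lemma det_Gm d (A : 'M[K]_d) : Gm_power A -> \det A = \prod_k A k k.
Proof.
move=> [_ /is_diag_mxP Ad].
have -> : A = diag_mx (\row_k A k k).
  apply/matrixP => k l; rewrite !mxE; have [->|kl] := eqVneq k l => //.
  by rewrite Ad.
by rewrite det_diag; apply: eq_bigr => k _; rewrite !mxE eqxx.
Qed.

Lemma Gm_entry_neq0 d (A : 'M[K]_d) i : Gm_power A -> A i i != 0.
Proof.
move=> GA; have := GA.1; rewrite /GL /= unitmxE unitfE (det_Gm GA).
by move/prodf_neq0; apply.
Qed.

Lemma conj_torus_iso g : G g -> algebraic_group_iso (@Gm_power K n) (conj_torus g).
Proof.
move=> Gg; have gu := cg_unit cg Gg.
pose row_of (A : 'M[K]_n) := \row_i A i i.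
pose f A := g *m D (row_of A) *m invmx g.
pose h (A : 'M[K]_N) : 'M[K]_n :=
  diag_mx (\row_i (invmx g *m A *m g) (idx false i) (idx false i)).
have row0 A : Gm_power A -> nonzero_coords (row_of A).
  by move=> GA i; rewrite mxE; exact: Gm_entry_neq0.
have hD t : h (g *m D t *m invmx g) = diag_mx t.
  rewrite /h conj_torus_conjK //; congr diag_mx; apply/rowP => i.
  by rewrite mxE (cg_diag cg) mxE eqxx mulr1n (cg_del cg).
have fG A : Gm_power A -> diag_mx (row_of A) = A.
  move=> [_ /is_diag_mxP Ad]; apply/matrixP => k l; rewrite !mxE.
  by have [->|kl] := eqVneq k l; rewrite ?mulr1n // mulr0n Ad.
exists f, h; split.
- split=> k l; last first.
    have [P PE] : poly_fun (fun A => h A k l).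
      have [kl|kl] := eqVneq k l; last first.
        exists 0 => A; rewrite /h mxE (negPf kl) mulr0n.
        by rewrite /eval_entries meval0.
      have [P PE] := poly_fun_conj (invmx g) g (idx false k) (idx false k).
      by exists P => A; rewrite PE /h !mxE kl eqxx mulr1n.
    by exists P, 0%N => A _; rewrite expr0 divr1 PE.
  (* On diagonal matrices $\det \cdot t_i^{-1}$ is the product of the other entries, so each entry
     of [D t] is a polynomial divided by one power of $\det$. *)
  have delP j : exists P : mpoly (n * n) K, forall A, Gm_power A ->
      del (row_of A) 0 j * \det A = eval_entries P A.
    have [P1 P1E] : poly_fun (fun A : 'M[K]_n => \prod_k A k k).
      by apply: poly_fun_prod => m; exact: poly_fun_entry.
    have [[[] [i ->]]|j1] := cg_del1 cg j.
    + have [P PE] : poly_fun (fun A : 'M[K]_n => \prod_(k | k != i) A k k).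
        by apply: poly_fun_prod => m; exact: poly_fun_entry.
      exists P => A GA; rewrite PE (cg_del cg) mxE (det_Gm GA) (bigD1 i) //=.
      by rewrite mulKf // Gm_entry_neq0.
    + have [P PE] : poly_fun (fun A : 'M[K]_n => A i i * \prod_k A k k).
        apply: poly_funM; first exact: poly_fun_entry.
        by apply: poly_fun_prod => m; exact: poly_fun_entry.
      by exists P => A GA; rewrite PE (cg_del cg) mxE (det_Gm GA).
    + by exists P1 => A GA; rewrite P1E j1 mul1r (det_Gm GA).
  have [Pj PjE] := choice delP.
  have [P PE] : poly_fun (fun A : 'M[K]_n => \sum_j g k j * eval_entries (Pj j) A * invmx g j l).
    apply: poly_fun_sum => j; apply: poly_funM; last exact: poly_fun_const.
    by apply: poly_funM; [exact: poly_fun_const|exists (Pj j)].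
  exists P, 1%N => A GA; rewrite PE expr1 mulr_suml /f mxE; apply: eq_bigr => j _.
  rewrite -PjE // (cg_diag cg) mul_mx_diag mxE.
  have dA : \det A != 0 by have := GA.1; rewrite /GL /= unitmxE unitfE.
  by field.
- move=> A GA; split; first by exists (row_of A) => //; exact: row0.
  by rewrite /f hD fG.
- move=> _ [t t0 <-]; rewrite hD; split.
    split; last by exact: diag_mx_is_diag.
    rewrite /GL /= unitmxE unitfE det_diag; apply/prodf_neq0 => i _; exact: t0.
  rewrite /f; congr (_ *m D _ *m _); apply/rowP => i; by rewrite !mxE eqxx.
- move=> A A' GA GA'; rewrite /f -(mulmxA _ (invmx g)) (mulmxA (invmx g)) mulKmx //.
  have -> : A *m A' = diag_mx (\row_k (row_of A 0 k * row_of A' 0 k)).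
    by rewrite -mulmx_diag !fG.
  rewrite !mulmxA -(mulmxA g (D _) (D _)) (diagM cg); congr (_ *m D _ *m _).
  by apply/rowP => i; rewrite !mxE eqxx mulr1n.
Qed.

Lemma conj_torus_subgroup g : G g -> closed_subgroup (conj_torus g).
Proof.
move=> Gg; have gu := cg_unit cg Gg; split.
- exact: conj_torus_closed.
- exists (const_mx 1); first by move=> i; rewrite mxE oner_neq0.
  have -> : D (const_mx 1) = 1%:M.
    rewrite (cg_diag cg) -diag_const_mx; congr diag_mx; apply/rowP => k; rewrite mxE.
    have [[s [i ->]]|//] := cg_del1 cg k; rewrite (cg_del cg) mxE.
    by case: s; rewrite //= invr1.
  by rewrite mulmx1 mulmxV.
- move=> _ _ [t t0 <-] [t' t'0 <-]; exists (\row_i (t 0 i * t' 0 i)).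
    by move=> i; rewrite mxE mulf_neq0.
  by rewrite -(diagM cg) !mulmxA mulmxKV.
- move=> _ [t t0 <-]; exists (\row_i (t 0 i)^-1).
    by move=> i; rewrite mxE invr_eq0.
  have Du s : nonzero_coords s -> D s \in unitmx by move=> s0; apply/(cg_unit cg)/(cg_torus cg).
  have D1 : D t *m D (\row_i (t 0 i)^-1) = 1%:M.
    rewrite (diagM cg) (cg_diag cg) -diag_const_mx; congr diag_mx; apply/rowP => k; rewrite mxE.
    have [[s [i ->]]|->//] := cg_del1 cg k; rewrite (cg_del cg) !mxE divff //.
    by case: s; rewrite //= invr1.
  have xu : g *m D t *m invmx g \in unitmx by rewrite !unitmx_mul unitmx_inv gu Du.
  rewrite -[RHS]mulmx1; apply: (canRL (mulKmx xu)); rewrite !mulmxA mulmxKV // -(mulmxA g) D1 mulmx1.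
  exact: mulmxV.
Qed.

Lemma conj_torus_is_torus g : G g -> is_torus (conj_torus g).
Proof.
by move=> Gg; split; [exact: conj_torus_subgroup|exists n; exact: conj_torus_iso].
Qed.

Lemma torus_comm (T : set 'M[K]_N) A A' : is_torus T -> T A -> T A' -> A *m A' = A' *m A.
Proof.
move=> [_ [d [f [h [_ fT hT fM]]]]] TA TA'.
have [GA <-] := hT _ TA; have [GA' <-] := hT _ TA'; rewrite -!fM //; congr f.
move: GA GA' => [_ /diag_mxP[a ->]] [_ /diag_mxP[b ->]].
by rewrite diag_mxC.
Qed.

(** A larger torus is commutative, hence lies in the centralizer of a regular element, which is
    already the conjugate of $T_0$. *)
Lemma conj_torus_maximal g : G g -> is_maximal_torus G (conj_torus g).
Proof.
move=> Gg; split; [exact: conj_torus_is_torus|exact: conj_torus_sub|].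
move=> S Stor SG TS; apply/seteqP; split=> // A SA.
have gu := cg_unit cg Gg.
have [t treg] := exists_regular K n; have [t0 _ _] := treg.
have [] := @centralizer_torus _ _ _ _ _ _ _ _ _ _ cg t (invmx g *m A *m g) treg.
- by apply: (cg_mul cg) => //; apply: (cg_mul cg); [exact: (cg_inv cg)|exact: SG].
- have STt : S (g *m D t *m invmx g) by apply: TS; exists t.
  have := torus_comm Stor SA STt => E.
  transitivity (invmx g *m (A *m (g *m D t *m invmx g)) *m g).
    by rewrite !mulmxA mulmxKV.
  by rewrite E !mulmxA mulVmx // mul1mx.
move=> s s0 E; exists s => //; rewrite -E !mulmxA mulmxV // mul1mx mulmxK //.
Qed.

End MaximalTori.

(** * Common eigenvectors of commuting diagonalizable matrices *)

Lemma finite_order_diagonalizable (K : closedFieldType) N (A : 'M[K]_N) m :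
  (0 < m)%N -> m%:R != 0 :> K -> A ^+ m = 1 -> diagonalizable A.
Proof.
case: N A => [|N] A m0 mK Am.
  by rewrite (flatmx0 A); exact: diagonalizable0.
have [r [ur sr rP]] := card_roots m0 mK (oner_neq0 K).
apply/diagonalizableP; exists r => //; apply: mxminpoly_min.
have <- : 'X^m - 1 = \prod_(x <- r) ('X - x%:P).
  have szP : size ('X^m - 1 : {poly K}) = m.+1 by exact: size_XnsubC.
  have uP : uniq_roots r by rewrite uniq_rootsE.
  have rr : all (root ('X^m - 1 : {poly K})) r.
    by apply/allP => x /rP xm; rewrite /root !hornerE xm subrr.
  rewrite [LHS](all_roots_prod_XsubC _ rr uP) ?szP ?sr //.
  by rewrite (monicP (monicXnsubC _ m0)) scale1r.
by rewrite rmorphB rmorphXn /= horner_mx_X rmorph1 Am subrr.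
Qed.

Section CommonEigenvectors.
Variables (K : closedFieldType) (N : nat) (T : 'M[K]_N -> Prop).
Hypothesis Tcomm : forall A A', T A -> T A' -> A *m A' = A' *m A.
Hypothesis Tdiag : forall A, T A -> diagonalizable A^T.

Definition common_eigen (v : 'cV[K]_N) := forall A, T A -> exists c, A *m v = c *: v.

(** Simultaneous diagonalization concerns finite lists, so [T] is replaced by a list of its elements
    with span of maximal dimension. *)
Lemma finite_span : exists2 As : seq 'M[K]_N, (forall A, A \in As -> T A) &
  forall A, T A -> A \in <<As>>%VS.
Proof.
pose P k := `[< exists2 As : seq 'M[K]_N, (forall A, A \in As -> T A) & \dim <<As>>%VS = k >].
have P0 : exists k, P k by exists (\dim <<[::] : seq 'M[K]_N>>%VS); apply/asboolP; exists [::].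
have Pub k : P k -> (k <= \dim {:'M[K]_N}%VS)%N.
  by move=> /asboolP[As _ <-]; rewrite dimvS // subvf.
case: (ex_maxnP P0 Pub) => k /asboolP[As AsT <-] kmax.
exists As => // A TA.
have sub : (<<As>> <= <<A :: As>>)%VS by apply: sub_span => C; rewrite inE orbC => ->.
have : P (\dim <<A :: As>>%VS).
  by apply/asboolP; exists (A :: As) => // C; rewrite inE => /orP[/eqP->|/AsT].
move/kmax => le; have /eqP -> : (<<As>> == <<A :: As>>)%VS by rewrite eqEdim sub.
by rewrite memv_span // mem_head.
Qed.

(** The common eigenvectors span, phrased through linear forms because it is applied to $B(v,\cdot)$
    and to matrix coordinates. *)
Lemma common_eigen_span (f : 'cV[K]_N -> K) :
  (forall a x y, f (a *: x + y) = a * f x + f y) ->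
  (forall v, common_eigen v -> f v = 0) -> forall v, f v = 0.
Proof.
move=> flin f0.
have [As AsT Asp] := finite_span.
have [P Pu Pd] : codiagonalizable [seq A^T | A <- As].
  apply/codiagonalizableP; split.
    move=> _ _ /mapP[A /AsT TA ->] /mapP[A' /AsT TA' ->].
    by rewrite /comm_mx -!trmx_mul Tcomm.
  by move=> _ /mapP[A /AsT TA ->]; exact: Tdiag.
have eig i : common_eigen (row i P)^T.
  have eigAs A : A \in As -> exists c, A *m (row i P)^T = c *: (row i P)^T.
    move=> AAs; have /diagonalizable_forPex[d /(simmxP Pu) E] := allP Pd _ (map_f trmx AAs).
    exists (d 0 i); rewrite -[A]trmxK -trmx_mul -row_mul E mul_diag_mx.
    by apply/colP => k; rewrite !mxE.
  have /choice[c cE] (j : 'I_(size As)) : exists c, As`_j *m (row i P)^T = c *: (row i P)^T.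
    by apply/eigAs/mem_nth.
  move=> A /Asp; rewrite -[As]/(tval (in_tuple As)) => /coord_span ->.
  exists (\sum_j coord (in_tuple As) j A * c j).
  rewrite mulmx_suml scaler_suml; apply: eq_bigr => j _.
  by rewrite -scalemxAl cE scalerA.
have f00 : f 0 = 0 by apply: f0 => A _; exists 0; rewrite mulmx0 scale0r.
have fsum (I : finType) (c : I -> K) (F : I -> 'cV[K]_N) :
    f (\sum_i c i *: F i) = \sum_i c i * f (F i).
  by elim/big_rec2: _ => [|i x y _ <-] //; rewrite flin.
move=> v; have -> : v = \sum_i (v^T *m invmx P) 0 i *: (row i P)^T.
  apply: trmx_inj; rewrite linear_sum /= -{1}(mulmxKV Pu v^T) mulmx_sum_row.
  by apply: eq_bigr => i _; rewrite linearZ /= trmxK.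
by rewrite fsum big1 // => i _; rewrite f0 ?mulr0.
Qed.

End CommonEigenvectors.

(** * Every torus of the group lies in a conjugate of the split torus *)

Section ConjugacyOfTori.
Variables (K : closedFieldType) (n N : nat) (kap : bool).
Variables (B : 'cV[K]_N -> 'cV[K]_N -> K) (Q : 'cV[K]_N -> K).
Variables (G : set 'M[K]_N) (D : 'rV[K]_n -> 'M[K]_N).
Variables (idx : bool -> 'I_n -> 'I_N) (del : 'rV[K]_n -> 'rV[K]_N).
Hypothesis cg : classical_group kap B Q G D idx del.
Let BQ := cg_form cg.

Definition seq_perp (s : seq ('cV[K]_N * 'cV[K]_N)) v :=
  forall p, p \in s -> B p.1 v = 0 /\ B p.2 v = 0.

Definition seq_proj (s : seq ('cV[K]_N * 'cV[K]_N)) v :=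
  foldr (fun p u => perp_proj kap B p.1 p.2 u) v s.

Lemma seq_proj_perp s v : hyp_seq B Q s -> seq_perp s (seq_proj s v).
Proof.
elim: s => [|[e f] s IHs] //= /andP[/= /andP[ef hs] /andP[os ps]] p.
have {}IHs := IHs (introT andP (conj hs ps)).
rewrite inE => /orP[/eqP->|ps']; first by rewrite (perp_proj_e BQ ef) (perp_proj_f BQ ef).
have [p1 p2] := IHs _ ps'; have /and4P[/= a b c d] := allP os _ ps'.
have swap x y : B x y == 0 -> B y x = 0 by rewrite (formC_eq0 BQ) => /eqP.
by rewrite /perp_proj !(formDr BQ) p1 p2 (swap _ _ a) (swap _ _ b) (swap _ _ c) (swap _ _ d) !mulr0 !addr0.
Qed.

Lemma seq_projE s v u : seq_perp s v -> B v (seq_proj s u) = B v u.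
Proof.
elim: s => [|[e f] s IHs] //= sv.
have [/eqP ev /eqP fv] := sv (e, f) (mem_head _ _).
have Bve : B v e = 0 by apply/eqP; rewrite (formC_eq0 BQ).
have Bvf : B v f = 0 by apply/eqP; rewrite (formC_eq0 BQ).
rewrite (perp_projE BQ _ Bve Bvf) IHs // => p ps.
by apply: sv; rewrite inE ps orbT.
Qed.

Lemma seq_proj_id s v : seq_perp s v -> seq_proj s v = v.
Proof.
elim: s => [|[e f] s IHs] //= sv.
have [/= ev fv] := sv (e, f) (mem_head _ _).
rewrite IHs; last by move=> p ps; apply: sv; rewrite inE ps orbT.
by rewrite /perp_proj ev fv mulr0 oppr0 !scale0r !add0r.
Qed.

Lemma seq_proj_linear s a x y : seq_proj s (a *: x + y) = a *: seq_proj s x + seq_proj s y.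
Proof.
elim: s => [|[e f] s IHs] //=; rewrite IHs /perp_proj !(formDr BQ) /=.
move: (seq_proj s x) (seq_proj s y) => X Y.
apply/matrixP => i j; rewrite !mxE; ring.
Qed.

(** Orthogonality to $k<n$ pairs is $2k \le 2n-2$ linear conditions on a space of dimension at least
    $2n$, so two independent solutions remain. *)
Lemma seq_perp_dim s : (size s < n)%N -> exists x y,
  [/\ seq_perp s x, seq_perp s y, x != 0 & forall a, a *: x + y != 0].
Proof.
move=> sn; set k := size s.
pose vs j := if (j < k)%N then (nth (0, 0) s j).1 else (nth (0, 0) s (j - k)).2.
pose M : 'M[K]_(N, k + k) := \matrix_(i, j) B (vs j) (delta_mx i 0).
have BM (r : 'rV[K]_N) j : (r *m M) 0 j = B (vs j) r^T.
  rewrite mxE {2}[r]row_sum_delta linear_sum /= (form_sumr BQ); apply: eq_bigr => i _.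
  by rewrite linearZ /= (formZr BQ) trmx_delta mxE.
have kerP (r : 'rV[K]_N) : r *m M = 0 -> seq_perp s r^T.
  move=> rM p ps; have ik : (index p s < k)%N by rewrite index_mem.
  have lt1 : (index p s < k + k)%N by rewrite ltn_addr.
  have lt2 : (k + index p s < k + k)%N by rewrite ltn_add2l.
  have := BM r (Ordinal lt1); have := BM r (Ordinal lt2).
  by rewrite rM !mxE /vs /= ik ltnNge leq_addr /= addKn nth_index // => <- <-.
have rk : (2 <= \rank (kermx M))%N.
  rewrite mxrank_ker; have := rank_leq_col M; have := cg_dim cg; move: sn; rewrite -/k.
  by move: (\rank M) => r; lia.
pose W := row_base (kermx M).
have WM i : row i W *m M = 0.
  apply/eqP; rewrite -sub_kermx; apply: (submx_trans (row_sub _ _)).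
  by rewrite eq_row_base.
have Wf : row_free W by exact: row_base_free.
pose i0 : 'I_(\rank (kermx M)) := Ordinal (ltn_trans (ltnSn 0) rk).
pose i1 : 'I_(\rank (kermx M)) := Ordinal rk.
have comb a b : a *: row i0 W + b *: row i1 W = 0 -> a = 0 /\ b = 0.
  move=> E; have : (a *: delta_mx 0 i0 + b *: delta_mx 0 i1 : 'rV_(\rank (kermx M))) = 0.
    by apply: (row_free_inj Wf); rewrite mulmxDl -!scalemxAl -!rowE E mul0mx.
  move/rowP => H; have := H i0; have := H i1; rewrite !mxE /=.
  by rewrite !mulr1 !mulr0 addr0 add0r => -> ->.
exists (row i0 W)^T, (row i1 W)^T; split; [exact: kerP|exact: kerP| |].
  apply/eqP => /(congr1 trmx); rewrite trmxK trmx0 => E.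
  have [/eqP] : (1 : K) = 0 /\ (0 : K) = 0 by apply: comb; rewrite E scaler0 scale0r addr0.
  by rewrite oner_eq0.
move=> a; apply/eqP => /(congr1 trmx); rewrite linearP /= !trmxK trmx0 => E.
have [_ /eqP] : a = 0 /\ (1 : K) = 0 by apply: comb; rewrite scale1r.
by rewrite oner_eq0.
Qed.

(** On a plane of such vectors, $Q(tx+y)=0$ is a quadratic equation in $t$, solvable in $K$. *)
Lemma seq_perp_singular s : (size s < n)%N -> exists x, [/\ seq_perp s x, x != 0 & Q x = 0].
Proof.
move=> /seq_perp_dim[x [y [sx sy x0 xy]]].
have [Qx|Qx] := eqVneq (Q x) 0; first by exists x.
have kap1 : kap by apply: contraNT Qx => /(quad_kap0 BQ) ->.
have [t] := @solve_monicpoly K 2 (fun i => if i == 0%N then - (Q y / Q x) else - (B x y / Q x)) isT.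
rewrite !big_ord_recl big_ord0 /= expr0 expr1 mulr1 addr0 => tE.
exists (t *: x + y); split => //.
  by move=> p ps; have [a b] := sx p ps; have [c d] := sy p ps;
     rewrite !(formDr BQ) a b c d mulr0 addr0.
by rewrite (quadD BQ) kap1 mul1r tE; field.
Qed.

Variable T : set 'M[K]_N.
Hypotheses (TG : forall A, T A -> G A) (Tcomm : forall A A', T A -> T A' -> A *m A' = A' *m A).
Hypothesis Tdiag : forall A, T A -> diagonalizable A^T.
Hypothesis Tdiv : forall A, T A -> exists2 A', T A' & A = A' *m A'.

Let eigen := common_eigen T.

(** Isometries have eigenvalue $\pm 1$ on a nonsingular vector; since $A=A'^2$ within the torus, the
    eigenvalue of $A$ is a square of such, namely 1. *)
Lemma eigen_fixed v : eigen v -> Q v != 0 -> forall A, T A -> A *m v = v.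
Proof.
move=> ev Qv A /Tdiv[A' TA' ->]; have [c cE] := ev A' TA'.
have c2 : c ^+ 2 = 1.
  apply: (mulIf Qv); rewrite mul1r -(quadZ BQ) -cE; exact: (cg_isoQ cg _ (TG TA')).
by rewrite -mulmxA cE -scalemxAr cE scalerA -expr2 c2 scale1r.
Qed.

Lemma eigen_pairing A v u c d : T A -> A *m v = c *: v -> A *m u = d *: u -> B v u != 0 -> c * d = 1.
Proof.
move=> TA cE dE Bvu; apply: (mulIf Bvu).
by rewrite mul1r -[RHS](cg_isoB cg v u (TG TA)) cE dE (formZl BQ) (formZr BQ) mulrA.
Qed.

(** If $u$ pairs nontrivially with $e$, its eigenvalue is inverse to that of $e$, hence equal to
    that of $f$. So each correction term of the projection has the eigenvalue of $u$. *)
Lemma eigen_proj s v : hyp_seq B Q s -> (forall p, p \in s -> eigen p.1 /\ eigen p.2) ->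
  eigen v -> eigen (seq_proj s v).
Proof.
elim: s => [|[e f] s IHs] //= /andP[/= /andP[ef hs] /andP[os ps]] es ev.
have {}IHs : eigen (seq_proj s v).
  by apply: IHs; rewrite /hyp_seq ?hs // => p ps'; apply: es; rewrite inE ps' orbT.
have [/= ee ef'] := es (e, f) (mem_head _ _).
have Bef : B e f = 1 by have /and3P[_ _ /eqP] := ef.
move: (seq_proj s v) IHs => u eu A TA.
have [a aE] := ee A TA; have [b bE] := ef' A TA; have [c cE] := eu A TA.
have ab : a * b = 1 by apply: eigen_pairing aE bE _; rewrite // Bef oner_neq0.
have same (x y : 'cV[K]_N) k k' : B x u != 0 -> A *m x = k *: x -> A *m y = k' *: y -> k * k' = 1 -> c = k'.
  move=> xu xE yE kk; have kc := eigen_pairing TA xE cE xu.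
  have k0 : k != 0 by apply: contra_eq_neq kk => ->; rewrite mul0r eq_sym oner_neq0.
  by apply: (mulfI k0); rewrite kc kk.
exists c; rewrite /perp_proj !mulmxDr -!scalemxAr cE bE aE !scalerDr; congr (_ + (_ + _)).
  have [->|xu] := eqVneq (B e u) 0; first by rewrite oppr0 !scale0r scaler0.
  by rewrite (same e f a b) // !scalerA mulrC.
have [->|xu] := eqVneq (B f u) 0; first by rewrite mulr0 oppr0 !scale0r scaler0.
have ba : b * a = 1 by rewrite mulrC.
by rewrite (same f e b a) // !scalerA mulrC.
Qed.

Lemma eigen_span_form v : v != 0 -> Q v = 0 -> exists2 u, eigen u & B v u != 0.
Proof.
move=> v0 Qv; apply: contrapT => H; case/eqP: v0; apply: (cg_nondeg cg) => //.
apply: (common_eigen_span Tcomm Tdiag); first by move=> a x y; exact: (formDr BQ).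
by move=> u eu; apply/eqP; apply: contra_notT H => Bvu; exists u.
Qed.

(** Suppose there is none. Then projections of common eigenvectors are zero or nonsingular, hence
    fixed by $T$; as they span, $T$ acts trivially on the complement of [s], where any singular
    vector becomes a common eigenvector. *)
Lemma exists_singular_eigen s : (size s < n)%N -> hyp_seq B Q s ->
  (forall p, p \in s -> eigen p.1 /\ eigen p.2) ->
  exists v, [/\ seq_perp s v, eigen v, v != 0 & Q v = 0].
Proof.
move=> sn hs es; have [x [sx x0 Qx]] := seq_perp_singular sn.
apply: contrapT => H.
have fixed u A : eigen u -> T A -> A *m seq_proj s u = seq_proj s u.
  move=> eu TA; have eP := eigen_proj hs es eu.
  have [Q0|Qn] := eqVneq (Q (seq_proj s u)) 0; last exact: eigen_fixed.
  have [->|P0] := eqVneq (seq_proj s u) 0; first by rewrite mulmx0.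
  by case: H; exists (seq_proj s u); split=> //; exact: seq_proj_perp.
apply: H; exists x; split=> // A TA; exists 1; rewrite scale1r -(seq_proj_id sx).
apply/colP => j; apply/eqP; rewrite -subr_eq0; apply/eqP.
apply: (common_eigen_span Tcomm Tdiag (f := fun u => (A *m seq_proj s u) j 0 - seq_proj s u j 0)).
  move=> a y z; rewrite seq_proj_linear mulmxDr -scalemxAr !mxE; ring.
by move=> u eu; rewrite fixed // subrr.
Qed.

Lemma eigen_hyp_seq k : (k <= n)%N -> exists s, [/\ size s = k, hyp_seq B Q s &
  forall p, p \in s -> eigen p.1 /\ eigen p.2].
Proof.
elim: k => [|k IHk] kn; first by exists [::].
have [s [sk hs es]] := IHk (ltnW kn).
have sn : (size s < n)%N by rewrite sk.
have [e [se ee e0 Qe]] := exists_singular_eigen sn hs es.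
have [u eu Beu] := eigen_span_form e0 Qe.
pose f0 := (B e u)^-1 *: seq_proj s u.
have ef0 : eigen f0.
  move=> A TA; have [c cE] := eigen_proj hs es eu TA; exists c.
  by rewrite -scalemxAr cE !scalerA mulrC.
have sf0 : seq_perp s f0.
  by move=> p ps; have [a b] := seq_proj_perp u hs ps; rewrite !(formZr BQ) a b !mulr0.
have Bef0 : B e f0 = 1 by rewrite (formZr BQ) seq_projE // mulVf.
(* If $Q(f_0) \ne 0$ then $T$ fixes $f_0$, hence also $e$ since $B(e,f_0)=1$, so the combination is
   still a common eigenvector. *)
pose f := - Q f0 *: e + f0.
have ef : eigen f.
  rewrite /f; have [Qf|Qf] := eqVneq (Q f0) 0; first by rewrite Qf oppr0 scale0r add0r.
  move=> A TA; exists 1; rewrite scale1r mulmxDr -scalemxAr (eigen_fixed ef0 Qf TA).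
  have [c cE] := ee A TA; congr (_ *: _ + _).
  have := eigen_pairing TA cE (etrans (eigen_fixed ef0 Qf TA) (esym (scale1r _))).
  by rewrite Bef0 oner_neq0 mulr1 cE => -> //; rewrite scale1r.
have sf : seq_perp s f.
  move=> p ps; have [a b] := se p ps; have [c d] := sf0 p ps.
  by rewrite !(formDr BQ) a b c d mulr0 addr0.
exists ((e, f) :: s); split; first by rewrite /= sk.
- have /andP[hs1 hs2] := hs; rewrite /hyp_seq /= (make_hyp_pair BQ) // hs1 hs2 !andbT /=.
  apply/allP => p ps; have [a b] := se p ps; have [c d] := sf p ps.
  by rewrite /orth_pair /= !(formC_eq0 BQ e) !(formC_eq0 BQ f) a b c d eqxx.
- by move=> p; rewrite inE => /orP[/eqP->|/es].
Qed.

Lemma eigen_frame : exists2 g, G g & (T `<=` conj_torus D g)%classic.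
Proof.
have [s [sn hs es]] := eigen_hyp_seq (leqnn n).
pose H (i : 'I_n) := nth (0, 0) s i.
have sH : s = [seq H i | i <- enum 'I_n].
  apply: (@eq_from_nth _ (0, 0)); first by rewrite size_map size_enum_ord.
  move=> i; rewrite sn => lt; rewrite (nth_map (Ordinal lt)) ?size_enum_ord //.
  by rewrite /H nth_enum_ord.
have Hfam : hyp_family B Q H by apply/(hyp_seqP BQ); rewrite -sH.
have [g Gg gE] := cg_frame cg Hfam; exists g => // A TA.
have /choice[c cE] (si : bool * 'I_n) : exists c, A *m (g *m std_vec K idx si.1 si.2) = c *: (g *m std_vec K idx si.1 si.2).
  have ps : H si.2 \in s by rewrite mem_nth // sn.
  have [e1 e2] := es _ ps; have [g1 g2] := gE si.2.
  by case: (si.1); rewrite ?g1 ?g2; [exact: e2|exact: e1].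
have [|t t0 ->] := @diagonal_on_frame _ _ _ _ _ _ _ _ _ _ cg A g (fun s i => c (s, i)) (TG TA) Gg.
  by move=> b i; exact: (cE (b, i)).
by exists t.
Qed.

End ConjugacyOfTori.

(** * The symplectic and odd orthogonal groups *)

Section SymplecticInstance.
Variables (K : closedFieldType) (n : nat).
Local Notation N := (n + n)%N.

Definition sp_bilin (u v : 'cV[K]_N) : K := (u^T *m sp_form K n *m v) 0 0.

Lemma sp_bilinE u v : sp_bilin u v =
  \sum_i u (lshift n i) 0 * v (rshift n i) 0 - \sum_i u (rshift n i) 0 * v (lshift n i) 0.
Proof.
rewrite /sp_bilin -[u]vsubmxK -[v]vsubmxK.
set a := usubmx u; set b := dsubmx u; set c := usubmx v; set d := dsubmx v.
rewrite tr_col_mx /sp_form mul_row_block mul_row_col !mulmx0 add0r addr0 mulmxN !mulmx1 mulNmx.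
rewrite addrC !mxE; congr (_ - _); apply: eq_bigr => i _;
by rewrite !(col_mxEu, col_mxEd) !mxE.
Qed.

Lemma sp_quad_space : quad_space false sp_bilin (fun=> 0).
Proof.
split=> //= [a x y z|x y|x|a x y].
- by rewrite /sp_bilin linearP /= !mulmxDl -!scalemxAl !mxE.
- rewrite !sp_bilinE expr1 mulN1r opprB; congr (_ - _); apply: eq_bigr => i _; exact: mulrC.
- rewrite sp_bilinE mul0rn; apply/eqP; rewrite subr_eq0; apply/eqP.
  by apply: eq_bigr => i _; exact: mulrC.
- by rewrite !mulr0 mul0r mul0r !addr0.
Qed.

Definition sp_idx (b : bool) (i : 'I_n) : 'I_N := if b then rshift n i else lshift n i.

Lemma sp_bilin_delta u b i :
  sp_bilin u (delta_mx (sp_idx b i) 0) = (-1) ^+ (~~ b) * u (sp_idx (~~ b) i) 0.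
Proof.
rewrite sp_bilinE /sp_idx; case: b => /=.
  rewrite (bigD1 i) //= big1 => [|j ji]; last first.
    by rewrite mxE andbT (inj_eq (@rshift_inj _ _)) (negPf ji) mulr0.
  rewrite big1 => [|j _]; last by rewrite mxE eq_lrshift mulr0.
  by rewrite mxE !eqxx mulr1 addr0 subr0 mul1r.
rewrite big1 => [|j _]; last by rewrite mxE eq_rlshift mulr0.
rewrite (bigD1 i) //= big1 => [|j ji]; last first.
  by rewrite mxE andbT (inj_eq (@lshift_inj _ _)) (negPf ji) mulr0.
by rewrite mxE !eqxx mulr1 addr0 sub0r mulN1r.
Qed.

Lemma sp_idxP (k : 'I_N) : exists b i, k = sp_idx b i.
Proof.
by rewrite -(fintype.splitK k); case: (fintype.split k) => i /=; [exists false, i|exists true, i].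
Qed.

Lemma sp_idx_inj b i b' i' : sp_idx b i = sp_idx b' i' -> b = b' /\ i = i'.
Proof.
rewrite /sp_idx; case: b; case: b' => /eqP; rewrite ?eq_lrshift ?eq_rlshift //.
  by rewrite (inj_eq (@rshift_inj _ _)) => /eqP.
by rewrite (inj_eq (@lshift_inj _ _)) => /eqP.
Qed.

Lemma sp_col_eq m (A A' : 'M[K]_(m, N)) :
  (forall b i, A *m delta_mx (sp_idx b i) 0 = A' *m (delta_mx (sp_idx b i) 0 : 'cV_N)) -> A = A'.
Proof.
move=> E; apply/matrixP => r k; have [b [i ->]] := sp_idxP k.
by have /colP/(_ r) := E b i; rewrite -!colE !mxE.
Qed.

Lemma sp_nondeg v : (forall u, sp_bilin v u = 0) -> v = 0.
Proof.
move=> H; apply/colP => k; rewrite mxE; have [b [i ->]] := sp_idxP k.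
have := H (delta_mx (sp_idx (~~ b) i) 0); rewrite sp_bilin_delta negbK => /eqP.
by rewrite mulf_eq0 signr_eq0 => /eqP.
Qed.

Lemma SpP (A : 'M[K]_N) : Sp A <-> forall u v, sp_bilin (A *m u) (A *m v) = sp_bilin u v.
Proof.
have conjE u v : sp_bilin (A *m u) (A *m v) = (u^T *m (A^T *m sp_form K n *m A) *m v) 0 0.
  by rewrite /sp_bilin trmx_mul !mulmxA.
rewrite /Sp /symplectic /=; split=> [/eqP E u v|H]; first by rewrite conjE E.
have ent (M : 'M[K]_N) k l : ((delta_mx k 0 : 'cV_N)^T *m M *m (delta_mx l 0 : 'cV_N)) 0 0 = M k l.
  by rewrite trmx_delta -rowE -colE !mxE.
by apply/eqP/matrixP => k l; rewrite -ent -conjE H /sp_bilin ent.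
Qed.

Lemma sp_std_family : hyp_family sp_bilin (fun=> 0)
  (fun i => (std_vec K sp_idx false i, std_vec K sp_idx true i)).
Proof.
split=> [i|i j ij].
  by rewrite /hyp_pair /= eqxx sp_bilin_delta mxE !eqxx /= mulr1 expr0 eqxx.
have ne b b' : (sp_idx b i == sp_idx b' j) = false.
  by apply/eqP => /sp_idx_inj[_ /eqP]; rewrite (negPf ij).
have ne' b b' : (sp_idx b j == sp_idx b' i) = false by rewrite eq_sym ne.
by rewrite /orth_pair /= /std_vec !sp_bilin_delta !mxE !ne' /= ?mulr0 eqxx.
Qed.

Lemma Sp_of_frame (y : 'M[K]_N) :
  hyp_family sp_bilin (fun=> 0)
    (fun i => (y *m std_vec K sp_idx false i, y *m std_vec K sp_idx true i)) -> Sp y.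
Proof.
move=> [h1 h2]; apply/SpP; have Q0 := sp_quad_space.
have std b i b' i' : sp_bilin (y *m std_vec K sp_idx b i) (y *m std_vec K sp_idx b' i') =
    sp_bilin (std_vec K sp_idx b i) (std_vec K sp_idx b' i').
  have [k1 k2] := sp_std_family.
  have [<-|ii] := eqVneq i i'.
    have /and3P[_ _ /eqP /= a] := h1 i; have /and3P[_ _ /eqP /= c] := k1 i.
    case: b; case: b'; rewrite ?(formxx Q0) //; last by rewrite a c.
    by rewrite (formC Q0) a [RHS](formC Q0) c.
  have /and4P[/= /eqP a1 /eqP a2 /eqP a3 /eqP a4] := h2 _ _ ii.
  have /and4P[/= /eqP c1 /eqP c2 /eqP c3 /eqP c4] := k2 _ _ ii.
  by case: b; case: b'; rewrite ?a1 ?a2 ?a3 ?a4 ?c1 ?c2 ?c3 ?c4.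
have decomp (u : 'cV[K]_N) : u = \sum_k u k 0 *: delta_mx k 0.
  by rewrite {1}[u]matrix_sum_delta; apply: eq_bigr => k _; rewrite big_ord1.
move=> u v; rewrite [u]decomp [v]decomp !mulmx_sumr !(form_suml Q0); apply: eq_bigr => k _.
rewrite !(form_sumr Q0); apply: eq_bigr => l _.
rewrite -!scalemxAr !(formZl Q0) !(formZr Q0); congr (_ * (_ * _)).
by have [b [i ->]] := sp_idxP k; have [b' [i' ->]] := sp_idxP l; exact: std.
Qed.

Lemma Sp_unit (A : 'M[K]_N) : Sp A -> A \in unitmx.
Proof.
move=> /SpP H; rewrite -unitmx_tr -row_free_unit; apply: inj_row_free => v vA.
have Av : A *m v^T = 0 by rewrite -[A]trmxK -trmx_mul vA trmx0.
apply: trmx_inj; rewrite trmx0; apply: sp_nondeg => u.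
by rewrite -H Av (form0l sp_quad_space).
Qed.

Definition sp_del (t : 'rV[K]_n) : 'rV[K]_N := row_mx t (map_mx GRing.inv t).

Lemma sp_delE t b i : sp_del t 0 (sp_idx b i) = inv_if b (t 0 i).
Proof. by case: b; rewrite /sp_del /= ?row_mxEr ?row_mxEl // mxE. Qed.

Lemma sp_diag_std t b i : sp_diag t *m std_vec K sp_idx b i = inv_if b (t 0 i) *: std_vec K sp_idx b i.
Proof.
have -> : sp_diag t = diag_mx (sp_del t) by [].
have := sp_delE t b i; move: (sp_del t) => d dE; apply/colP => k.
rewrite mul_diag_mx !mxE andbT.
by have [->|_] := eqVneq k (sp_idx b i); rewrite ?dE // !mulr0.
Qed.

Lemma sp_classical_group : classical_group false sp_bilin (fun=> 0) (@Sp K n) (@sp_diag K n) sp_idx sp_del.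
Proof.
have Q0 := sp_quad_space; split.
- exact: sp_quad_space.
- by rewrite addn0 mul2n addnn.
- by move=> v H _; exact: sp_nondeg.
- by apply/SpP => u v; rewrite !mul1mx.
- by move=> x y /SpP Hx /SpP Hy; apply/SpP => u v; rewrite -!mulmxA Hx Hy.
- move=> x Hx; have xu := Sp_unit Hx; apply/SpP => u v.
  by rewrite -((SpP x).1 Hx) !mulKVmx.
- exact: Sp_unit.
- by move=> x u v /SpP.
- by [].
- move=> t t0; apply: Sp_of_frame; have [h1 h2] := sp_std_family.
  split=> [i|i j ij]; rewrite !sp_diag_std /hyp_pair /orth_pair /= !(formZl Q0) !(formZr Q0).
    have /and3P[_ _ /eqP /= ->] := h1 i; rewrite mulr1 divff ?eqxx //; exact: t0.
  have /and4P[/= /eqP -> /eqP -> /eqP -> /eqP ->] := h2 _ _ ij.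
  by rewrite !mulr0 eqxx.
- by [].
- exact: sp_delE.
- by move=> k; left; exact: sp_idxP.
- exact: sp_idx_inj.
- exact: sp_std_family.
- move=> H hH; pose y : 'M[K]_N := row_mx (\matrix_(r, i) (H i).1 r 0) (\matrix_(r, i) (H i).2 r 0).
  have yE i : y *m std_vec K sp_idx false i = (H i).1 /\ y *m std_vec K sp_idx true i = (H i).2.
    by split; rewrite -colE; apply/colP => r; rewrite mxE /y /= ?row_mxEl ?row_mxEr mxE.
  exists y => //; apply: Sp_of_frame; case: hH => h1 h2.
  by split=> [i|i j ij]; rewrite !(yE _).1 !(yE _).2; [have := h1 i|have := h2 i j ij].
- by move=> x y _ _; exact: sp_col_eq.
- move=> phi u v; rewrite !sp_bilinE rmorphB !rmorph_sum; congr (_ - _);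
  by apply: eq_bigr => i _; rewrite rmorphM !mxE.
- by move=> phi u; rewrite rmorph0.
- move=> phi x; rewrite /Sp /symplectic /= => /eqP E.
  have SF : map_mx phi (sp_form K n) = sp_form K n.
    by rewrite /sp_form map_block_mx !map_mx0 map_mxN map_mx1.
  by rewrite -{1}SF map_trmx -!map_mxM E SF.
Qed.

End SymplecticInstance.

(** * The odd orthogonal group, in every characteristic *)

Section OrthogonalInstance.
Variables (K : closedFieldType) (n : nat).
Local Notation N := (1 + (n + n))%N.

Definition so_bilin (u v : 'cV[K]_N) : K := so_form (u + v) - so_form u - so_form v.

Definition so_idx (b : bool) (i : 'I_n) : 'I_N := rshift 1 (sp_idx b i).
Definition so_idx0 : 'I_N := lshift (n + n) 0.

Lemma so_formE (v : 'cV[K]_N) :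
  so_form v = v so_idx0 0 ^+ 2 + \sum_i v (so_idx false i) 0 * v (so_idx true i) 0.
Proof. by []. Qed.

Lemma so_bilinE u v : so_bilin u v = u so_idx0 0 * v so_idx0 0 *+ 2 +
  \sum_i (u (so_idx false i) 0 * v (so_idx true i) 0 + u (so_idx true i) 0 * v (so_idx false i) 0).
Proof.
have E : \sum_i (u + v) (so_idx false i) 0 * (u + v) (so_idx true i) 0 =
   \sum_i u (so_idx false i) 0 * u (so_idx true i) 0 +
   \sum_i v (so_idx false i) 0 * v (so_idx true i) 0 +
   \sum_i (u (so_idx false i) 0 * v (so_idx true i) 0 + u (so_idx true i) 0 * v (so_idx false i) 0).
  rewrite -!big_split /=; apply: eq_bigr => i _; rewrite !mxE; ring.
rewrite /so_bilin !so_formE E mxE; ring.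
Qed.

Lemma so_quad_space : quad_space true so_bilin (@so_form K n).
Proof.
split=> //= [a x y z|x y|x|a x y].
- rewrite !so_bilinE !mxE.
  rewrite (eq_bigr (fun i => a * (x (so_idx false i) 0 * z (so_idx true i) 0 + x (so_idx true i) 0 * z (so_idx false i) 0) + (y (so_idx false i) 0 * z (so_idx true i) 0 + y (so_idx true i) 0 * z (so_idx false i) 0))).
    by rewrite big_split /= -mulr_sumr; ring.
  by move=> i _; rewrite !mxE; ring.
- by rewrite expr0 mul1r /so_bilin [y + x]addrC addrAC.
- rewrite so_bilinE so_formE mulrnDl -sumrMnl -expr2; congr (_ + _).
  by apply: eq_bigr => i _; rewrite [X in _ + X]mulrC mulr2n.
- rewrite mul1r so_bilinE !so_formE !mxE.
  rewrite (eq_bigr (fun i => a ^+ 2 * (x (so_idx false i) 0 * x (so_idx true i) 0) + a * (x (so_idx false i) 0 * y (so_idx true i) 0 + x (so_idx true i) 0 * y (so_idx false i) 0) + (y (so_idx false i) 0 * y (so_idx true i) 0))).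
    by rewrite big_split big_split /= -!mulr_sumr; ring.
  by move=> i _; rewrite !mxE; ring.
Qed.

Lemma so_idxP (k : 'I_N) : k = so_idx0 \/ exists b i, k = so_idx b i.
Proof.
rewrite -(fintype.splitK k); case: (fintype.split k) => i /=.
  by left; rewrite (ord1 i).
by right; have [b [j ->]] := sp_idxP i; exists b, j.
Qed.

Lemma so_idx_neq0 b i : (so_idx b i == so_idx0) = false.
Proof. exact: eq_rlshift. Qed.

Lemma so_idx_inj b i b' i' : so_idx b i = so_idx b' i' -> b = b' /\ i = i'.
Proof. by move=> /rshift_inj/sp_idx_inj. Qed.

Lemma so_idx_eq b i b' i' : (so_idx b i == so_idx b' i') = (b == b') && (i == i').
Proof.
apply/eqP/andP => [/so_idx_inj[-> ->]|[/eqP-> /eqP->]] //.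
Qed.

Lemma so_bilin_delta u b i : so_bilin u (delta_mx (so_idx b i) 0) = u (so_idx (~~ b) i) 0.
Proof.
rewrite so_bilinE mxE eq_sym so_idx_neq0 mulr0 mul0rn add0r.
rewrite (bigD1 i) //= big1 => [|j ji]; last first.
  by rewrite !mxE !so_idx_eq (negPf ji) !andbF !mulr0 addr0.
by rewrite addr0 !mxE !so_idx_eq !eqxx !andbT; case: b; rewrite /= mulr1 mulr0 ?addr0 ?add0r.
Qed.

Lemma so_form_delta b i : so_form (delta_mx (so_idx b i) 0 : 'cV[K]_N) = 0.
Proof.
rewrite so_formE mxE eq_sym so_idx_neq0 expr0n add0r big1 // => j _.
by rewrite !mxE !so_idx_eq; case: b; rewrite /= ?mul0r ?mulr0.
Qed.

Lemma so_nondeg v : (forall u, so_bilin v u = 0) -> so_form v = 0 -> v = 0.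
Proof.
move=> H; have v0 b i : v (so_idx b i) 0 = 0.
  by have := H (delta_mx (so_idx (~~ b) i) 0); rewrite so_bilin_delta negbK.
rewrite so_formE big1 => [|i _]; last by rewrite v0 mul0r.
rewrite addr0 => /eqP; rewrite sqrf_eq0 => /eqP v00.
by apply/colP => k; rewrite mxE; have [->|[b [i ->]]] := so_idxP k.
Qed.

Lemma so_std_family : hyp_family so_bilin (@so_form K n)
  (fun i => (std_vec K so_idx false i, std_vec K so_idx true i)).
Proof.
split=> [i|i j ij].
  by rewrite /hyp_pair /= !so_form_delta so_bilin_delta mxE !eqxx.
by rewrite /orth_pair /= !so_bilin_delta !mxE !so_idx_eq [j == i]eq_sym (negPf ij) /= eqxx.
Qed.

Local Notation e0 := (delta_mx so_idx0 0 : 'cV[K]_N).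

Lemma so_bilin_e0 b i : so_bilin e0 (delta_mx (so_idx b i) 0) = 0.
Proof. by rewrite so_bilin_delta mxE so_idx_neq0. Qed.

Lemma so_form_e0 : so_form e0 = 1.
Proof.
rewrite so_formE mxE !eqxx expr1n big1 ?addr0 // => i _.
by rewrite mxE so_idx_neq0 mul0r.
Qed.

Lemma so_basis (u : 'cV[K]_N) : u = u so_idx0 0 *: e0 +
  \sum_(i < n) (u (so_idx false i) 0 *: std_vec K so_idx false i + u (so_idx true i) 0 *: std_vec K so_idx true i).
Proof.
apply/colP => k; rewrite mxE summxE !mxE !eqxx andbT.
have [->|[b [j ->]]] := so_idxP k.
  rewrite eqxx mulr1 big1 ?addr0 // => i _; rewrite !mxE ![so_idx0 == _]eq_sym !so_idx_neq0.
  by rewrite !mulr0 addr0.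
rewrite so_idx_neq0 mulr0 add0r (bigD1 j) //= big1 => [|i ij]; last first.
  by rewrite !mxE !so_idx_eq [j == i]eq_sym (negPf ij) !andbF !mulr0 addr0.
by rewrite addr0 !mxE !so_idx_eq !eqxx; case: b; rewrite /= mulr1 mulr0 ?addr0 ?add0r.
Qed.

Lemma so_col_eq m (A A' : 'M[K]_(m, N)) : A *m e0 = A' *m e0 ->
  (forall b i, A *m std_vec K so_idx b i = A' *m std_vec K so_idx b i) -> A = A'.
Proof.
move=> E0 E; apply/matrixP => r k; have [->|[b [i ->]]] := so_idxP k.
  by have /colP/(_ r) := E0; rewrite -!colE !mxE.
by have /colP/(_ r) := E b i; rewrite -!colE !mxE.
Qed.

Lemma so_isometry (y : 'M[K]_N) :
  hyp_family so_bilin (@so_form K n)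
    (fun i => (y *m std_vec K so_idx false i, y *m std_vec K so_idx true i)) ->
  so_form (y *m e0) = 1 ->
  (forall b i, so_bilin (y *m e0) (y *m std_vec K so_idx b i) = 0) ->
  forall u, so_form (y *m u) = so_form u.
Proof.
have Q0 := so_quad_space; move=> [h1 h2] y1 y0 u.
have sumE (I : seq 'I_n) : uniq I ->
    so_form (\sum_(i <- I) (u (so_idx false i) 0 *: (y *m std_vec K so_idx false i) +
             u (so_idx true i) 0 *: (y *m std_vec K so_idx true i))) =
    \sum_(i <- I) u (so_idx false i) 0 * u (so_idx true i) 0.
  elim: I => [|i I IHI] /=; first by rewrite !big_nil (quad0 Q0).
  case/andP=> iI uI; rewrite !big_cons (quad_add Q0) IHI // (quad_add Q0) !(quadZ Q0).
  have /and3P[/= /eqP -> /eqP -> /eqP c] := h1 i.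
  rewrite (formZl Q0) (formZr Q0) c !mulr0 mulr1 add0r addr0 !mul1r.
  rewrite (form_sumr Q0) big_seq big1 ?addr0 // => j jI.
  have ij : i != j by apply: contraNneq iI => ->.
  have /and4P[/= /eqP a /eqP b /eqP c' /eqP d] := h2 _ _ ij.
  by rewrite !(form_addr Q0, form_addl Q0) !(formZl Q0, formZr Q0) a b c' d !mulr0 !addr0.
rewrite {1}[u]so_basis mulmxDr mulmx_sumr -scalemxAr (quadD Q0) y1 mulr1.
rewrite (form_sumr Q0) big1 => [|i _]; last first.
  by rewrite mulmxDr -!scalemxAr (form_addr Q0) !(formZr Q0) !y0 !mulr0 addr0.
rewrite mulr0 addr0 so_formE; congr (_ + _).
by rewrite -(sumE _ (index_enum_uniq _)); congr (so_form _); apply: eq_bigr => i _; rewrite mulmxDr -!scalemxAr.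
Qed.

Lemma isometry_bilin (y : 'M[K]_N) : (forall u, so_form (y *m u) = so_form u) ->
  forall u v, so_bilin (y *m u) (y *m v) = so_bilin u v.
Proof. by move=> H u v; rewrite /so_bilin -mulmxDr !H. Qed.

Lemma isometry_unit (y : 'M[K]_N) : (forall u, so_form (y *m u) = so_form u) -> y \in unitmx.
Proof.
move=> H; rewrite -unitmx_tr -row_free_unit; apply: inj_row_free => v vy.
have yv : y *m v^T = 0 by rewrite -[y]trmxK -trmx_mul vy trmx0.
apply: trmx_inj; rewrite trmx0; apply: so_nondeg.
  by move=> u; rewrite -(isometry_bilin H) yv (form0l so_quad_space).
by rewrite -H yv (quad0 so_quad_space).
Qed.

Lemma isometry_fix_std (y : 'M[K]_N) : (forall u, so_form (y *m u) = so_form u) ->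
  (forall b i, y *m std_vec K so_idx b i = std_vec K so_idx b i) ->
  exists2 c, y *m e0 = c *: e0 & c ^+ 2 = 1.
Proof.
move=> H ystd; have HB := isometry_bilin H.
pose v := y *m e0.
have v0 b i : v (so_idx b i) 0 = 0.
  rewrite -[b]negbK -so_bilin_delta -[delta_mx _ _]/(std_vec K so_idx (~~ b) i).
  by rewrite -ystd HB so_bilin_e0.
have vE : v = v so_idx0 0 *: e0.
  rewrite {1}[v]so_basis big1 ?addr0 // => i _; by rewrite !v0 !scale0r addr0.
exists (v so_idx0 0) => //; have := H e0.
by rewrite -/v {1}vE (quadZ so_quad_space) so_form_e0 mulr1.
Qed.

Lemma det_scale_e0 (c : K) (y : 'M[K]_N) : y *m e0 = c *: e0 ->
  (forall b i, y *m std_vec K so_idx b i = std_vec K so_idx b i) -> \det y = c.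
Proof.
move=> y0 ystd.
pose d : 'rV[K]_N := \row_k (if k == so_idx0 then c else 1).
have -> : y = diag_mx d.
  apply: so_col_eq => [|b i]; rewrite ?y0 ?ystd; apply/colP => k; rewrite mul_diag_mx !mxE andbT.
    by case: eqP; rewrite ?mulr0.
  by have [->|] := eqVneq k (so_idx b i); rewrite ?so_idx_neq0 ?mulr1 ?mulr0.
rewrite det_diag (bigD1 so_idx0) //= big1 => [|k k0]; rewrite mxE ?eqxx ?mulr1 //.
by rewrite (negPf k0).
Qed.

(** The quotient $x^{-1}y$ fixes the hyperbolic basis vectors, so it sends $e_0$ to $ce_0$ and has
    determinant $c$; hence $c=1$. *)
Lemma SO_inj (x y : 'M[K]_N) : SO x -> SO y ->
  (forall b i, x *m std_vec K so_idx b i = y *m std_vec K so_idx b i) -> x = y.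
Proof.
move=> [dx Hx] [dy Hy] E; have xu := isometry_unit Hx.
have Hz u : so_form ((invmx x *m y) *m u) = so_form u.
  by rewrite -Hx -mulmxA mulKVmx.
have zstd b i : (invmx x *m y) *m std_vec K so_idx b i = std_vec K so_idx b i.
  by rewrite -mulmxA -E mulKmx.
have [c c0 _] := isometry_fix_std Hz zstd.
have c1 : c = 1.
  by rewrite -(det_scale_e0 c0 zstd) det_mulmx det_inv dx dy invr1 mulr1.
have z1 : invmx x *m y = 1%:M.
  by apply: so_col_eq => [|b i]; rewrite mul1mx ?zstd // c0 c1 scale1r.
by rewrite -(mulKVmx xu y) z1 mulmx1.
Qed.

Lemma sp_det2 (A : 'M[K]_(n + n)) : Sp A -> \det A ^+ 2 = 1.
Proof.
rewrite /Sp /symplectic /= => /eqP/(congr1 determinant); rewrite !det_mulmx det_tr => E.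
have Ju : sp_form K n \in unitmx.
  have : sp_form K n *m (- sp_form K n) = 1%:M.
    rewrite mulmxN /sp_form mulmx_block !mul0mx !mulmx0 !mul1mx !mulmx1 !add0r !addr0.
    by rewrite opp_block_mx !oppr0 opprK -scalar_mx_block.
  by move/mulmx1_unit => [].
have J0 : \det (sp_form K n) != 0 by rewrite -unitfE -unitmxE.
by apply: (mulIf J0); rewrite mul1r -[RHS]E expr2 mulrAC.
Qed.

Lemma isometry_det2 (y : 'M[K]_N) : (forall u, so_form (y *m u) = so_form u) -> \det y ^+ 2 = 1.
Proof.
have Q0 := so_quad_space; move=> H; have HB := isometry_bilin H.
have [K2|K2] := eqVneq (2%:R : K) 0; last first.
  pose S : 'M[K]_N := \matrix_(k, l) so_bilin (delta_mx k 0) (delta_mx l 0).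
  have SB (u v : 'cV[K]_N) : (u^T *m S *m v) 0 0 = so_bilin u v.
    rewrite {2}[u]matrix_sum_delta {2}[v]matrix_sum_delta (form_suml Q0) -mulmxA mxE.
    apply: eq_bigr => k _; rewrite big_ord1 (formZl Q0) (form_sumr Q0) !mxE; congr (_ * _).
    by apply: eq_bigr => l _; rewrite big_ord1 (formZr Q0) mxE mulrC.
  have ent (M : 'M[K]_N) k l : ((delta_mx k 0 : 'cV_N)^T *m M *m (delta_mx l 0 : 'cV_N)) 0 0 = M k l.
    by rewrite trmx_delta -rowE -colE !mxE.
  have E : y^T *m S *m y = S.
    by apply/matrixP => k l; rewrite -ent -[RHS]ent SB -HB -SB trmx_mul !mulmxA.
  have S0 : \det S != 0.
    rewrite -unitfE -unitmxE -row_free_unit; apply: inj_row_free => v vS.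
    have vB u : so_bilin v^T u = 0 by rewrite -SB trmxK vS mul0mx mxE.
    apply: trmx_inj; rewrite trmx0; apply: so_nondeg => //.
    have /eqP := vB v^T; rewrite (formxx Q0) -mulr_natl mulf_eq0 (negPf K2) /= => /eqP.
    exact.
  have /(congr1 determinant) := E; rewrite !det_mulmx det_tr => E'.
  by apply: (mulIf S0); rewrite mul1r -[RHS]E' expr2 mulrAC.
(* In characteristic 2, e_0 spans the radical of the polar form and the      *)
(* quotient by it is symplectic.                                             *)
have K2n (x : K) : x *+ 2 = 0 by rewrite -mulr_natl K2 mul0r.
have opp (x : K) : - x = x by apply/eqP; rewrite -subr_eq0 -opprD oppr_eq0 -mulr2n K2n.
have B2 u v : so_bilin u v = sp_bilin (dsubmx (u : 'cV_(1 + (n + n)))) (dsubmx (v : 'cV_(1 + (n + n)))).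
  rewrite so_bilinE K2n add0r sp_bilinE opp -big_split /=.
  by apply: eq_bigr => i _; rewrite !mxE.
have rad u : (forall w, so_bilin u w = 0) -> u = u so_idx0 0 *: e0.
  move=> uB; rewrite {1}[u]so_basis big1 ?addr0 // => i _.
  have u0 b : u (so_idx b i) 0 = 0.
    by have := uB (delta_mx (so_idx (~~ b) i) 0); rewrite so_bilin_delta negbK.
  by rewrite !u0 !scale0r addr0.
have yu := isometry_unit H.
have ye : y *m e0 = e0.
  have /rad E : forall w, so_bilin (y *m e0) w = 0.
    move=> w; rewrite -(mulKVmx yu w) HB so_bilinE K2n add0r big1 // => i _.
    by rewrite !mxE !so_idx_neq0 !mul0r addr0.
  have := H e0; rewrite {1}E (quadZ Q0) so_form_e0 mulr1 => /eqP.
  rewrite -subr_eq0 -(expr1n _ 2) subr_sqr mulf_eq0 -{2}[1]opp orbb subr_eq0 => /eqP c1.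
  by rewrite {1}E c1 scale1r.
have yE : y = block_mx 1%:M (ursubmx (y : 'M_(1 + (n + n)))) 0 (drsubmx (y : 'M_(1 + (n + n)))).
  rewrite -{1}[y](@submxK _ 1 (n + n) 1 (n + n)); congr block_mx; apply/matrixP => k l.
    have /colP/(_ so_idx0) := ye; rewrite -colE (ord1 k) (ord1 l) !mxE !eqxx /= => <-.
    by congr (y _ _); apply: val_inj.
  have /colP/(_ (rshift 1 k)) := ye; rewrite -colE (ord1 l) !mxE eq_rlshift /= => E.
  by rewrite -[RHS]E; congr (y _ _); apply: val_inj.
set A := drsubmx _ in yE; have detA : \det y = \det A.
  by rewrite yE det_ublock det1 mul1r.
rewrite detA; apply: sp_det2; apply/SpP => u v.
have ext (u' : 'cV[K]_(n + n)) : dsubmx (y *m col_mx (0 : 'cV_1) u') = A *m u'.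
  by rewrite {1}yE mul_block_col mul0mx add0r col_mxKd.
by rewrite -!ext -B2 HB B2 !col_mxKd.
Qed.

Definition so_del (t : 'rV[K]_n) : 'rV[K]_N :=
  row_mx (const_mx 1 : 'rV[K]_1) (row_mx t (map_mx GRing.inv t)).

Lemma so_delE t b i : so_del t 0 (so_idx b i) = inv_if b (t 0 i).
Proof. by rewrite /so_del row_mxEr; exact: sp_delE. Qed.

Lemma so_del0 t : so_del t 0 so_idx0 = 1.
Proof. by rewrite /so_del row_mxEl mxE. Qed.

Lemma so_diag_std t b i : so_diag t *m std_vec K so_idx b i = inv_if b (t 0 i) *: std_vec K so_idx b i.
Proof.
have -> : so_diag t = diag_mx (so_del t) by [].
have := so_delE t b i; move: (so_del t) => d dE; apply/colP => k.
rewrite mul_diag_mx !mxE andbT.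
by have [->|_] := eqVneq k (so_idx b i); rewrite ?dE // !mulr0.
Qed.

Lemma so_diag_e0 t : so_diag t *m e0 = e0.
Proof.
have -> : so_diag t = diag_mx (so_del t) by [].
have := so_del0 t; move: (so_del t) => d dE; apply/colP => k.
rewrite mul_diag_mx !mxE andbT.
by have [->|_] := eqVneq k so_idx0; rewrite ?dE ?mulr1 // !mulr0.
Qed.

Lemma so_diag_SO (t : 'rV[K]_n) : nonzero_coords t -> SO (so_diag t).
Proof.
have Q0 := so_quad_space => t0; split.
  have -> : so_diag t = diag_mx (so_del t) by [].
  rewrite det_diag big_split_ord /= [X in X * _]big1 ?mul1r => [|i _]; last first.
    by rewrite (ord1 i); exact: so_del0.
  rewrite big_split_ord /= -big_split big1 //= => i _.
  by have := so_delE t false i; have := so_delE t true i; rewrite /so_idx /= => -> ->; rewrite divff.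
apply: so_isometry; rewrite ?so_diag_e0 ?so_form_e0 //; last first.
  by move=> b i; rewrite so_diag_std (formZr Q0) so_bilin_e0 mulr0.
have [h1 h2] := so_std_family.
split=> [i|i j ij]; rewrite !so_diag_std /hyp_pair /orth_pair /= !(formZl Q0) !(formZr Q0).
  have /and3P[/= /eqP a /eqP b /eqP c] := h1 i.
  by rewrite !(quadZ Q0) a b c !mulr0 mulr1 divff ?eqxx //; exact: t0.
have /and4P[/= /eqP -> /eqP -> /eqP -> /eqP ->] := h2 _ _ ij.
by rewrite !mulr0 eqxx.
Qed.

(** The given $2n$ vectors are completed by a vector orthogonal to them, rescaled to have $Q=1$. *)
Lemma so_frame (H : 'I_n -> 'cV[K]_N * 'cV[K]_N) : hyp_family so_bilin (@so_form K n) H ->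
  exists2 y, SO y & forall i, y *m std_vec K so_idx false i = (H i).1 /\ y *m std_vec K so_idx true i = (H i).2.
Proof.
have Q0 := so_quad_space; move=> hH; have [h1 h2] := hH.
pose M : 'M[K]_(N, n + n) := row_mx (\matrix_(r, i) so_bilin (H i).1 (delta_mx r 0)) (\matrix_(r, i) so_bilin (H i).2 (delta_mx r 0)).
have [v v0 vM] : exists2 v : 'rV[K]_N, v != 0 & v *m M = 0.
  have : kermx M != 0.
    rewrite -mxrank_eq0 mxrank_ker; have := rank_leq_col M; move: (\rank M) => r; lia.
  case/matrix0Pn => i [j ij]; exists (row i (kermx M)).
    by apply/matrix0Pn; exists 0, j; rewrite mxE.
  by apply/eqP; rewrite -sub_kermx row_sub.
have vperp i : so_bilin (H i).1 v^T = 0 /\ so_bilin (H i).2 v^T = 0.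
  have E b : (v *m M) 0 (sp_idx b i) = so_bilin (if b then (H i).2 else (H i).1) v^T.
    rewrite mxE {2}[v]row_sum_delta linear_sum /= (form_sumr Q0); apply: eq_bigr => r _.
    rewrite linearZ /= (formZr Q0) trmx_delta; congr (_ * _).
    by rewrite /M /sp_idx; case: b; rewrite ?row_mxEr ?row_mxEl mxE.
  by have := E false; have := E true; rewrite vM !mxE.
pose y c : 'M[K]_N := row_mx (c *: v^T : 'M[K]_(N, 1)) (row_mx (\matrix_(r, i) (H i).1 r 0) (\matrix_(r, i) (H i).2 r 0)).
have ystd c i : y c *m std_vec K so_idx false i = (H i).1 /\ y c *m std_vec K so_idx true i = (H i).2.
  by split; rewrite -colE; apply/colP => r; rewrite mxE /y row_mxEr /= ?row_mxEl ?row_mxEr mxE.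
have y0 c : y c *m e0 = c *: v^T.
  by rewrite -colE; apply/colP => r; rewrite mxE /y row_mxEl.
have yfam c : hyp_family so_bilin (@so_form K n)
    (fun i => (y c *m std_vec K so_idx false i, y c *m std_vec K so_idx true i)).
  by split=> [i|i j ij]; rewrite !(ystd c _).1 !(ystd c _).2; [have := h1 i|have := h2 i j ij].
have yperp c b i : so_bilin (y c *m e0) (y c *m std_vec K so_idx b i) = 0.
  rewrite y0 (formZl Q0); have [a1 a2] := vperp i; have [s1 s2] := ystd c i.
  by case: b; rewrite ?s1 ?s2 (formC Q0) ?a1 ?a2 !mulr0.
(* If $Q(v)=0$ then $v$ is also orthogonal to itself. Together with the family it forms a basis, so
   it would be a singular vector of the radical. *)
have Qv : so_form v^T != 0.
  apply: contra_neq v0 => Qv; apply: trmx_inj; rewrite trmx0.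
  pose w : 'cV[K]_N := v^T.
  have yu : y 1 \in unitmx \/ w = 0.
    have [->|w0] := eqVneq w 0; [by right|left].
    rewrite -unitmx_tr -row_free_unit; apply: inj_row_free => z zy.
    have yz : y 1 *m z^T = 0 by rewrite -[y 1]trmxK -trmx_mul zy trmx0.
    have zstd b i : z^T (so_idx b i) 0 = 0.
      have : so_bilin (y 1 *m z^T) (y 1 *m std_vec K so_idx (~~ b) i) = 0 by rewrite yz (form0l Q0).
      rewrite {1}[z^T]so_basis mulmxDr mulmx_sumr -scalemxAr (form_addl Q0) (formZl Q0) yperp mulr0 add0r.
      rewrite (form_suml Q0) (bigD1 i) //= big1 ?addr0 => [|j ji].
        rewrite mulmxDr -!scalemxAr (form_addl Q0) !(formZl Q0).
        have /and3P[/= /eqP a1 /eqP a2 /eqP a3] := (yfam 1).1 i.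
        by case: b => /=; rewrite ?(formxx Q0) ?a1 ?a2 ?mul0rn ?(formC Q0 (_ *m std_vec K so_idx true i)) a3 ?expr0 !mulr0 ?mul1r ?mulr1 ?add0r ?addr0.
      have /and4P[/= /eqP a1 /eqP a2 /eqP a3 /eqP a4] := (yfam 1).2 j i ji.
      by rewrite mulmxDr -!scalemxAr (form_addl Q0) !(formZl Q0); case: b; rewrite /= ?a1 ?a2 ?a3 ?a4 !mulr0 addr0.
    have z0 : z^T so_idx0 0 = 0.
      move: yz; rewrite {1}[z^T]so_basis big1 ?addr0 => [|i _]; last by rewrite !zstd !scale0r addr0.
      by rewrite -scalemxAr y0 scale1r => /eqP; rewrite scaler_eq0 (negPf w0) orbF => /eqP.
    apply: trmx_inj; rewrite trmx0; apply/colP => k; rewrite [RHS]mxE.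
    by have [->|[b [i ->]]] := so_idxP k.
  case: yu => // yu; apply: so_nondeg => // u; rewrite -(mulKVmx yu u).
  move: (invmx (y 1) *m u) => z; rewrite [z]so_basis mulmxDr mulmx_sumr (form_addr Q0).
  rewrite (form_sumr Q0) big1 ?addr0 => [|i _]; last first.
    by rewrite mulmxDr -!scalemxAr (form_addr Q0) !(formZr Q0) -[v^T]scale1r -y0 !yperp !mulr0 addr0.
  by rewrite -scalemxAr y0 scale1r (formZr Q0) (formxx Q0) Qv mul0rn mulr0.
have [c c2] : exists c, c ^+ 2 * so_form v^T = 1.
  have [c cE] := @solve_monicpoly K 2 (fun i => if i == 0%N then (so_form v^T)^-1 else 0) isT.
  exists c; rewrite cE !big_ord_recl big_ord0 /= expr0 mulr1 mul0r !addr0 mulVf //.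
have iso d : d ^+ 2 * so_form v^T = 1 -> forall u, so_form (y d *m u) = so_form u.
  by move=> d1; apply: so_isometry => //; rewrite y0 (quadZ Q0).
(* The sign of the image of e_0 is adjusted so that the determinant is 1. *)
pose s : 'M[K]_N := diag_mx (\row_k (if k == so_idx0 then \det (y c) else 1)).
have dety : \det (y c) ^+ 2 = 1 by apply: isometry_det2; exact: iso.
exists (y (\det (y c) * c)); last by move=> i; exact: ystd.
split; last by apply: iso; rewrite exprMn dety mul1r.
have -> : y (\det (y c) * c) = y c *m s.
  apply: so_col_eq => [|b i].
    rewrite y0 -mulmxA; have -> : s *m e0 = \det (y c) *: e0.
      by apply/colP => k; rewrite mul_diag_mx !mxE andbT; case: eqP; rewrite ?mulr0.
    by rewrite -scalemxAr y0 scalerA.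
  rewrite -mulmxA; have -> : s *m std_vec K so_idx b i = std_vec K so_idx b i.
    apply/colP => k; rewrite mul_diag_mx !mxE andbT.
    by have [->|] := eqVneq k (so_idx b i); rewrite ?so_idx_neq0 ?mulr1 ?mulr0.
  by have [a1 a2] := ystd (\det (y c) * c) i; have [b1 b2] := ystd c i; case: b; rewrite ?a1 ?a2 ?b1 ?b2.
rewrite det_mulmx -[RHS]dety expr2; congr (_ * _).
rewrite det_diag (bigD1 so_idx0) //= big1 => [|k k0]; rewrite mxE ?eqxx ?mulr1 //.
by rewrite (negPf k0).
Qed.

Lemma so_bilin_map (phi : {rmorphism K -> K}) u v :
  so_bilin (map_mx phi u) (map_mx phi v) = phi (so_bilin u v).
Proof.
rewrite !so_bilinE rmorphD rmorphMn rmorphM rmorph_sum !mxE; congr (_ + _).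
by apply: eq_bigr => i _; rewrite rmorphD !rmorphM !mxE.
Qed.

Lemma so_form_map (phi : {rmorphism K -> K}) (u : 'cV[K]_N) :
  so_form (map_mx phi u) = phi (so_form u).
Proof.
rewrite !so_formE rmorphD rmorphXn rmorph_sum !mxE; congr (_ + _).
by apply: eq_bigr => i _; rewrite rmorphM !mxE.
Qed.

Lemma so_classical_group :
  classical_group true so_bilin (@so_form K n) (@SO K n) (@so_diag K n) so_idx so_del.
Proof.
have Q0 := so_quad_space; split.
- exact: so_quad_space.
- by rewrite addn1 mul2n addnn.
- exact: so_nondeg.
- by split; [exact: det1|move=> v; rewrite mul1mx].
- move=> x y [dx Hx] [dy Hy]; split; first by rewrite det_mulmx dx dy mulr1.
  by move=> v; rewrite -mulmxA Hx Hy.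
- move=> x [dx Hx]; split; first by rewrite det_inv dx invr1.
  by move=> v; rewrite -Hx mulKVmx // isometry_unit.
- by move=> x [_ /isometry_unit].
- by move=> x u v [_ /isometry_bilin].
- by move=> x u [_ Hx].
- exact: so_diag_SO.
- by [].
- exact: so_delE.
- by move=> k; have [->|[b [i ->]]] := so_idxP k; [right; exact: so_del0|left; exists b, i].
- exact: so_idx_inj.
- exact: so_std_family.
- exact: so_frame.
- exact: SO_inj.
- exact: so_bilin_map.
- exact: so_form_map.
- move=> phi x SOx; have [dx Hx] := SOx; split; first by rewrite det_map_mx dx rmorph1.
  have Fstd (k : 'I_N) : map_mx phi x *m delta_mx k 0 = map_mx phi (x *m (delta_mx k 0 : 'cV_N)).
    by rewrite map_mxM map_delta_mx.
  have HB := isometry_bilin Hx; have [h1 h2] := so_std_family.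
  apply: so_isometry.
  + split=> [i|i j ij]; rewrite /hyp_pair /orth_pair /= !Fstd ?so_form_map !so_bilin_map ?Hx !HB.
      have /and3P[/= /eqP -> /eqP -> /eqP ->] := h1 i.
      by rewrite rmorph0 rmorph1 !eqxx.
    have /and4P[/= /eqP -> /eqP -> /eqP -> /eqP ->] := h2 _ _ ij.
    by rewrite rmorph0 !eqxx.
  + by rewrite Fstd so_form_map Hx so_form_e0 rmorph1.
  + by move=> b i; rewrite !Fstd so_bilin_map HB so_bilin_e0 rmorph0.
Qed.

End OrthogonalInstance.

(** * Counting stable maximal tori *)

Section CountingTori.
Variables (p e q : nat) (p_prime : prime p) (e_gt0 : (0 < e)%N) (q_def : q = (p ^ e)%N).
Variables (Fq : finFieldType) (card_Fq : #|Fq| = q).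
Variables (K : closedFieldType) (iota : {rmorphism Fq -> K}).
Hypothesis K_closure : is_algebraic_closure iota.
Variables (n N : nat) (kap : bool).
Variables (B : 'cV[K]_N -> 'cV[K]_N -> K) (Q : 'cV[K]_N -> K).
Variables (G : set 'M[K]_N) (D : 'rV[K]_n -> 'M[K]_N).
Variables (idx : bool -> 'I_n -> 'I_N) (del : 'rV[K]_n -> 'rV[K]_N).
Hypothesis cg : classical_group kap B Q G D idx del.
Let BQ := cg_form cg.
Let F : {rmorphism K -> K} := frob p_prime q_def card_Fq iota.
Let F_fixed x : F x = x -> exists a, iota a = x.
Proof. exact: frob_fixed. Qed.

Lemma fixed_lift a b (x : 'M[K]_(a, b)) : map_mx F x = x -> exists x0, map_mx iota x0 = x.
Proof.
move=> xF; have H ij : exists c, iota c = x ij.1 ij.2.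
  by apply: F_fixed; have /matrixP/(_ ij.1 ij.2) := xF; rewrite mxE.
have [f fE] := choice H; exists (\matrix_(i, j) f (i, j)).
by apply/matrixP => i j; rewrite !mxE fE.
Qed.

(** [cg_frame] and [cg_frame_inj] identify $y$ with the hyperbolic family it makes of the standard
    one; $mF(y)=y$ says that this family consists of fixed vectors of $v \mapsto mF(v)$, that is, is
    defined over $F_q$ in the coordinates given by [lang_GL]. *)
Lemma card_twisted_fixed m : G m ->
  card_is (fun y => G y /\ m *m map_mx F y = y) (hyp_count q n).
Proof.
move=> Gm; have [g0 g0u mg0] := lang_GL p_prime e_gt0 q_def card_Fq K_closure (cg_unit cg Gm).
rewrite -/F in mg0.
(* [J] identifies $F_q^N$ with the fixed vectors of $v \mapsto mF(v)$. *)
pose J (x : 'cV[Fq]_N) := g0 *m map_mx iota x.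
have Jlin a x y : J (a *: x + y) = iota a *: J x + J y.
  by rewrite /J map_mxD map_mxZ mulmxDr scalemxAr.
have Fiota a b (x : 'M[Fq]_(a, b)) : map_mx F (map_mx iota x) = map_mx iota x.
  by apply/matrixP => i j; rewrite !mxE frob_iota.
have JF x : m *m map_mx F (J x) = J x by rewrite /J map_mxM Fiota mulmxA mg0.
have Jinj : injective J.
  move=> x y /(congr1 (mulmx (invmx g0))); rewrite /J !mulKmx // => /matrixP E.
  by apply/matrixP => i j; have := E i j; rewrite !mxE => /fmorph_inj.
(* Since [m] is an isometry, $F(B(Jx,Jy)) = B(mF(Jx),mF(Jy)) = B(Jx,Jy)$, so the form descends to
   $F_q$. *)
have iB x y : exists b, iota b = B (J x) (J y).
  by apply: F_fixed; rewrite -(cg_mapB cg) -(cg_isoB cg _ _ Gm) !JF.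
have iQ x : exists b, iota b = Q (J x).
  by apply: F_fixed; rewrite -(cg_mapQ cg) -(cg_isoQ cg _ Gm) JF.
have [B0' B0'E] := choice (fun xy => iB xy.1 xy.2).
pose B0 x y := B0' (x, y).
have B0E x y : iota (B0 x y) = B (J x) (J y) by exact: (B0'E (x, y)).
have [Q0 Q0E] := choice iQ.
have BQ0 : quad_space kap B0 Q0.
  split=> [a x y z|x y|x|a x y|x k]; apply: (fmorph_inj iota).
  - by rewrite rmorphD rmorphM /= !B0E Jlin (formDl BQ).
  - by rewrite rmorphM rmorph_sign /= !B0E (formC BQ).
  - by rewrite rmorphMn /= B0E Q0E (formxx BQ).
  - by rewrite expr2 !rmorphD !rmorphM /= rmorph_nat !Q0E B0E Jlin (quadD BQ) expr2.
  - by rewrite Q0E (quad_kap0 BQ) // rmorph0.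
have sub0 : subspace [set: 'cV[Fq]_N] by split=> [|*]; rewrite inE.
have nd0 : nondegenerate B0 Q0 [set: 'cV[Fq]_N].
  move=> v _ vB vQ; apply: Jinj; rewrite {2}/J map_mx0 mulmx0.
  apply: (cg_nondeg cg); last by rewrite -Q0E vQ rmorph0.
  move=> u; rewrite -(mulKVmx g0u u); move: (invmx g0 *m u) => z.
  have -> : g0 *m z = \sum_k z k 0 *: J (delta_mx k 0).
    rewrite {1}[z]matrix_sum_delta mulmx_sumr; apply: eq_bigr => k _.
    by rewrite big_ord1 -scalemxAr /J map_delta_mx.
  rewrite (form_sumr BQ) big1 // => k _; rewrite (formZr BQ) -B0E vB ?inE //.
  by rewrite rmorph0 mulr0.
have c0 : #|[set: 'cV[Fq]_N]| = (#|Fq| ^ (2 * n + kap))%N.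
  by rewrite cardsT card_mx muln1 (cg_dim cg).
have := card_hyp_seq BQ0 sub0 nd0 c0; rewrite card_Fq => cS.
pose std := std_vec K idx.
(* Choice needs a total function: sequences that are not hyperbolic families of length [n] are sent
   to 0. *)
have exf (s : seq ('cV[Fq]_N * 'cV[Fq]_N)) : exists y : 'M[K]_N, size s = n -> hyp_seq B0 Q0 s ->
    G y /\ forall i : 'I_n, y *m std false i = J (nth (0, 0) s i).1 /\
                            y *m std true i = J (nth (0, 0) s i).2.
  have [sn|] := eqVneq (size s) n; last by move=> /eqP sn; exists 0.
  case: (boolP (hyp_seq B0 Q0 s)) => [hs|_]; last by exists 0.
  have sE : s = [seq nth (0, 0) s (i : 'I_n) | i <- enum 'I_n].
    apply: (@eq_from_nth _ (0, 0)); first by rewrite size_map size_enum_ord.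
    move=> i; rewrite sn => lt; rewrite (nth_map (Ordinal lt)) ?size_enum_ord //.
    by rewrite nth_enum_ord.
  move: hs; rewrite sE => /(hyp_seqP BQ0); rewrite -sE => -[h1 h2].
  have [y Gy yE] : exists2 y, G y & forall i, y *m std false i = J (nth (0, 0) s i).1 /\ y *m std true i = J (nth (0, 0) s i).2.
    apply: (cg_frame cg (H := fun i => (J (nth (0, 0) s i).1, J (nth (0, 0) s i).2))).
    split=> [i|i j ij].
      have /and3P[/eqP a /eqP b /eqP c] := h1 i.
      by rewrite /hyp_pair /= -!Q0E -B0E a b c rmorph0 rmorph1 !eqxx.
    have /and4P[/eqP a /eqP b /eqP c /eqP d] := h2 i j ij.
    by rewrite /orth_pair /= -!B0E a b c d rmorph0 !eqxx.
  by exists y.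
have [f fE] := choice exf.
have Fstd (y : 'M[K]_N) s i : map_mx F y *m std s i = map_mx F (y *m std s i).
  by rewrite map_mxM map_delta_mx.
apply: (card_is_bij (f := f)) cS.
- move=> s [sn _ hs]; have [Gy yE] := fE s sn hs; split=> //.
  apply: (cg_frame_inj cg) => //; first by apply: (cg_mul cg) => //; exact: (cg_mapG cg).
  move=> b i; have [e1 e2] := yE i; rewrite -mulmxA [map_mx F _ *m _]Fstd.
  by case: b; rewrite ?e1 ?e2 JF.
- move=> s s' [sn _ hs] [sn' _ hs'] E; have [_ yE] := fE s sn hs; have [_ yE'] := fE s' sn' hs'.
  apply: (@eq_from_nth _ (0, 0)); first by rewrite sn.
  move=> i; rewrite sn => lt; have [e1 e2] := yE (Ordinal lt); have [e1' e2'] := yE' (Ordinal lt).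
  move: e1 e2; rewrite E e1' e2' /= => /Jinj e1 /Jinj e2.
  by rewrite [LHS]surjective_pairing [RHS]surjective_pairing e1 e2.
move=> y [Gy yF].
have lift b i : exists x, J x = y *m std b i.
  have [|x xE] := @fixed_lift _ _ (invmx g0 *m (y *m std b i)).
    rewrite map_mxM map_invmx -Fstd.
    rewrite -[map_mx F g0](mulKmx (cg_unit cg Gm)) mg0 -[map_mx F y](mulKmx (cg_unit cg Gm)) yF.
    have mu : invmx m \in unitmx by rewrite unitmx_inv (cg_unit cg).
    apply: (can_inj (mulKmx g0u)); rewrite mulKVmx //.
    apply: (can_inj (mulKmx mu)); rewrite !mulmxA mulmxV ?mul1mx // unitmx_mul mu //.
  by exists x; rewrite /J xE mulKVmx.
have [x xE] := choice (fun bi => lift bi.1 bi.2).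
pose H i := (x (false, i), x (true, i)).
have sn : size [seq H i | i <- enum 'I_n] = n by rewrite size_map size_enum_ord.
have [s1 s2] := cg_std cg.
have HE : hyp_family B0 Q0 H.
  have inj0 (z : Fq) : (z == 0) = (iota z == 0) by rewrite fmorph_eq0.
  have inj1 (z : Fq) : (z == 1) = (iota z == 1) by rewrite fmorph_eq1.
  split=> [i|i j ij].
    by rewrite /hyp_pair /= !inj0 inj1 !Q0E B0E !xE /= !(cg_isoQ cg _ Gy) (cg_isoB cg _ _ Gy); exact: s1.
  rewrite /orth_pair /= !inj0 !B0E !xE /= !(cg_isoB cg _ _ Gy); exact: s2.
have hs : hyp_seq B0 Q0 [seq H i | i <- enum 'I_n] by apply/(hyp_seqP BQ0).
exists [seq H i | i <- enum 'I_n].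
  by split=> //; apply/allP => pr _; rewrite !inE.
have [Gf fsE] := fE _ sn hs; apply: (cg_frame_inj cg) => // b i.
have [] := fsE i; rewrite (nth_map i) ?size_enum_ord // nth_ord_enum /= !xE /= => e1 e2.
by case: b.
Qed.

(** The substitution $y = g^{-1}$ turns $g^{-1}F(g)=m$ into $mF(y)=y$. *)
Lemma card_lang m : G m ->
  card_is (fun g => G g /\ invmx g *m map_mx F g = m) (hyp_count q n).
Proof.
move=> Gm; apply: (card_is_bij (f := invmx)) (card_twisted_fixed Gm).
- move=> y [Gy yF]; split; first exact: (cg_inv cg).
  rewrite invmxK map_invmx -{1}yF mulmxK // map_unitmx; exact: (cg_unit cg).
- by move=> x y [/(cg_unit cg) xu _] [/(cg_unit cg) yu _] E; rewrite -[x]invmxK E invmxK.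
- move=> g [Gg gF]; exists (invmx g); last by rewrite invmxK.
  split; first exact: (cg_inv cg).
  by rewrite -gF map_invmx mulmxK // map_unitmx (cg_unit cg).
Qed.

End CountingTori.

Lemma card_is_count (T : eqType) (L : seq T) (a : pred T) : uniq L ->
  card_is (fun x => x \in L /\ a x) (count a L).
Proof.
move=> uL; exists (filter a L); split; rewrite ?filter_uniq ?size_filter // => x.
by rewrite mem_filter andbC; split=> [/andP|/andP].
Qed.

Lemma sum_undup_count (V : lmodType rat) (U : eqType) (l : seq U) (f : U -> V) :
  \sum_(T <- undup l) f T = \sum_(T <- l) ((count_mem T l)%:R^-1 : rat) *: f T.
Proof.
rewrite -[RHS]big_undup_iterop_count; apply: eq_big_seq => T; rewrite mem_undup => Tl.
have c0 : (count_mem T l)%:R != 0 :> rat.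
  by rewrite pnatr_eq0 -lt0n -has_count has_pred1.
change (f T = ((count_mem T l)%:R^-1 *: f T) *+ count_mem T l).
by rewrite -scaler_nat scalerA mulfV // scale1r.
Qed.

Lemma sum_by_index (V : lmodType rat) (I : finType) (T : eqType) (L : seq (I * T)) k (f : I -> V) :
  (forall i, count (fun x => x.1 == i) L = k) ->
  \sum_(x <- L) f x.1 = (k%:R : rat) *: \sum_i f i.
Proof.
move=> Lk; rewrite (partition_big (fun x => x.1) xpredT) //= scaler_sumr.
apply: eq_bigr => i _; rewrite (eq_bigr (fun=> f i)); last by move=> x /eqP ->.
by rewrite big_const_seq iter_addr_0 Lk scaler_nat.
Qed.

Lemma conj_by_exists n (v w : signed_perm n) : exists w', conj_by v w' w.
Proof.
pose s : 'S_n := (v.1 * w.1 * v.1^-1)%g.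
exists (s, [ffun i => v.2 i (+) w.2 (v.1 i) (+) v.2 (s i)]) => i /=.
by rewrite ffunE !permM permKV addbK.
Qed.

Lemma conj_by_act (K : closedFieldType) n (v w' w : signed_perm n) (t : 'rV[K]_n) :
  conj_by v w' w -> signed_act w (signed_act v t) = signed_act v (signed_act w' t).
Proof.
move=> vw; apply/rowP => j; have [i ->] : exists i, j = v.1 (w'.1 i).
  by exists ((w'.1^-1)%g ((v.1^-1)%g j)); rewrite !permKV.
have [v1 v2] := vw i; rewrite [in RHS]signed_actE v1 !signed_actE !inv_if_addb.
by congr inv_if; rewrite addbC -v2 addbC.
Qed.

Lemma torus_order_gt0 q n (w : signed_perm n) : (1 < q)%N -> (0 < torus_order q w)%N.
Proof.
move=> q1; rewrite /torus_order; elim/big_ind: _ => // [a b|X /imsetP[x _ ->]].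
  by rewrite muln_gt0 => -> ->.
rewrite /cycle_order; case: odd => //.
rewrite -subn1 subn_gt0 -(expn0 q) ltn_exp2l //.
by rewrite lt0n card_porbit_neq0.
Qed.

(** * The sum over stable maximal tori as an average over the Weyl group *)

Section SumOverTori.
Variables (p e q : nat) (p_prime : prime p) (e_gt0 : (0 < e)%N) (q_def : q = (p ^ e)%N).
Variables (Fq : finFieldType) (card_Fq : #|Fq| = q).
Variables (K : closedFieldType) (iota : {rmorphism Fq -> K}).
Hypothesis K_closure : is_algebraic_closure iota.
Variables (n N : nat) (kap : bool).
Variables (B : 'cV[K]_N -> 'cV[K]_N -> K) (Q : 'cV[K]_N -> K).
Variables (G : set 'M[K]_N) (D : 'rV[K]_n -> 'M[K]_N).
Variables (idx : bool -> 'I_n -> 'I_N) (del : 'rV[K]_n -> 'rV[K]_N).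
Hypothesis cg : classical_group kap B Q G D idx del.
Let BQ := cg_form cg.
Let F : {rmorphism K -> K} := frob p_prime q_def card_Fq iota.
Let FE x : F x = x ^+ q. Proof. exact: frobE. Qed.
Let q1 : (1 < q)%N. Proof. exact: (q_gt1 p_prime e_gt0 q_def). Qed.
Let qK : q%:R = 0 :> K. Proof. exact: (natr_q p_prime e_gt0 q_def card_Fq iota). Qed.
Let gunit g : G g -> g \in unitmx := fun Gg => cg_unit cg Gg.
Let GF g : G g -> G (map_mx F g) := fun Gg => cg_mapG cg F Gg.

(** Diagonal entries in $K$ are roots of unity of order prime to $p$ and have square roots in $K$,
    so elements of [T] are diagonalizable and squares in [T]. Then [eigen_frame] puts [T] inside a
    conjugate of $T_0$, and maximality gives equality. *)
Lemma torus_is_conj T : is_maximal_torus G T -> exists2 g, G g & T = conj_torus D g.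
Proof.
move=> [Ttor TG Tmax]; have [_ [d [f [h [_ fT hT fM]]]]] := Ttor.
have GmX (A : 'M[K]_d) m : Gm_power A -> Gm_power (A ^+ m.+1) /\ f (A ^+ m.+1) = f A ^+ m.+1.
  move=> GA; elim: m => [|m [GAm fAm]]; first by rewrite !expr1.
  rewrite exprS -[A * _]/(A *m _) fM // fAm [RHS]exprS; split=> //; split.
    by rewrite /GL /= unitmx_mul; apply/andP; split; [exact: GA.1|exact: GAm.1].
  move: GA.2 GAm.2 => /diag_mxP[a ->] /diag_mxP[b ->].
  by rewrite mulmx_diag; exact: diag_mx_is_diag.
have Gm1 : Gm_power (1%:M : 'M[K]_d).
  by split; [rewrite /GL /= unitmx1|exact: scalar_mx_is_diag].
have f1 : f 1%:M = 1%:M.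
  have u := gunit (TG _ (fT _ Gm1).1).
  by rewrite -[LHS](mulKmx u) -fM // mul1mx mulVmx.
have [||A TA|A TA|g Gg sub] := @eigen_frame K n N kap B Q G D idx del cg T.
- exact: TG.
- by move=> A A'; exact: (torus_comm Ttor).
- have [GA fA] := hT _ TA.
  have [M M0 AM] := expq_periodic_seq p_prime q_def card_Fq K_closure [seq h A i i | i <- enum 'I_d].
  have m0 : (0 < (q ^ M).-1)%N by rewrite -subn1 subn_gt0 -(expn0 q) ltn_exp2l.
  apply: (finite_order_diagonalizable m0); first exact: (natr_expq_pred p_prime e_gt0 q_def card_Fq iota M0).
  rewrite -(prednK m0) in AM *; set m := (q ^ M).-1.-1.
  have [_ fm] := GmX (h A) m GA.
  have hAm : h A ^+ m.+1 = 1%:M.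
    have dX (a : 'rV[K]_d) k : diag_mx a ^+ k = diag_mx (\row_i a 0 i ^+ k).
      elim: k => [|k IHk]; first by
        rewrite expr0 -[1]/(1%:M) -diag_const_mx; congr diag_mx; apply/rowP => i; rewrite !mxE.
      by rewrite exprS IHk -[_ * _]/(_ *m _) mulmx_diag; congr diag_mx; apply/rowP => i; rewrite !mxE exprS.
    move: GA (GA.2) AM => GA /diag_mxP[a aE] AM; rewrite aE dX -diag_const_mx; congr diag_mx.
    apply/rowP => i; rewrite !mxE.
    have ai : h A i i = a 0 i by rewrite aE mxE eqxx.
    rewrite -ai /m prednK //; apply: (periodic_order p_prime e_gt0 q_def) M0 _.
      exact: Gm_entry_neq0.
    by apply: AM; apply: map_f; rewrite mem_enum.
  have trX k : A^T ^+ k = (A ^+ k)^T.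
    elim: k => [|k IHk]; first by rewrite !expr0 -[1]/(1%:M) trmx1.
    by rewrite exprSr IHk exprS; exact: (esym (trmx_mul A (A ^+ k))).
  by rewrite trX -{1}fA -fm hAm f1 trmx1.
- have [GA fA] := hT _ TA; have [a aE] := diag_mxP _ GA.2.
  have sq x : exists y : K, y ^+ 2 = x.
    have [y yE] := @solve_monicpoly K 2 (fun i => if i == 0%N then x else 0) isT.
    by exists y; rewrite yE !big_ord_recl big_ord0 /= expr0 mulr1 mul0r !addr0.
  have [r rE] := choice sq; pose b : 'rV[K]_d := \row_i r (a 0 i).
  have bb : diag_mx b *m diag_mx b = h A.
    by rewrite mulmx_diag aE; congr diag_mx; apply/rowP => i; rewrite !mxE -expr2 rE.
  have Gb : Gm_power (diag_mx b).
    split; last exact: diag_mx_is_diag.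
    by have := GA.1; rewrite /GL /= -bb unitmx_mul andbb.
  by exists (f (diag_mx b)); [exact: (fT _ Gb).1|rewrite -fM // bb fA].
exists g => //; apply/esym/Tmax => //; [exact: (conj_torus_is_torus cg)|exact: (conj_torus_sub cg)].
Qed.

Lemma weyl_image_diag x w t : G x -> nonzero_coords t -> weyl_image D x w -> weyl_image D (x *m D t) w.
Proof.
move=> Gx t0 xw u u0; have Dt := gunit (cg_torus cg t0).
have GxD : G (x *m D t) by apply: (cg_mul cg) => //; exact: (cg_torus cg).
apply: (canLR (mulmxK (gunit GxD))).
by rewrite mulmxA -(weyl_image_mul cg Gx xw u0) -!mulmxA (diag_comm cg).
Qed.

Lemma weyl_image_diff x y w : G x -> G y -> weyl_image D x w -> weyl_image D y w ->
  exists2 t, nonzero_coords t & y = x *m D t.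
Proof.
move=> Gx Gy xw yw; have [t treg] := exists_regular K n; have [t0 _ _] := treg.
have [||s s0 E] := @centralizer_torus K n N kap B Q G D idx del cg t (invmx x *m y) treg.
- by apply: (cg_mul cg) => //; exact: (cg_inv cg).
- rewrite -mulmxA (weyl_image_mul cg Gy yw t0).
  apply: (canLR (mulKmx (gunit Gx))); rewrite !mulmxA (weyl_image_mul cg Gx xw t0).
  by rewrite mulmxK // gunit.
by exists s => //; rewrite -E mulKVmx // gunit.
Qed.

Lemma weyl_image_conj x x' y v w w' : G x -> G x' -> G y ->
  weyl_image D x v -> weyl_image D x' v -> weyl_image D y w -> conj_by v w' w ->
  weyl_image D (invmx x *m y *m x') w'.
Proof.
move=> Gx Gx' Gy xv x'v yw vw t t0.
have GX : G (invmx x *m y *m x') by do 2?apply: (cg_mul cg) => //; exact: (cg_inv cg).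
apply: (canLR (mulmxK (gunit GX))).
rewrite -!mulmxA (weyl_image_mul cg Gx' x'v t0) (mulmxA y).
rewrite (weyl_image_mul cg Gy yw (signed_act_nonzero v t0)).
apply: (canLR (mulKmx (gunit Gx))); rewrite (conj_by_act t vw) !mulmxA.
rewrite (weyl_image_mul cg Gx xv (signed_act_nonzero w' t0)).
by rewrite -!mulmxA mulKVmx // gunit.
Qed.

(** $F$ acts trivially on $W$: signed permutations of coordinates commute with $F$ on the split
    torus, where $F$ is surjective. *)
Lemma weyl_image_frob x w : G x -> weyl_image D x w -> weyl_image D (map_mx F x) w.
Proof.
move=> Gx xw t t0.
have [s sE] := choice (frob_surj p_prime e_gt0 q_def card_Fq iota).
pose t' : 'rV[K]_n := \row_i s (t 0 i).
have tE : map_mx F t' = t by apply/rowP => i; rewrite !mxE; exact: sE.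
have t'0 : nonzero_coords t'.
  by move=> i; have := t0 i; rewrite -tE mxE fmorph_eq0.
apply: (canLR (mulmxK (gunit (GF Gx)))); rewrite -tE -(map_diag cg) -map_mxM.
rewrite (weyl_image_mul cg Gx xw t'0) map_mxM (map_diag cg); congr (D _ *m _).
have FV b z : F (inv_if b z) = inv_if b (F z) by case: b => //=; rewrite fmorphV.
apply/rowP => j; rewrite -[j](permKV w.1).
by rewrite [map_mx F (signed_act _ _) _ _]mxE !signed_actE FV [map_mx F _ _ _]mxE.
Qed.

Lemma frobenius_conj_torus g : G g ->
  ((@frobenius K q N) @` conj_torus D g = conj_torus D (map_mx F g))%classic.
Proof.
move=> Gg; have frobE' (A : 'M[K]_N) : frobenius q A = map_mx F A by exact: frobeniusE.
have im t : frobenius q (g *m D t *m invmx g) = map_mx F g *m D (map_mx F t) *m invmx (map_mx F g).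
  by rewrite frobE' !map_mxM map_invmx (map_diag cg).
have [s sE] := choice (frob_surj p_prime e_gt0 q_def card_Fq iota).
apply/seteqP; split=> [_ [_ [t t0 <-] <-]|_ [t t0 <-]].
  by rewrite im; exists (map_mx F t) => // i; rewrite mxE fmorph_eq0.
have tE : map_mx F (\row_i s (t 0 i)) = t by apply/rowP => i; rewrite !mxE; exact: sE.
exists (g *m D (\row_i s (t 0 i)) *m invmx g); last by rewrite im tE.
by exists (\row_i s (t 0 i)) => // i; have := t0 i; rewrite -{1}tE mxE fmorph_eq0.
Qed.

(** Both sides say that $g^{-1}h$ normalizes $T_0$. *)
Lemma conj_torus_eqP g h : G g -> G h ->
  (conj_torus D g = conj_torus D h <-> exists w, weyl_image D (invmx g *m h) w).
Proof.
move=> Gg Gh; have [gu hu] := (gunit Gg, gunit Gh).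
have Gx : G (invmx g *m h) by apply: (cg_mul cg) => //; exact: (cg_inv cg).
have xconj t : (invmx g *m h) *m D t *m invmx (invmx g *m h) = invmx g *m (h *m D t *m invmx h) *m g.
  apply: (canLR (mulmxK (gunit Gx))).
  by rewrite -!mulmxA (mulKVmx gu) (mulVmx hu) mulmx1.
split=> [E|[w xw]].
  apply: (normalizer_weyl cg Gx) => t t0.
  have : conj_torus D h (h *m D t *m invmx h) by exists t.
  by rewrite -E => -[t' t'0 E']; exists t' => //; rewrite xconj -E' (conj_torus_conjK cg).
have [_ _ hmax] := conj_torus_maximal cg Gh.
apply: hmax; [exact: (conj_torus_is_torus cg)|exact: (conj_torus_sub cg)|].
move=> _ [t t0 <-]; exists (signed_act w t); first exact: signed_act_nonzero.
by rewrite -(xw t t0) xconj !mulmxA mulmxV // mul1mx mulmxK.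
Qed.

Variable nw : signed_perm n -> 'M[K]_N.
Hypotheses (Gnw : forall w, G (nw w)) (nwP : forall w, weyl_image D (nw w) w).

Lemma lang_torus_eq w s t : nonzero_coords s -> nonzero_coords t ->
  (invmx (D t) *m (nw w *m D s) *m map_mx F (D t) = nw w <-> forall i, torus_eq_at q w (s 0) t i).
Proof.
move=> s0 t0; have Dt := gunit (cg_torus cg t0).
pose u : 'rV[K]_n := \row_i (s 0 i * t 0 i ^+ q).
have u0 : nonzero_coords u by move=> i; rewrite mxE mulf_neq0 ?expf_neq0.
have E : nw w *m D s *m map_mx F (D t) = D (signed_act w u) *m nw w.
  rewrite (map_diag cg) -mulmxA (diagM cg) -(weyl_image_mul cg (Gnw w) (nwP w) u0).
  by congr (_ *m D _); apply/rowP => i; rewrite !mxE FE.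
have -> : (invmx (D t) *m (nw w *m D s) *m map_mx F (D t) = nw w) <-> signed_act w u = t.
  rewrite -[_ *m _ *m map_mx F _]mulmxA E; split=> [H|->]; last by rewrite mulKmx.
  apply: (diag_inj cg); apply: (can_inj (mulmxK (gunit (Gnw w)))).
  by rewrite -{2}H mulKVmx.
split=> [H i|H]; first by rewrite /torus_eq_at -{1}H signed_actE mxE.
by apply/rowP => j; rewrite -[j](permKV w.1) signed_actE mxE; exact/esym/H.
Qed.

(** Fixing one lift [nw w] per Weyl element keeps the set of pairs finite, while every stable torus
    is still reached. *)
Definition good_pair (x : signed_perm n * 'M[K]_N) :=
  G x.2 /\ invmx x.2 *m map_mx F x.2 = nw x.1.

Lemma stable_tori_conj T : stable_maximal_tori q G T <->
  exists2 x, good_pair x & T = conj_torus D x.2.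
Proof.
split=> [[Tmax TF]|[[w g] [/= Gg gF] ->]]; last first.
  split; first exact: (conj_torus_maximal cg).
  rewrite frobenius_conj_torus //; apply/esym/conj_torus_eqP => //; first exact: GF.
  by exists w; rewrite gF.
have [g Gg TE] := torus_is_conj Tmax.
move: TF; rewrite TE frobenius_conj_torus // => /esym/(conj_torus_eqP Gg (GF Gg))[w gw].
have Gx : G (invmx g *m map_mx F g) by apply: (cg_mul cg); [exact: (cg_inv cg)|exact: GF].
have [s s0 sE] := weyl_image_diff (Gnw w) Gx (nwP w) gw.
have [r [_ sr rP]] := card_torus_eq q1 qK w s0.
(* Lang's theorem for the twisted torus: the number of solutions [torus_order q w] is positive. A
   solution [t] absorbs the factor [D s] of $g^{-1}F(g)$. *)
have : (0 < size r)%N by rewrite sr torus_order_gt0.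
case: r sr rP => // t r _ rP _; have /rP tP := mem_head t r.
have t0 : nonzero_coords t by move=> i; case: (tP i).
have GD : G (D t) by exact: (cg_torus cg).
exists (w, g *m D t).
  split=> /=; first exact: (cg_mul cg).
  have -> : invmx (g *m D t) = invmx (D t) *m invmx g.
    rewrite -[LHS]mulmx1; apply: (canLR (mulKmx (gunit (cg_mul cg Gg GD)))).
    by rewrite mulmxA mulmxK ?gunit // mulmxV // gunit.
  rewrite map_mxM !mulmxA -(mulmxA _ (invmx g)) sE.
  by apply/(lang_torus_eq w s0 t0) => i; case: (tP i).
apply/(conj_torus_eqP Gg (cg_mul cg Gg GD)); exists (1%g, [ffun=> false]).
move=> u u0; rewrite mulKmx ?gunit //; apply: (canLR (mulmxK (gunit GD))).
rewrite (diag_comm cg); congr (D _ *m _); apply/rowP => j.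
by rewrite mxE /= ffunE invg1 perm1.
Qed.

Lemma good_pair_conj w g w' h v : good_pair (w, g) -> G h ->
  weyl_image D (invmx g *m h) v -> conj_by v w' w ->
  weyl_image D (invmx h *m map_mx F h) w'.
Proof.
move=> [/= Gg gF] Gh hv vw; have [gu hu] := (gunit Gg, gunit Gh).
have Gx : G (invmx g *m h) by apply: (cg_mul cg) => //; exact: (cg_inv cg).
have := weyl_image_conj Gx (GF Gx) (Gnw w) hv (weyl_image_frob Gx hv) (nwP w) vw.
rewrite -gF; congr (weyl_image D _ _).
have -> : invmx (invmx g *m h) = invmx h *m g.
  rewrite -[LHS]mulmx1; apply: (canLR (mulKmx (gunit Gx))).
  by rewrite !mulmxA mulmxK // mulVmx.
have Fgu : map_mx F g \in unitmx by rewrite map_unitmx.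
by rewrite map_mxM map_invmx -!mulmxA (mulKVmx gu) (mulKVmx Fgu).
Qed.

(** [type_repr] picks an arbitrary element of [torus_type]; any such element is conjugate to [w],
    and cycle weights are class functions. *)
Lemma type_repr_weight (R : comAlgType rat) (z : nat -> bool -> R) w g :
  good_pair (w, g) -> cycle_weight z (type_repr q G D (conj_torus D g)) = cycle_weight z w.
Proof.
move=> gw; have [/= Gg gF] := gw.
have : torus_type q G D (conj_torus D g) (type_repr q G D (conj_torus D g)).
  apply: xgetPex; exists w; exists g; split=> //.
  rewrite (_ : frobenius q g = map_mx F g); last exact: frobeniusE.
  by rewrite gF.
move: (type_repr _ _ _ _) => w2 [h [Gh /(conj_torus_eqP Gg Gh)[v hv] hw2]].
have [w' vw] := conj_by_exists v w.
have hw' := good_pair_conj gw Gh hv vw.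
rewrite (_ : frobenius q h = map_mx F h) in hw2; last exact: frobeniusE.
by rewrite (weyl_image_inj cg hw2 hw') (cycle_weight_conj z vw).
Qed.

Lemma torus_order_conj v w' w : @conj_by n v w' w -> torus_order q w' = torus_order q w.
Proof.
move=> vw; have E (u : signed_perm n) : (torus_order q u)%:R =
    cycle_weight (R := rat^o) (fun k b => (cycle_order q k b)%:R) u by rewrite natr_prod.
have H := cycle_weight_conj (R := rat^o) (fun k b => (cycle_order q k b)%:R) vw.
rewrite -!E in H.
have : (torus_order q w')%:R = (torus_order q w)%:R :> rat by exact: H.
by move/eqP; rewrite eqr_nat => /eqP.
Qed.

(** Elements $y$ with the same torus are $g\,n_v D(t)$ with $v \in B_n$. For each of the $2^n n!$
    choices of $v$, the requirement that $y^{-1}F(y)$ be the chosen lift of $v^{-1}wv$ is a twisted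
    torus equation in $t$. *)
Lemma card_fibre x : good_pair x ->
  card_is (fun y => good_pair y /\ conj_torus D y.2 = conj_torus D x.2)
    (2 ^ n * n`! * torus_order q x.1).
Proof.
case: x => w g gw; have [/= Gg gF] := gw; have gu := gunit Gg.
have ex v : exists ws : signed_perm n * 'rV[K]_n, [/\ conj_by v ws.1 w, nonzero_coords ws.2 &
    invmx (nw v) *m nw w *m map_mx F (nw v) = nw ws.1 *m D ws.2].
  have [w' vw] := conj_by_exists v w.
  have Gv := Gnw v; have GX : G (invmx (nw v) *m nw w *m map_mx F (nw v)).
    by apply: (cg_mul cg) (GF Gv); apply: (cg_mul cg) (Gnw w); exact: (cg_inv cg).
  have [s s0 sE] := weyl_image_diff (Gnw w') GX (nwP w')
    (weyl_image_conj Gv (GF Gv) (Gnw w) (nwP v) (weyl_image_frob Gv (nwP v)) (nwP w) vw).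
  by exists (w', s).
have [c cP] := choice ex.
pose h (v : signed_perm n) t := g *m nw v *m D t.
have Gh v t : nonzero_coords t -> G (h v t).
  by move=> t0; apply: (cg_mul cg); [exact: (cg_mul cg)|exact: (cg_torus cg)].
have ghE v t : invmx g *m h v t = nw v *m D t by rewrite /h !mulmxA mulVmx // mul1mx.
have hF v t : nonzero_coords t -> invmx (h v t) *m map_mx F (h v t) =
    invmx (D t) *m (nw (c v).1 *m D (c v).2) *m map_mx F (D t).
  move=> t0; have Dt := gunit (cg_torus cg t0); have vu := gunit (Gnw v).
  have [_ _ <-] := cP v.
  have -> : invmx (h v t) = invmx (D t) *m invmx (nw v) *m invmx g.
    rewrite -[LHS]mulmx1; apply: (canLR (mulKmx (gunit (Gh v t t0)))).
    by rewrite /h !mulmxA mulmxK // mulmxK // mulmxV.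
  by rewrite /h !map_mxM -gF !mulmxA.
have hT v t : nonzero_coords t -> conj_torus D (h v t) = conj_torus D g.
  move=> t0; apply/esym/(conj_torus_eqP Gg (Gh v t t0)); exists v.
  by rewrite ghE; exact: weyl_image_diag.
have cS (v : 'S_n * {ffun 'I_n -> bool}) :
    card_is (fun t : 'rV[K]_n => forall i, t 0 i != 0 /\ torus_eq_at q (c v).1 ((c v).2 0) t i) (torus_order q w).
  have [vw s0 _] := cP v; rewrite -(torus_order_conj vw).
  exact: (card_torus_eq q1 qK (c v).1 s0).
have := card_is_pair_fin cS; rewrite sum_nat_const card_prod card_ffun card_bool card_ord.
rewrite card_Sn.
rewrite [(n`! * _)%N]mulnC.
apply: (card_is_bij (f := fun vt => ((c vt.1).1, h vt.1 vt.2))).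
- move=> [v t] /= tP; have t0 : nonzero_coords t by move=> i; case: (tP i).
  split; last exact: hT.
  split=> /=; first exact: Gh.
  rewrite hF //; have [_ s0 _] := cP v.
  by apply/(lang_torus_eq _ s0 t0) => i; case: (tP i).
- move=> [v t] [v' t'] /= tP tP' [_ E].
  have t0 : nonzero_coords t by move=> i; case: (tP i).
  have t'0 : nonzero_coords t' by move=> i; case: (tP' i).
  have E2 : nw v *m D t = nw v' *m D t' by rewrite -!ghE E.
  have vv : v = v'.
    apply: (weyl_image_inj cg (weyl_image_diag (Gnw v) t0 (nwP v))).
    by rewrite E2; exact: weyl_image_diag.
  congr pair => //; move: E2; rewrite vv => E2; apply: (diag_inj cg).
  by apply: (can_inj (mulKmx (gunit (Gnw v')))).
- move=> [w2 y] [[/= Gy yF] /esym yT].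
  have [v yv] := (conj_torus_eqP Gg Gy).1 yT.
  have Gx : G (invmx g *m y) by apply: (cg_mul cg) => //; exact: (cg_inv cg).
  have [t t0 tE] := weyl_image_diff (Gnw v) Gx (nwP v) yv.
  have yE : y = h v t by rewrite /h -mulmxA -tE mulKVmx.
  have [vw s0 _] := cP v.
  have := good_pair_conj gw Gy yv vw; rewrite yF => /(weyl_image_inj cg (nwP w2)) ww.
  exists (v, t) => /=; last by rewrite -yE ww.
  move=> i; split; first exact: t0.
  by apply: (lang_torus_eq (c v).1 s0 t0).1; rewrite -hF // -yE yF ww.
Qed.

Lemma sum_stable_tori (R : comAlgType rat) (z : nat -> bool -> R) :
  \sum_(T \in stable_maximal_tori q G) cycle_weight z (type_repr q G D T) =
  ((hyp_count q n)%:R : rat) *: \sum_(w : 'S_n * {ffun 'I_n -> bool})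
    (((2 ^ n * n`! * torus_order q w)%:R^-1 : rat) *: cycle_weight z w).
Proof.
have cL (w : 'S_n * {ffun 'I_n -> bool}) :=
  card_lang p_prime e_gt0 q_def card_Fq K_closure cg (Gnw w).
have [L [uL _ LP]] := card_is_pair_fin cL.
pose tor (x : ('S_n * {ffun 'I_n -> bool}) * 'M[K]_N) := conj_torus D x.2.
(* Each torus is listed once by [undup]; the sum is then spread over all good pairs, each weighted
   by the inverse of its fibre size. *)
have -> : stable_maximal_tori q G = [set` undup (map tor L)]%classic.
  apply/seteqP; split=> T /=.
    move=> /stable_tori_conj[x /LP xL ->]; rewrite mem_undup; apply/mapP; exists x => //.
  by rewrite mem_undup => /mapP[x /LP xP ->]; apply/stable_tori_conj; exists x.
rewrite -fsbig_seq ?undup_uniq // sum_undup_count big_map.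
rewrite -(sum_by_index (L := L)); last first.
  move=> w; apply: card_is_inj (card_is_count _ uL) _.
  apply: (card_is_bij (f := pair w)) (cL w).
  - by move=> g [Gg gF]; split; [apply/LP|rewrite /= eqxx].
  - by move=> g g' _ _ [].
  - by move=> [w' g] [/LP[Gg gF] /= /eqP <-]; exists g.
apply: eq_big_seq => -[w g] /LP xP; rewrite (type_repr_weight z (w := w) xP).
congr (_ ^-1 *: _); congr (_%:R); rewrite count_map.
apply: card_is_inj (card_is_count _ uL) _.
apply: card_is_eq (card_fibre (x := (w, g)) xP) => y /=.
by split=> [[/LP yL /eqP yT]|[/LP yP /eqP yT]].
Qed.

End SumOverTori.

Section RecursiveSequence.
Variables (R : comAlgType rat) (c : nat -> R).

(** Course-of-values recursion: all earlier terms are kept in the list. *)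
Fixpoint recursive_prefix n : seq R :=
  if n is n'.+1 then
    let s := recursive_prefix n' in
    rcons s ((n'.+1%:R^-1 : rat) *: \sum_(k < n'.+1) c k.+1 * nth 0 s (n' - k)%N)
  else [:: 1].

Lemma exists_recursive_sequence : exists h : nat -> R, h 0%N = 1 /\
  forall n, n.+1%:R * h n.+1 = \sum_(k < n.+1) c k.+1 * h (n - k)%N.
Proof.
have sz n : size (recursive_prefix n) = n.+1.
  by elim: n => //= n IHn; rewrite size_rcons IHn.
have pre n m : (n <= m)%N -> nth 0 (recursive_prefix m) n = nth 0 (recursive_prefix n) n.
  elim: m => [|m IHm]; first by rewrite leqn0 => /eqP ->.
  rewrite leq_eqVlt => /orP[/eqP -> //|nm] /=.
  by rewrite nth_rcons sz nm IHm.
exists (fun n => nth 0 (recursive_prefix n) n); split=> // n /=.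
rewrite nth_rcons sz ltnn eqxx mulr_natl -scaler_nat scalerA mulfV ?pnatr_eq0 // scale1r.
by apply: eq_bigr => k _; rewrite pre // leq_subr.
Qed.

End RecursiveSequence.

(** * The generating series and the product of exponentials *)

Section MainSeries.
Variables (p e q : nat) (p_prime : prime p) (e_gt0 : (0 < e)%N) (q_def : q = (p ^ e)%N).
Variables (Fq : finFieldType) (card_Fq : #|Fq| = q).
Variables (K : closedFieldType) (iota : {rmorphism Fq -> K}).
Hypothesis K_closure : is_algebraic_closure iota.
Variable R : comAlgType rat.
Variables (x y : nat -> R).

(** The case $m=1$ of [card_twisted_fixed]: the $F$-fixed matrices of $Sp_{2n}(K)$ come from
    $F_q$. *)
Lemma card_SpE n : card_Sp Fq n = hyp_count q n.
Proof.
have cg := sp_classical_group K n.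
have cF := card_twisted_fixed p_prime e_gt0 q_def card_Fq K_closure cg (cg_1 cg).
apply: card_is_inj (card_is_fin [pred A : 'M[Fq]_(n + n) | symplectic A]) _.
have mapSp (A : 'M[Fq]_(n + n)) : Sp (map_mx iota A) <-> symplectic A.
  have JE : map_mx iota (sp_form Fq n) = sp_form K n.
    by rewrite /sp_form map_block_mx !map_mx0 map_mxN map_mx1.
  rewrite /Sp /symplectic /= -JE map_trmx -!map_mxM.
  by split=> /eqP; [move/map_mx_inj => ->|move=> ->].
apply: (@card_is_bij _ _ _ _ _ (fun B : 'M[K]_(n + n) =>
   xget 0 [set A | map_mx iota A = B]%classic)) cF.
- move=> B [SpB]; rewrite mul1mx => /fixed_lift[A AB].
  have : exists A, [set A | map_mx iota A = B]%classic A by exists A.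
  by move/(xgetPex 0); move: (xget _ _) => A' /= A'B; rewrite inE; apply/mapSp; rewrite A'B.
- move=> B B' [_]; rewrite mul1mx => /fixed_lift[A AB] [_]; rewrite mul1mx => /fixed_lift[A' A'B'] E.
  have : exists A, [set A | map_mx iota A = B]%classic A by exists A.
  move/(xgetPex 0) => /= <-; rewrite E.
  by apply: (@xgetPex _ 0 [set A | map_mx iota A = B']%classic); exists A'.
- move=> A; rewrite inE => /mapSp SpA; exists (map_mx iota A).
    split=> //; rewrite mul1mx; apply/matrixP => i j; rewrite !mxE; exact: frob_iota.
  have : exists A', [set A' | map_mx iota A' = map_mx iota A]%classic A' by exists A.
  by move/(xgetPex 0) => /= /map_mx_inj.
Qed.

Definition type_var k (b : bool) : R := if b then y k else x k.

Definition torus_weight k (b : bool) : R := ((cycle_order q k b)%:R^-1 : rat) *: type_var k b.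

Lemma torus_weightE n (w : signed_perm n) :
  cycle_weight torus_weight w = ((torus_order q w)%:R^-1 : rat) *: cycle_weight type_var w.
Proof.
by rewrite /cycle_weight scaler_prod /torus_order natr_prod -prodfV.
Qed.

Lemma hyp_count_gt0 n : (0 < hyp_count q n)%N.
Proof.
have q1 := q_gt1 p_prime e_gt0 q_def.
elim: n => //= n IHn; rewrite !muln_gt0 IHn expn_gt0 (ltnW q1) /= andbT.
by rewrite -subn1 subn_gt0 -(expn0 q) ltn_exp2l // muln_gt0.
Qed.

Definition weight_series (S : nat -> R) : fps R :=
  fun n => if n == 0%N then 1 else ((card_Sp Fq n)%:R^-1 : rat) *: S n.

Definition exponent_coef k : R :=
  (((q%:R ^+ k - 1) * (2 * k)%N%:R)^-1 : rat) *: x k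
  + (((q%:R ^+ k + 1) * (2 * k)%N%:R)^-1 : rat) *: y k.

Lemma mean_torus_weight k :
  mean_weight torus_weight k.+1 = k.+1%:R * exponent_coef k.+1.
Proof.
have q1 := q_gt1 p_prime e_gt0 q_def.
have qk1 : (1 < q ^ k.+1)%N by rewrite -(expn0 q) ltn_exp2l.
have cT : (q ^ k.+1).+1%:R = q%:R ^+ k.+1 + 1 :> rat by rewrite -natr1 natrX.
have cF : (q ^ k.+1).-1%:R = q%:R ^+ k.+1 - 1 :> rat.
  by rewrite -subn1 natrB ?natrX // ltnW.
have k0 : k.+1%:R != 0 :> rat by rewrite pnatr_eq0.
have T0 : q%:R ^+ k.+1 + 1 != 0 :> rat by rewrite -cT pnatr_eq0.
have F0 : q%:R ^+ k.+1 - 1 != 0 :> rat by rewrite -cF pnatr_eq0 -lt0n -subn1 subn_gt0.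
rewrite /mean_weight /torus_weight /exponent_coef /type_var /cycle_order.
rewrite mulr_natl -scaler_nat !scalerDr !scalerA cT cF natrM.
move: (k.+1%:R : rat) (q%:R ^+ k.+1 : rat) k0 T0 F0 => d u d0 u1 u0.
by congr (_ *: _ + _ *: _); field; rewrite ?d0 ?u0 ?u1.
Qed.

Section OneGroup.
Variables (N : nat -> nat) (kap : nat -> bool).
Variables (B : forall n, 'cV[K]_(N n) -> 'cV[K]_(N n) -> K) (Q : forall n, 'cV[K]_(N n) -> K).
Variables (G : forall n, set 'M[K]_(N n)) (D : forall n, 'rV[K]_n -> 'M[K]_(N n)).
Variables (idx : forall n, bool -> 'I_n -> 'I_(N n)) (del : forall n, 'rV[K]_n -> 'rV[K]_(N n)).
Hypothesis cg : forall n, classical_group (kap n) (@B n) (@Q n) (@G n) (@D n) (@idx n) (@del n).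

(** [hyp_count] cancels against $|Sp_{2n}(F_q)|$, and $1/|T_w|$ distributes over the cycles of [w],
    which leaves the average computed by [sum_cycle_weight]. *)
Lemma weight_series_prod :
  fps_infinite_prod (fun k => fps_exp (fps_monomial (exponent_coef k) k))
    (weight_series (fun n => \sum_(T \in stable_maximal_tori q (@G n))
      \prod_(1 <= r < n.+1) (x r ^+ torus_X q (@G n) (@D n) r T * y r ^+ torus_Y q (@G n) (@D n) r T))).
Proof.
have [h [h0 hS]] := exists_recursive_sequence (mean_weight torus_weight).
set S := weight_series _.
have SE n : S n = h n.
  rewrite /S /weight_series; case: eqP => [->//|_].
  have -> : \sum_(T \in stable_maximal_tori q (@G n))
      \prod_(1 <= r < n.+1) (x r ^+ torus_X q (@G n) (@D n) r T * y r ^+ torus_Y q (@G n) (@D n) r T) =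
      \sum_(T \in stable_maximal_tori q (@G n)) cycle_weight type_var (type_repr q (@G n) (@D n) T).
    by apply: eq_fsbigr => T _; exact: type_monomialE.
  have /choice[nw nwP] (w : signed_perm n) : exists g, @G n g /\ weyl_image (@D n) g w.
    by have [g Gg gw] := weyl_image_exists (cg n) w; exists g.
  rewrite (sum_stable_tori p_prime e_gt0 q_def card_Fq K_closure (cg n)
    (fun w => (nwP w).1) (fun w => (nwP w).2) type_var).
  rewrite card_SpE scalerA mulVf ?scale1r ?pnatr_eq0 -?lt0n ?hyp_count_gt0 //.
  transitivity (((2 ^ n * n`!)%:R^-1 : rat) *:
    \sum_(w : 'S_n * {ffun 'I_n -> bool}) cycle_weight torus_weight (w : signed_perm n)).
    rewrite scaler_sumr; apply: eq_bigr => w _.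
    by rewrite torus_weightE scalerA natrM invfM.
  rewrite (sum_cycle_weight h0 hS) mulr_natl -scaler_nat scalerA mulVf ?scale1r //.
  by rewrite pnatr_eq0 -lt0n muln_gt0 expn_gt0 fact_gt0.
apply: (infinite_prod_exp (c := mean_weight torus_weight)).
- exact: mean_torus_weight.
- by rewrite SE.
- by move=> n; rewrite SE hS; apply: eq_bigr => k _; rewrite SE.
Qed.

End OneGroup.

End MainSeries.

Theorem theorem3p2 (p e q : nat) (p_prime : prime p) (e_gt0 : (0 < e)%N)
    (q_def : q = (p ^ e)%N)
    (Fq : finFieldType) (card_Fq : #|Fq| = q)
    (K : closedFieldType) (iota : {rmorphism Fq -> K})
    (K_closure : is_algebraic_closure iota) :
  fps_infinite_prod (cycle_factor q)
    (tori_series Fq (fun n => tori_sum q (@Sp K n) (@sp_diag K n)))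
  /\
  fps_infinite_prod (cycle_factor q)
    (tori_series Fq (fun n => tori_sum q (@SO K n) (@so_diag K n))).
Proof.
split.
  exact: (weight_series_prod p_prime e_gt0 q_def card_Fq K_closure varx vary
    (@sp_classical_group K)).
exact: (weight_series_prod p_prime e_gt0 q_def card_Fq K_closure varx vary
  (@so_classical_group K)).
Qed.
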